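(* For $N\ge3$ with $4\nmid N$, define $$\Lambda_N^+=\begin{cases}3,&N=3,\\ \dfrac{5+\sqrt{17}}2,&N=5,\\ k_N+\dfrac32+\sqrt{\left(k_N+\dfrac32\right)^2+2(k_N+\ell_N-3)},&N\notin\{3,5\},\end{cases}$$ $$\Lambda_N^-=\begin{cases}2,&N=3,\\ 1+\sqrt3,&N=5,\\ k_N+\dfrac{\ell_N-1}{2}+\sqrt{\left(k_N+\dfrac{\ell_N-1}{2}\right)^2-2(k_N+\ell_N-3)},&N\notin\{3,5\}.\end{cases}$$ If $0\le\beta<\beta_{\mathrm c,N}$, then for every entry $\mathsf c_m(\beta)$ of the crossing vector $\mathbf C_m^{(N)}(\beta)$ the following limit exists and satisfies $$0<\lim_{m\to\infty}(\Lambda_N^+)^{-m}\log\mathsf c_m(\beta)<\infty.$$ If $\beta>\beta_{\mathrm c,N}$, then for every entry $\mathsf c_m(\beta)$ of $\mathbf C_m^{(N)}(\beta)$ the following limit exists and satisfies $$0<\lim_{m\to\infty}(\Lambda_N^-)^{-m}\bigl(-\log\mathsf c_m(\beta)\bigr)<\infty.$$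
   Context: **Polygonal $N$-gasket.** Let $N\ge3$, $4\nmid N$. Identify $\mathbb R^2$ with $\mathbb C$; $q_j=e^{2\pi\mathrm i j/N}$, $V_0^{(N)}=\{q_j:j\in\mathbb Z/N\mathbb Z\}$, and $F_0^{(N)}$ is the $N$-cycle on $V_0^{(N)}$. Put $k_N=\lfloor N/4\rfloor$, $\ell_N=N-4k_N$, $s_N=k_N+1$, $$\rho_N=\frac{\sin(\pi/N)}{\sin(\pi/N)+\sin((2s_N-1)\pi/N)},\qquad \Psi_j^{(N)}(x)=q_j+\rho_N(x-q_j).$$ With $O=q_0$, $F_m=F_m^{(N)}=\bigcup_{w\in(\mathbb Z/N\mathbb Z)^m}\bigl((\Psi_0^{(N)})^{-m}\circ\Psi^{(N)}_{w_1}\circ\cdots\circ\Psi^{(N)}_{w_m}\bigr)(F_0^{(N)})$ (union of image graphs). Let $a_{j,m}=(\Psi_0^{(N)})^{-m}(q_j)$ and $\partial F_m=\{a_{j,m}:j\in\mathbb Z/N\mathbb Z\}$. **Crossing vector.** A self-avoiding walk $w$ with $L(w)$ edges has weight $e^{-\beta L(w)}$, $\beta\ge0$; a crossing is a self-avoiding walk in $F_m$ between two prescribed distinct vertices of $\partial F_m$; partition functions are sums of weights. - If $N\notin\{3,5\}$: $X_m(\beta)$ is the partition function of crossings from $a_{0,m}$ to $a_{s_N,m}$, $Y_m(\beta)$ that of crossings from $a_{-s_N,m}$ to $a_{s_N,m}$; $\mathbf C_m^{(N)}=(X_m,Y_m)$. - If $N=3$: $x_m$, $y_m$ are the partition functions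 of crossings between two fixed boundary vertices which respectively avoid and visit the third; $\mathbf C_m^{(3)}=(x_m,y_m)$. - If $N=5$: $\phi_{1,m},\phi_{2,m}$ are the partition functions of crossings from $a_{0,m}$ to $a_{2,m}$ which respectively avoid and visit $a_{-2,m}$; $\theta_{1,m},\theta_{2,m}$ those of crossings from $a_{-2,m}$ to $a_{2,m}$ which respectively avoid and visit $a_{0,m}$; $\mathbf C_m^{(5)}=(\phi_{1,m},\phi_{2,m},\theta_{1,m},\theta_{2,m})$. **Critical value $\beta_{\mathrm c,N}$.** A linear forest is an acyclic graph with all degrees at most two. A boundary forest in $F_m$ is a nonempty edge subgraph $\Gamma\subset F_m$ that is a linear forest, all of whose degree-one vertices lie in $\partial F_m$ and each of whose components contains an edge. $\mathcal S$ is the finite set of nonempty linear forests with vertex set in $V_0^{(N)}$ and no isolated vertices. The trace $\operatorname{tr}_m(\Gamma)\in\mathcal S$ is obtained, for each component (a path), by listing the vertices of $\partial F_m$ in the order the path meets them, keeping only these, replacing each portion between consecutive listed vertices by one abstract edge, and relabeling $a_{j,m}$ as $q_j$. For $\sigma\in\mathcal S$, $Z_m^\sigma(\beta)=\sum e^{-\beta\#E(\Gamma)}$ over boundary forests $\Gamma\subset F_m$ with $\operatorname{tr}_m(\Gamma)=\sigma$, $\mathbf Z_m=(Z_m^\sigma)_{\sigma\in\mathcal S}$, and $\beta_{\mathrm c,N}=\inf\{\beta\ge0:\sup_{m\ge0}\|\mathbf Z_m(\beta)\|_\infty<\infty\}$. *)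

(* Defs.v *)
From HB Require Import structures.
From mathcomp Require Import all_boot all_order all_algebra finmap complex.
From mathcomp Require Import all_classical all_reals all_analysis.
Import Order.TTheory GRing.Theory Num.Theory.
Import numFieldNormedType.Exports.

Set Implicit Arguments.
Unset Strict Implicit.
Unset Printing Implicit Defensive.

Local Open Scope classical_set_scope.
Local Open Scope ring_scope.

(* A finite simple graph without isolated vertices is represented by its edge
   set, an edge being the two-element set of its endpoints. *)

Definition adj (T : choiceType) (E : {fset {fset T}}) : rel T :=
  fun x y => [fset x; y]%fset \in E.

Definition degree (T : choiceType) (E : {fset {fset T}}) (x : T) : nat :=
  #|` [fset e in E | x \in e]%fset |.

Definition acyclic (T : choiceType) (E : {fset {fset T}}) : Prop :=
  forall c : seq T, (2 < size c)%N -> uniq c -> ~~ cycle (adj E) c.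

Definition linear_forest (T : choiceType) (E : {fset {fset T}}) : Prop :=
  [/\ forall e, e \in E -> #|` e | = 2%N, acyclic E
    & forall x, (degree E x <= 2)%N].

Definition path_edges (T : choiceType) (p : seq T) : {fset {fset T}} :=
  [fset [fset e.1; e.2] | e in zip p (behead p)]%fset.

(* [p] lists, from one end to the other, the vertices of a connected component
   of [E] which is a path. *)
Definition component_path (T : choiceType) (E : {fset {fset T}}) (p : seq T)
  : Prop :=
  [/\ (1 < size p)%N, uniq p, (path_edges p `<=` E)%fset
    & forall e x, e \in E -> x \in e -> x \in p -> e \in path_edges p].

(* The walk visits [x] and then the vertices of [p] in order; it has [size p]
   edges. *)
Definition saw (T : choiceType) (E : {fset {fset T}}) (x y : T) (p : seq T)
  : bool :=
  [&& path (adj E) x p, uniq (x :: p) & last x p == y].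

Definition image_graph (T T' : choiceType) (f : T -> T') (E : {fset {fset T}})
  : {fset {fset T'}} :=
  [fset (f @` (e : {fset T}))%fset | e in E]%fset.

Definition kN (N : nat) : nat := (N %/ 4)%N.
Definition lN (N : nat) : nat := (N - 4 * kN N)%N.
Definition sN (N : nat) : nat := (kN N).+1.

(* The vertex exp(2 i pi j / N); it depends only on [j] modulo [N]. *)
Definition vertex (R : realType) (N : nat) (j : int) : R[i] :=
  let t := 2 * pi * j%:~R / N%:R in (cos t +i* sin t)%C.

Definition rho (R : realType) (N : nat) : R :=
  sin (pi / N%:R) /
  (sin (pi / N%:R) + sin ((2 * sN N - 1)%N%:R * pi / N%:R)).

Definition homothety (R : realType) (z : R[i]) (r : R) (x : R[i]) : R[i] :=
  z + (r%:C)%C * (x - z).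

Definition Psi (R : realType) (N : nat) (j : int) : R[i] -> R[i] :=
  homothety (vertex R N j) (rho R N).

Definition PsiV (R : realType) (N : nat) (j : int) : R[i] -> R[i] :=
  homothety (vertex R N j) (rho R N)^-1.

Definition base_vertices (R : realType) (N : nat) : {fset R[i]} :=
  [fset vertex R N (nat_of_ord i)%:Z | i in 'I_N]%fset.

Definition base_cycle (R : realType) (N : nat) : {fset {fset R[i]}} :=
  [fset [fset vertex R N (nat_of_ord i)%:Z; vertex R N ((nat_of_ord i)%:Z + 1)]
  | i in 'I_N]%fset.

Definition cell (R : realType) (N m : nat) (w : m.-tuple 'I_N) (x : R[i])
  : R[i] :=
  iter m (PsiV N 0) (foldr (fun i : 'I_N => Psi N (i : nat)%:Z) x w).

Definition gasket (R : realType) (N m : nat) : {fset {fset R[i]}} :=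
  (\bigcup_(w in {: m.-tuple 'I_N}) image_graph (cell w) (base_cycle R N))%fset.

Definition corner (R : realType) (N m : nat) (j : int) : R[i] :=
  iter m (PsiV N 0) (vertex R N j).

Definition bdry (R : realType) (N m : nat) : {fset R[i]} :=
  [fset corner R N m (nat_of_ord i)%:Z | i in 'I_N]%fset.

(* The index set is finite, since walks in [gasket R N m] are self-avoiding. *)
Definition crossing_sum (R : realType) (N m : nat) (beta : R) (x y : R[i])
    (P : pred (seq R[i])) : R :=
  \sum_(p \in [set p | saw (gasket R N m) x y p && P (x :: p)])
    expR (- beta * (size p)%:R).

Definition crossing_vector (R : realType) (N : nat) : seq (nat -> R -> R) :=
  let Z (i j : int) (P : nat -> pred (seq R[i])) m beta :=
    crossing_sum N m beta (corner R N m i) (corner R N m j) (P m) in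
  let any m := predT in
  let avoids k m := [pred p : seq R[i] | corner R N m k \notin p] in
  let visits k m := [pred p : seq R[i] | corner R N m k \in p] in
  let s := (sN N)%:Z in
  if N == 3%N then
    [:: Z 0 1 (avoids 2); Z 0 1 (visits 2)]
  else if N == 5%N then
    [:: Z 0 2 (avoids (- 2)); Z 0 2 (visits (- 2));
        Z (- 2) 2 (avoids 0); Z (- 2) 2 (visits 0)]
  else [:: Z 0 s any; Z (- s) s any].

Definition boundary_forest (R : realType) (N m : nat) (G : {fset {fset R[i]}})
  : Prop :=
  [/\ (G `<=` gasket R N m)%fset, G != fset0, linear_forest G
    & forall x, degree G x = 1%N -> x \in bdry R N m].

(* Each portion of a component between consecutive boundary vertices becomes
   one edge. The relabeling of [corner R N m j] as [vertex R N j] is the [m]-th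
   iterate of [Psi N 0]; it sends the boundary into [base_vertices R N], so
   restricting to [fpowerset (base_vertices R N)] discards nothing. *)
Definition trace (R : realType) (N m : nat) (G : {fset {fset R[i]}})
  : {fset {fset R[i]}} :=
  [fset e in fpowerset (base_vertices R N) |
    `[< exists2 p, component_path G p &
          e \in path_edges [seq iter m (Psi N 0) x | x <- p & x \in bdry R N m]
      >]]%fset.

Definition skeletons (R : realType) (N : nat) : {fset {fset {fset R[i]}}} :=
  [fset sigma in fpowerset (fpowerset (base_vertices R N)) |
    `[< sigma != fset0 /\ linear_forest sigma >]]%fset.

Definition forest_sum (R : realType) (N m : nat) (beta : R)
    (sigma : {fset {fset R[i]}}) : R :=
  \sum_(G \in [set G | boundary_forest N m G /\ trace N m G = sigma])
    expR (- beta * #|` G |%:R).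

Definition Znorm (R : realType) (N m : nat) (beta : R) : R :=
  \big[Num.max/0]_(sigma <- skeletons R N) `|forest_sum N m beta sigma|.

(* Infimum in the extended reals, so that no convention is needed for an
   empty set. *)
Definition betac (R : realType) (N : nat) : \bar R :=
  ereal_inf [set beta%:E | beta in
    [set beta : R | 0 <= beta /\ has_ubound (range (fun m => Znorm N m beta))]].

Definition LambdaP (R : realType) (N : nat) : R :=
  let k := (kN N)%:R in let l := (lN N)%:R in
  if N == 3%N then 3
  else if N == 5%N then (5 + Num.sqrt 17) / 2
  else k + 3 / 2 + Num.sqrt ((k + 3 / 2) ^+ 2 + 2 * (k + l - 3)).

Definition LambdaM (R : realType) (N : nat) : R :=
  let k := (kN N)%:R in let l := (lN N)%:R in
  if N == 3%N then 2
  else if N == 5%N then 1 + Num.sqrt 3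
  else k + (l - 1) / 2
       + Num.sqrt ((k + (l - 1) / 2) ^+ 2 - 2 * (k + l - 3)).

(* Main.v *)
(* Cut [F_(m+1)] into its N copies of [F_m]. They form a ring in which two
   consecutive copies share one vertex and no other two meet, so a crossing
   of [F_(m+1)] goes around the ring in one of two ways and factors into
   crossings of the copies. This gives closed polynomial recursions for the
   crossing vector. The trace of a boundary forest of [F_(m+1)] on a copy is
   empty or a single path between two of three vertices, so the partition
   functions Z are bounded by a polynomial in X and Y; conversely a crossing is
   a boundary forest, hence beta_c separates bounded from unbounded crossing
   vectors. Below beta_c the recursions force X and Y to be at least 1 at some
   level; from then on the monomials of highest degree dominate, and log X,
   log Y follow, up to bounded errors, a linear recursion whose largest
   eigenvalue is Lambda^+. Above beta_c, compare with some beta' in between: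
   crossings of [F_m] have length tending to infinity, so X and Y tend to 0, the
   monomials of lowest degree dominate, and the eigenvalue is Lambda^-. *)
Require Import Defs.
From HB Require Import structures.
From mathcomp Require Import all_boot all_order all_algebra finmap complex.
From mathcomp Require Import all_classical all_reals all_analysis.
From mathcomp Require Import ring lra zify.
Import Order.TTheory GRing.Theory Num.Theory.
Import numFieldNormedType.Exports.

Set Implicit Arguments.
Unset Strict Implicit.
Unset Printing Implicit Defensive.

Local Open Scope classical_set_scope.
Local Open Scope ring_scope.

(** * Finite sums and self-avoiding walks *)

(** That the cells form a ring is proved with the linear form [gap i j], the difference of the inner
    products with two corners. All maps [Psi] contract by the same ratio, so the minimum of [gap]
    over the whole gasket is already attained at a corner, and separating the cells reduces to
    inequalities between sines. That 4 does not divide [N] makes the extremal corner, hence the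
    contact point of two cells, unique. The obstacle to a plain product formula is the closing of
    the ring. If the two end cells of a crossing are neighbours, the walk that goes the long way
    around may meet their common vertex in both, and such pairs must be removed. This affects the
    recursions for [N = 3] and [N = 5] only, and explains why crossings are split there by their
    visits to a third corner. Convergence alone would allow a zero limit. Positivity needs the
    logarithms to pass a threshold set by the bounded errors. Below the critical value this follows
    from a dichotomy: either the crossings reach 1, after which they grow without bound, or they
    stay bounded at all levels, which the definition of [betac] excludes. *)

Section FiniteSums.
Context {R : realType}.

Lemma ler_fsum (I : choiceType) (A : set I) (f g : I -> R) :
  finite_set A -> (forall i, A i -> f i <= g i) ->
  \sum_(i \in A) f i <= \sum_(i \in A) g i.
Proof.
move=> fA fg; rewrite !fsbig_finite //= big_seq [leRHS]big_seq.
by apply: ler_sum => i; rewrite in_fset_set // inE => /fg.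
Qed.

Lemma ler_fsum_sub (I : choiceType) (A B : set I) (f : I -> R) :
  finite_set B -> A `<=` B -> (forall i, B i -> 0 <= f i) ->
  \sum_(i \in A) f i <= \sum_(i \in B) f i.
Proof.
move=> fB sAB f0; rewrite (fsbigID A B) //= (_ : B `&` A = A).
  by rewrite lerDl; apply: fsumr_ge0 => i [/f0].
by apply/seteqP; split=> [i []|i Ai] //; split=> //; exact: sAB.
Qed.

Lemma ler_fsum_term (I : choiceType) (A : set I) (f : I -> R) i :
  finite_set A -> (forall j, A j -> 0 <= f j) -> A i -> f i <= \sum_(j \in A) f j.
Proof.
move=> fA f0 Ai; apply: (@le_trans _ _ (\sum_(j \in [set i]) f j)).
  by rewrite fsbig_set1.
by apply: ler_fsum_sub => // j ->.
Qed.

Lemma ler_fsum_inj (I J : choiceType) (A : set I) (B : set J) (h : I -> J)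
    (f : I -> R) (g : J -> R) :
  finite_set A -> finite_set B -> set_inj A h ->
  (forall i, A i -> B (h i) /\ f i <= g (h i)) ->
  (forall j, B j -> 0 <= g j) ->
  \sum_(i \in A) f i <= \sum_(j \in B) g j.
Proof.
move=> fA fB injh hAB g0.
apply: (@le_trans _ _ (\sum_(i \in A) g (h i))).
  by apply: ler_fsum => // i /hAB [].
rewrite -(fsbig_image _ _ g injh); apply: ler_fsum_sub => //.
by move=> _ [i Ai <-]; case: (hAB i Ai).
Qed.

Lemma fsum_mul (I J : choiceType) (A : set I) (B : set J) (f : I -> R)
    (g : J -> R) :
  finite_set A -> finite_set B ->
  (\sum_(i \in A) f i) * (\sum_(j \in B) g j) =
  \sum_(p \in A `*` B) f p.1 * g p.2.
Proof.
move=> fA fB; rewrite -(pair_fsbig _ (fun i j => f i * g j)) //.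
by rewrite mulr_fsuml; apply: eq_fsbigr => i _; rewrite mulr_fsumr.
Qed.

(** Each index picks one label and one preimage under it; peeling off one label at a time turns this
    choice into injections. [j0] is only the default value of the choice function where no preimage
    exists. *)
Lemma ler_fsum_cover (I J : choiceType) (K : eqType) (A : set I) (L : seq K)
    (B : K -> set J) (h : K -> J -> I) (f : I -> R) (g : J -> R) (j0 : J) :
  finite_set A -> (forall k, finite_set (B k)) -> (forall j, 0 <= g j) ->
  (forall i, A i -> exists2 k, k \in L & exists2 j, B k j & h k j = i /\ f i <= g j) ->
  \sum_(i \in A) f i <= \sum_(k <- L) \sum_(j \in B k) g j.
Proof.
move=> fA fB g0; elim: L A fA => [|k L IH] A fA cover.
  rewrite big_nil (_ : A = set0) ?fsbig_set0 //.
  by apply/seteqP; split=> // i /cover [].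
rewrite big_cons.
pose D i := exists2 j, B k j & h k j = i /\ f i <= g j.
rewrite (fsbigID D) //; apply: lerD; last first.
  apply: IH; first exact: finite_setIl.
  move=> i [Ai nDi]; have [k' + jj] := cover i Ai.
  by rewrite inE => /orP [/eqP kk|k'L]; [subst k'; case: nDi | exists k'].
have [s sP] : exists s, forall i, D i -> B k (s i) /\ (h k (s i) = i /\ f i <= g (s i)).
  have /choice [s sP] : forall i, exists j, D i -> B k j /\ (h k j = i /\ f i <= g j).
    move=> i; have [[j Bj hj]|nD] := pselect (D i); first by exists j.
    by exists j0.
  by exists s.
apply: (@ler_fsum_inj _ _ _ _ s) => //; first exact: finite_setIl.
  move=> i i' /set_mem [_ /sP [_ [hi _]]] /set_mem [_ /sP [_ [hi' _]]] e.
  by rewrite -hi -hi' e.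
by move=> i [_ /sP [? [? ?]]].
Qed.

End FiniteSums.

Section Walks.
Context {T : choiceType}.
Implicit Types (E A H : {fset {fset T}}) (x y c d : T) (p q : seq T)
  (S : pred T).

Definition vtx E : {fset T} := (\bigcup_(e <- E) e)%fset.

Lemma vtxP E x : reflect (exists2 e, e \in E & x \in e) (x \in vtx E).
Proof.
rewrite /vtx; apply: (iffP (bigfcupP _ _ _ _)).
  by move=> [e /andP [eE _] xe]; exists e.
by move=> [e eE xe]; exists e => //; rewrite eE.
Qed.

Lemma adj_sym E : symmetric (adj E).
Proof. by move=> x y; rewrite /adj fsetUC. Qed.

Lemma adj_vtx E x y : adj E x y -> (x \in vtx E) && (y \in vtx E).
Proof.
move=> Exy; apply/andP; split; apply/vtxP; exists [fset x; y]%fset => //;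
by rewrite !inE eqxx ?orbT.
Qed.

Lemma path_vtx E x p : path (adj E) x p -> {subset p <= vtx E}.
Proof.
elim: p x => [|y p IH] x //= /andP [/adj_vtx /andP [_ yE] /IH pE] z.
by rewrite inE => /orP [/eqP ->|/pE].
Qed.

Lemma adj_sub A H : (A `<=` H)%fset -> subrel (adj A) (adj H).
Proof. by move=> AH x y; apply: (fsubsetP AH). Qed.

Lemma adjU A H x y : adj (A `|` H)%fset x y = adj A x y || adj H x y.
Proof. by rewrite /adj inE. Qed.

Lemma saw_vtx E x y p z : saw E x y p -> x != y -> z \in x :: p -> z \in vtx E.
Proof.
move=> /and3P [pp _ /eqP <-]; case: p pp => [|w p] /=; first by rewrite eqxx.
move=> /andP [xw pp] _; rewrite inE => /orP [/eqP ->|].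
  by case/andP: (adj_vtx xw).
by apply: (@path_vtx _ x); rewrite /= xw.
Qed.

Lemma finite_uniq_seqs (V : {fset T}) :
  finite_set [set p : seq T | uniq p /\ {subset p <= V}].
Proof.
have fn n : finite_set [set p : seq T | size p = n /\ {subset p <= V}].
  elim: n => [|n IH].
    apply: (@sub_finite_set _ _ [set [::]]); last exact: finite_set1.
    by move=> p [/size0nil ->].
  apply: (@sub_finite_set _ _ ((fun z => z.1 :: z.2) @`
     ([set` V] `*` [set p : seq T | size p = n /\ {subset p <= V}]))).
    case=> [|a p] [] // [sp] pV; exists (a, p) => //; split => /=.
      by apply: pV; rewrite inE eqxx.
    by split=> // z zp; apply: pV; rewrite inE zp orbT.
  by apply/finite_image/finite_setX => //; exact: finite_fset.
apply: (@sub_finite_set _ _ (\bigcup_(n in `I_(#|` V|.+1))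
  [set p : seq T | size p = n /\ {subset p <= V}])); last first.
  by apply: bigcup_finite => // n _; exact: fn.
move=> p [up pV]; exists (size p) => //=.
rewrite ltnS -(undup_id up) -card_fseq.
by apply: fsubset_leq_card; apply/fsubsetP => z; rewrite !inE; exact: pV.
Qed.

(** [S] collects forbidden vertices, the starting point included in the test. Free crossings
    ([pred0]) and crossings that avoid a corner are thus treated together. *)
Definition saws E x y S : set (seq T) :=
  [set p | saw E x y p && all (predC S) (x :: p)].

Lemma finite_saws E x y S : finite_set (saws E x y S).
Proof.
apply: sub_finite_set (finite_uniq_seqs (vtx E)) => p /andP [/and3P [pp up _] _].
by split; [case/andP: up | exact: path_vtx pp].
Qed.

Lemma path_exit A H x p : path (adj (A `|` H)%fset) x p ->
  path (adj A) x p \/ exists p1 z p2,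
    [/\ p = p1 ++ z :: p2, path (adj A) x p1, adj H (last x p1) z
      & ~~ adj A (last x p1) z].
Proof.
elim: p x => [|y p IH] x //=; first by left.
move=> /andP []; rewrite adjU => Exy pp.
have [Axy|nAxy] := boolP (adj A x y); last first.
  by right; exists [::], y, p; split=> //; rewrite (negbTE nAxy) in Exy.
case: (IH _ pp) => [Ap|[p1 [z [p2 [-> Ap1 Hz nAz]]]]].
  by left.
by right; exists (y :: p1), z, p2; rewrite /= Axy.
Qed.

Lemma saw_subset A H x y p : (A `<=` H)%fset -> saw A x y p -> saw H x y p.
Proof.
move=> AH /and3P [pp up lp]; apply/and3P; split=> //.
exact: sub_path (adj_sub AH) _ _ pp.
Qed.

Lemma last_uniq x p1 p2 : uniq (x :: p1 ++ p2) -> uniq (last x p1 :: p2).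
Proof.
elim: p1 x => [|a p1 IH] x //= => /andP [_ u]; exact: IH.
Qed.

Lemma uniq_last x p1 z p2 : uniq (x :: p1 ++ z :: p2) ->
  last x (p1 ++ z :: p2) != last x p1.
Proof.
move=> /last_uniq /= /andP [h _]; rewrite last_cat /=.
by apply: contraNneq h => <-; exact: mem_last.
Qed.

(* Once the walk has moved from [A] to [H] through one of [c] and [d], it
   could only come back to [A] through the other one, and it would then be
   trapped in [A]. *)
Lemma saw_leave A H x y c d p :
  (forall z, z \in vtx A -> z \in vtx H -> z \in [:: c; d]) ->
  x \notin vtx H -> y \notin vtx A -> x != y ->
  saw (A `|` H)%fset x y p ->
  exists p1 p2, [/\ p = p1 ++ p2, last x p1 \in [:: c; d],
    saw A x (last x p1) p1 & saw H (last x p1) y p2].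
Proof.
move=> AHcd xH yA xy /and3P [pp up /eqP lp].
case: (path_exit pp) => [Ap|[p1 [z [p2 [pE Ap1 Hz nAz]]]]].
  case/negP: yA; rewrite -lp; case: p {pp up} lp Ap => [|a p] /= => [yx|_ xa].
    by rewrite yx eqxx in xy.
  by apply: (@path_vtx A x (a :: p)) => //; exact: mem_last.
set e := last x p1 in Hz nAz *.
have eH : e \in vtx H by case/andP: (adj_vtx Hz).
have eA : e \in vtx A.
  move: xH; rewrite /e; case: p1 Ap1 {pE Hz nAz} @e eH => [|a p1] /=.
    by move=> _ ->.
  by move=> xa _ _; apply: (@path_vtx A x (a :: p1)) => //; exact: mem_last.
have ue : uniq (e :: z :: p2) by apply: last_uniq; rewrite -pE.
have le : last z p2 = y by rewrite -lp pE last_cat.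
exists p1, (z :: p2); split => //; first exact: AHcd.
  apply/and3P; split=> //; move: up; rewrite pE -cat_cons cat_uniq.
  by case/and3P.
apply/and3P; split; rewrite //= ?le //.
have ppe : path (adj (H `|` A)%fset) e (z :: p2).
  by move: pp; rewrite fsetUC pE cat_path => /andP [].
case: (path_exit ppe) => [//|[r1 [w [r2 [rE Hr1 Aw nHw]]]]].
case: r1 => [|z' r1] in rE Hr1 Aw nHw *.
  by case: rE => zw _; rewrite -zw Hz in nHw.
set f := last e (z' :: r1) in Aw nHw *.
have fA : f \in vtx A by case/andP: (adj_vtx Aw).
have fH : f \in vtx H by exact: (path_vtx Hr1 (mem_last z' r1)).
have uf : uniq (f :: w :: r2) by apply: last_uniq; rewrite -rE.
have fe : f != e.
  move: ue => /= /andP [h _]; apply: contraNneq h => <-.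
  by rewrite rE mem_cat; apply/orP; left; exact: (mem_last z' r1).
have lf : last f (w :: r2) = y by rewrite -le -[LHS](last_cat e) -rE.
have ppf : path (adj (A `|` H)%fset) f (w :: r2).
  by move: ppe; rewrite fsetUC rE cat_path => /andP [].
case: (path_exit ppf) => [Ap|[s1 [v [s2 [sE As1 Hv nAv]]]]].
  by case/negP: yA; rewrite -lf; exact: (path_vtx Ap (mem_last w r2)).
case: s1 => [|w' s1] in sE As1 Hv nAv *.
  by case: sE => wv _; rewrite -wv Aw in nAv.
set g := last f (w' :: s1) in Hv nAv *.
have gH : g \in vtx H by case/andP: (adj_vtx Hv).
have gA : g \in vtx A by exact: (path_vtx As1 (mem_last w' s1)).
have gw : g \in w :: r2.
  by rewrite sE mem_cat; apply/orP; left; exact: (mem_last w' s1).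
have gf : g != f.
  by move: uf => /= /andP [h _]; apply: contraNneq h => <-.
have ge : g != e.
  move: ue => /= /andP [h _]; apply: contraNneq h => <-.
  by rewrite rE mem_cat gw orbT.
(* The exit [e], the return [f] and the second exit [g] would be three distinct vertices common to
   [A] and [H], which share at most two. *)
move: (AHcd _ eA eH) (AHcd _ fA fH) (AHcd _ gA gH) fe gf ge; rewrite !inE.
by do 3 case/orP => /eqP ->; rewrite ?eqxx.
Qed.

(** The junction [c] is used once, so [e] is the only vertex at which the two halves can still
    collide. *)
Lemma saw_cat A H x y e c p1 p2 :
  (forall z, z \in vtx A -> z \in vtx H -> z \in [:: c; e]) ->
  x \notin vtx H -> ~~ ((e \in p1) && (e \in p2)) ->
  saw A x c p1 -> saw H c y p2 -> saw (A `|` H)%fset x y (p1 ++ p2).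
Proof.
move=> AHce xH eN /and3P [pp1 up1 /eqP lp1] /and3P [pp2 up2 lp2].
apply/and3P; split; last by rewrite last_cat lp1.
  rewrite cat_path lp1; apply/andP; split.
    by apply: sub_path pp1; apply: adj_sub; exact: fsubsetUl.
  by apply: sub_path pp2; apply: adj_sub; exact: fsubsetUr.
rewrite -cat_cons cat_uniq up1 /=; move: up2 => /= /andP [cp2 ->].
rewrite andbT; apply/hasPn => z zp2; have zH := path_vtx pp2 zp2.
rewrite inE; apply/norP; split; first by apply: contraNneq xH => <-.
apply/negP => zp1; have := AHce z (path_vtx pp1 zp1) zH.
rewrite !inE => /orP [] /eqP ze; first by rewrite -ze zp2 in cp2.
by rewrite -ze zp1 zp2 in eN.
Qed.

Lemma cat_prefix p1 p2 q1 q2 : p1 ++ p2 = q1 ++ q2 -> (size p1 <= size q1)%N ->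
  exists2 r, q1 = p1 ++ r & p2 = r ++ q2.
Proof.
move=> e s; exists (drop (size p1) q1).
  rewrite -{1}(cat_take_drop (size p1) q1); congr (_ ++ _).
  by rewrite -(takel_cat q2 s) -e take_size_cat.
have := congr1 (drop (size p1)) e; rewrite drop_size_cat // drop_cat => ->.
case: ltngtP s => // ->; by rewrite subnn drop_size drop0.
Qed.

(** The cutting place is recovered as the unique position of [c]: if one first half were a strict
    prefix of the other, the longer one would visit [c] twice. *)
Lemma cat_saw_inj A H x y y' c p1 p2 q1 q2 :
  saw A x c p1 -> saw H c y p2 -> saw A x c q1 -> saw H c y' q2 ->
  p1 ++ p2 = q1 ++ q2 -> p1 = q1 /\ p2 = q2.
Proof.
move=> /and3P [_ up1 /eqP lp1] /and3P [_ up2 _].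
move=> /and3P [_ uq1 /eqP lq1] /and3P [_ uq2 _].
have main (r1 r2 s1 s2 : seq T) : uniq (x :: s1) -> last x s1 = c ->
    last x r1 = c ->
    r1 ++ r2 = s1 ++ s2 -> (size r1 <= size s1)%N -> s1 = r1 /\ s2 = r2.
  move=> us ls lr e sz; case: (cat_prefix e sz) => r sE ->.
  case: r sE => [|z r] sE; first by rewrite cats0 in sE; rewrite sE.
  move: (@uniq_last x r1 z r); rewrite -sE us ls lr eqxx => h.
  by have := h isT.
move=> e; case: (leqP (size p1) (size q1)) => sz.
  by case: (main _ _ _ _ uq1 lq1 lp1 e sz) => -> ->.
by case: (main _ _ _ _ up1 lp1 lq1 (esym e) (ltnW sz)) => -> ->.
Qed.

(** If the two cuts differ, the edge that follows the earlier cut lies in [H] for one decomposition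
    and in [A] for the other. *)
Lemma cat_saw_disj A H x y y' c d p1 p2 q1 q2 :
  (forall u v, adj A u v -> ~~ adj H u v) -> c != d ->
  saw A x c p1 -> saw H c y p2 -> saw A x d q1 -> saw H d y' q2 ->
  p1 ++ p2 <> q1 ++ q2.
Proof.
move=> AH cd /and3P [pp1 _ /eqP lp1] /and3P [pp2 _ _].
move=> /and3P [pq1 _ /eqP lq1] /and3P [pq2 _ _].
have main (r1 r2 s1 s2 : seq T) e f : e != f -> last x r1 = e ->
    last x s1 = f -> path (adj A) x s1 -> path (adj H) e r2 ->
    r1 ++ r2 = s1 ++ s2 -> (size r1 <= size s1)%N -> False.
  move=> ef lr ls ps pr E sz; case: (cat_prefix E sz) => -[|z r] sE rE.
    by rewrite -lr -ls sE cats0 eqxx in ef.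
  move: ps; rewrite sE cat_path lr => /andP [_ /= /andP [/AH nH _]].
  by move: pr nH; rewrite rE /= => /andP [->].
move=> e; case: (leqP (size p1) (size q1)) => sz.
  exact: (main _ _ _ _ _ _ cd lp1 lq1 pq1 pp2 e sz).
by apply: (main _ _ _ _ _ _ _ lq1 lp1 pp1 pq2 (esym e) (ltnW sz)); rewrite eq_sym.
Qed.

Lemma saw_end A x y p : saw A x y p -> x != y -> (x \in vtx A) && (y \in vtx A).
Proof.
move=> sp xy; rewrite !(saw_vtx sp xy) ?inE ?eqxx //.
by case/and3P: sp => _ _ /eqP <-; rewrite -in_cons mem_last.
Qed.

End Walks.

(** * Images of graphs under maps of vertices *)

Section ImageGraphs.

Lemma imfset_pair (T T' : choiceType) (f : T -> T') (x y : T) :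
  (f @` [fset x; y])%fset = [fset f x; f y]%fset.
Proof.
apply/fsetP => z; rewrite !inE; apply/imfsetP/orP => [[u /=]|].
  by rewrite !inE => /orP [] /eqP -> ->; [left|right].
by move=> [] /eqP ->; [exists x|exists y]; rewrite //= !inE eqxx ?orbT.
Qed.

Lemma imfset_inj (T T' : choiceType) (f : T -> T') : injective f ->
  injective (fun e : {fset T} => f @` e)%fset.
Proof.
by move=> fi e e' /fsetP ee; apply/fsetP => z; have := ee (f z); rewrite !mem_imfset.
Qed.

Lemma image_graphP (T T' : choiceType) (f : T -> T') (E : {fset {fset T}}) e :
  reflect (exists2 e', e' \in E & e = (f @` (e' : {fset T}))%fset)
    (e \in image_graph f E).
Proof. exact: imfsetP. Qed.

Lemma eq_image_graph (T T' : choiceType) (f g : T -> T') (E : {fset {fset T}}) :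
  f =1 g -> image_graph f E = image_graph g E.
Proof.
move=> fg; apply/fsetP => e; apply/image_graphP/image_graphP => -[e' eE ->];
by exists e' => //; apply/fsetP => z; apply/imfsetP/imfsetP => -[y /= ye ->];
  exists y => //; rewrite fg.
Qed.

Lemma image_graph_comp (T T' T'' : choiceType) (f : T' -> T'') (g : T -> T')
    (E : {fset {fset T}}) :
  image_graph f (image_graph g E) = image_graph (f \o g) E.
Proof.
rewrite /image_graph -imfset_comp; apply: eq_imfset => // e /=.
by rewrite -imfset_comp.
Qed.

Lemma vtx_image_graph (T T' : choiceType) (f : T -> T') (E : {fset {fset T}}) (x : T') :
  reflect (exists2 y, y \in vtx E & x = f y) (x \in vtx (image_graph f E)).
Proof.
apply: (iffP (vtxP _ _)) => [[_ /image_graphP [e eE ->] /imfsetP [y /= ye ->]]|].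
  by exists y => //; apply/vtxP; exists e.
move=> [y /vtxP [e eE ye] ->]; exists (f @` (e : {fset T}))%fset.
  by apply/image_graphP; exists e.
by apply/imfsetP; exists y.
Qed.

End ImageGraphs.

(** * Walk sums and how they factor when graphs are glued *)

Section WalkSums.
Context {R : realType} {T : choiceType} (w : R).
Implicit Types (E A H : {fset {fset T}}) (x y c d : T) (p q : seq T)
  (S : pred T).

Definition walk_sum E x y S : R := \sum_(p \in saws E x y S) w ^+ size p.

Definition visit_sum E x y S d : R :=
  \sum_(p \in saws E x y S `&` [set p | d \in x :: p]) w ^+ size p.

Lemma walk_sumE E x y S d :
  walk_sum E x y S = walk_sum E x y [predU1 d & S] + visit_sum E x y S d.
Proof.
rewrite /walk_sum (fsbigID [set p | d \in x :: p]) //=; last exact: finite_saws.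
rewrite addrC; congr (_ + _); apply: eq_fsbigl; apply/seteqP; split=> p.
  move=> [/andP [sp /allP ap] /= /negP dp]; rewrite /saws /= sp /=.
  have H z : z \in x :: p -> ~~ ((z == d) || S z).
    move=> zp; have /= Sz := ap _ zp; rewrite negb_or Sz andbT.
    by apply: contra dp => /eqP <-.
  by apply/andP; split; [apply: H; exact: mem_head
    | apply/allP => z zp; apply: H; rewrite inE zp orbT].
move=> /andP [sp /allP ap]; split.
  apply/andP; split=> //; apply/allP => z zp.
  by have /= := ap _ zp; rewrite negb_or => /andP [].
by move=> /= dp; have /= := ap _ dp; rewrite eqxx.
Qed.

Lemma eq_walk_sum E x y S S' : x != y -> {in vtx E, S =1 S'} ->
  walk_sum E x y S = walk_sum E x y S'.
Proof.
move=> xy SS'; apply: eq_fsbigl; apply/seteqP; split=> p /andP [sp /allP ap];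
apply/andP; split=> //; apply/allP => z zp;
by have := ap _ zp; rewrite /= (SS' z (saw_vtx sp xy zp)).
Qed.

Lemma walk_sum_eq0 E x y S : x != y -> (x \notin vtx E) || (y \notin vtx E) ->
  walk_sum E x y S = 0.
Proof.
move=> xy xyE; rewrite /walk_sum (_ : saws _ _ _ _ = set0) ?fsbig_set0 //.
apply/seteqP; split=> // p /andP [sp _].
by case/andP: (saw_end sp xy) => xE yE; rewrite xE yE in xyE.
Qed.

Lemma visit_sum_eq0 E x y S d : x != y -> d \notin vtx E ->
  visit_sum E x y S d = 0.
Proof.
move=> xy dE; rewrite /visit_sum (_ : _ `&` _ = set0) ?fsbig_set0 //.
apply/seteqP; split=> // p [/andP [sp _] /= dp].
by rewrite (saw_vtx sp xy dp) in dE.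
Qed.

(* The two sums run over the ways to leave [A]; the subtracted products count
   the pairs of walks that meet again at the other common vertex. *)
Lemma walk_sum_peel A H x y c d S :
  (forall z, z \in vtx A -> z \in vtx H -> z \in [:: c; d]) ->
  (forall u v, adj A u v -> ~~ adj H u v) -> c != d ->
  x \notin vtx H -> y \notin vtx A -> x != y -> c \in vtx H -> d \in vtx H ->
  walk_sum (A `|` H)%fset x y S =
  (walk_sum A x c S * walk_sum H c y S - visit_sum A x c S d * visit_sum H c y S d) +
  (walk_sum A x d S * walk_sum H d y S - visit_sum A x d S c * visit_sum H d y S c).
Proof.
move=> AHcd AH cd xH yA xy cH dH.
pose D e f := (saws A x e S `*` saws H e y S) `&`
  [set p : seq T * seq T | ~~ ((f \in p.1) && (f \in p.2))].
pose ct (p : seq T * seq T) := p.1 ++ p.2.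
have DE : saws (A `|` H)%fset x y S = ct @` D c d `|` ct @` D d c.
  apply/seteqP; split=> p; last first.
    have main e f : (forall z, z \in vtx A -> z \in vtx H -> z \in [:: e; f]) ->
      (ct @` D e f) p -> saws (A `|` H)%fset x y S p.
      move=> AHef [[p1 p2] /= [[/andP [s1 a1] /andP [s2 a2]] N] <-].
      rewrite /saws /= /ct /= (saw_cat AHef xH N s1 s2) /= all_cat.
      by move: a1 a2 => /= /andP [-> ->] /andP [_ ->].
    case; apply: main => // z zA zH; move: (AHcd z zA zH).
    by rewrite !inE orbC.
  move=> /andP [sp ap].
  have [p1 [p2 [pE ecd s1 s2]]] := saw_leave AHcd xH yA xy sp.
  have [a1 a2] : all (predC S) (x :: p1) /\ all (predC S) (last x p1 :: p2).
    move: ap; rewrite pE -cat_cons all_cat => /andP [a1 a2]; split => //.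
    by rewrite /= a2 andbT; apply: (allP a1); exact: mem_last.
  have N f : ~~ ((f \in p1) && (f \in p2)).
    apply/negP => /andP [f1 f2]; move: sp => /and3P [_ + _].
    rewrite pE -cat_cons cat_uniq => /and3P [_ /hasPn h _].
    by have := h _ f2; rewrite inE f1 orbT.
  move: ecd; rewrite !inE => /orP [] /eqP e; [left|right]; exists (p1, p2) => //;
  by rewrite e in s1 s2 a2; split; rewrite /= ?N //; split; apply/andP.
have fD e f : finite_set (D e f).
  by apply: finite_setIl; apply: finite_setX; exact: finite_saws.
have Dinj e f : set_inj (D e f) ct.
  move=> [p1 p2] [q1 q2] /set_mem [[/andP [s1 _] /andP [s2 _]] _].
  move=> /set_mem [[/andP [t1 _] /andP [t2 _]] _] /= E.
  by have /= [-> ->] := cat_saw_inj s1 s2 t1 t2 E.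
have Dsum e f : e \in vtx H -> f \in vtx H -> e != f ->
    \sum_(p \in ct @` D e f) w ^+ size p =
    walk_sum A x e S * walk_sum H e y S - visit_sum A x e S f * visit_sum H e y S f.
  move=> eH fH ef.
  rewrite (fsbig_image _ _ _ (@Dinj e f)).
  rewrite fsum_mul; [|exact: finite_saws..].
  rewrite fsum_mul; [|apply: finite_setIl; exact: finite_saws..].
  (* The pairs left out of [D e f] are those where both halves visit [f]; since [f] is neither [x]
     nor [e], their weight is the product of the two visiting sums. *)
  rewrite [X in X - _](fsbigID
    [set p : seq T * seq T | ~~ ((f \in p.1) && (f \in p.2))]);
    last by apply: finite_setX; exact: finite_saws.
  rewrite -/(D e f).
  rewrite (_ : _ `&` ~` _ = (saws A x e S `&` [set p | f \in x :: p]) `*`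
     (saws H e y S `&` [set p | f \in e :: p])).
    by rewrite addrK; apply: eq_fsbigr => p _; rewrite /ct size_cat exprD.
  have xf : f != x by apply: contraNneq xH => <-.
  have fe : f != e by rewrite eq_sym.
  apply/seteqP; split=> -[p1 p2] /=.
    by move=> [[? ?] /negP/negPn/andP [f1 f2]]; rewrite !inE f1 f2 !orbT.
  rewrite !inE (negbTE xf) (negbTE fe) /= => -[[? f1] [? f2]].
  by split=> //; apply/negP/negPn/andP.
rewrite {1}/walk_sum DE fsbigU /=; first last.
- move=> p [[[p1 p2] [[/andP [s1 _] /andP [s2 _]] _] <-]].
  move=> [[q1 q2] [[/andP [t1 _] /andP [t2 _]] _] /esym e].
  by case: (cat_saw_disj AH cd s1 s2 t1 t2 e).
- exact: finite_image.
- exact: finite_image.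
by rewrite !Dsum // eq_sym.
Qed.

(** Gluing at one vertex is the two-vertex formula with the endpoint [y] taken as second common
    vertex: as [y] is not in [A], every term through it vanishes. *)
Lemma walk_sum_cut A H x y c S :
  (forall z, z \in vtx A -> z \in vtx H -> z = c) ->
  (forall u v, adj A u v -> ~~ adj H u v) ->
  x \notin vtx H -> y \notin vtx A -> y != c -> x != y ->
  c \in vtx H -> y \in vtx H ->
  walk_sum (A `|` H)%fset x y S = walk_sum A x c S * walk_sum H c y S.
Proof.
move=> AHc AH xH yA yc xy cH yH.
rewrite (@walk_sum_peel A H x y c y) //; last first.
- by rewrite eq_sym.
- by move=> z zA zH; rewrite (AHc z zA zH) inE eqxx.
have xc : x != c by apply: contraNneq xH => ->.
rewrite (visit_sum_eq0 _ xc yA) (walk_sum_eq0 _ xy) ?yA ?orbT //.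
have -> : visit_sum A x y S c = 0.
  have := walk_sumE A x y S c; rewrite !(walk_sum_eq0 _ xy) ?yA ?orbT //.
  by rewrite add0r.
by rewrite !mul0r !subr0 addr0.
Qed.

(** A walk that enters [H] has to come back to [A] through [e], the vertex by which it left. *)
Lemma walk_sum_deadend A H x y e S :
  (forall z, z \in vtx A -> z \in vtx H -> z = e) ->
  (forall u v, adj A u v -> ~~ adj H u v) ->
  y \notin vtx H -> x \notin vtx H ->
  walk_sum (A `|` H)%fset x y S = walk_sum A x y S.
Proof.
move=> AHe AH yH xH; apply: eq_fsbigl; apply/seteqP; split=> p; last first.
  move=> /andP [sp ap]; apply/andP; split=> //.
  by apply: saw_subset sp; exact: fsubsetUl.
move=> /andP [/and3P [pp up lp] ap]; apply/andP; split=> //.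
apply/and3P; split=> //.
case: (path_exit pp) => // -[p1 [z [p2 [pE Ap1 Hz nAz]]]].
have fH : last x p1 \in vtx H by case/andP: (adj_vtx Hz).
have fe : last x p1 = e.
  apply: AHe => //; case: p1 {pE Hz nAz} Ap1 fH => [|a p1] Ap1 fH.
    by rewrite /= (negbTE xH) in fH.
  exact: (path_vtx Ap1 (mem_last a p1)).
have ppe : path (adj (H `|` A)%fset) (last x p1) (z :: p2).
  by move: pp; rewrite fsetUC pE cat_path => /andP [].
case: (path_exit ppe) => [Hp|[r1 [v [r2 [rE Hr1 Av nHv]]]]].
  case/negP: yH; rewrite -(eqP lp) pE last_cat.
  exact: (path_vtx Hp (mem_last z p2)).
case: r1 => [|a r1] in rE Hr1 Av nHv *.
  by case: rE => zv _; rewrite -zv Hz in nHv.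
have ge : last a r1 = e.
  apply: AHe; first by case/andP: (adj_vtx Av).
  exact: (path_vtx Hr1 (mem_last a r1)).
have : uniq (last x p1 :: z :: p2) by apply: last_uniq; rewrite -pE.
rewrite rE fe cons_uniq -{1}ge => /andP [+ _].
by rewrite mem_cat mem_last.
Qed.

Lemma saw_rev E x y p : saw E x y p -> saw E y x (rev (belast x p)).
Proof.
move=> /and3P [pp up /eqP <-]; apply/and3P; split.
- rewrite rev_path; apply: sub_path pp => u v; by rewrite adj_sym.
- by rewrite -rev_rcons rev_uniq -lastI.
- case: p {pp up} => [|a p] //=; by rewrite rev_cons last_rcons.
Qed.

Lemma walk_sum_rev E x y S : walk_sum E x y S = walk_sum E y x S.
Proof.
pose rv u (p : seq T) := rev (belast u p).
have rvE u v p : last u p = v -> rev (u :: p) = v :: rv u p.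
  by move=> <-; rewrite lastI rev_rcons.
have rvS u v p : saws E u v S p -> saws E v u S (rv u p).
  move=> /andP [sp ap]; apply/andP; split; first exact: saw_rev.
  by case/and3P: sp => _ _ /eqP/rvE <-; rewrite all_rev.
rewrite /walk_sum; have -> : saws E x y S = rv y @` saws E y x S.
  apply/seteqP; split=> [p sp|_ [p sp <-]]; last exact: rvS.
  exists (rv x p); first exact: rvS.
  have /rvE e : last x p = y by case/andP: sp => /and3P [_ _ /eqP].
  have /rvE : last y (rv x p) = x.
    by case/andP: (rvS _ _ _ sp) => /and3P [_ _ /eqP].
  by rewrite -e revK => -[].
rewrite fsbig_image; last first.
  move=> p q /set_mem /andP [/and3P [_ _ /eqP/rvE e1] _].
  move=> /set_mem /andP [/and3P [_ _ /eqP/rvE e2] _] e.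
  by move: e1; rewrite e -e2 => /(can_inj revK) [].
by apply: eq_fsbigr => p _; rewrite size_rev size_belast.
Qed.

Lemma walk_sum_image (T' : choiceType) (f : T -> T') E x y (S : pred T') :
  injective f ->
  walk_sum E x y (S \o f) =
  \sum_(p \in saws (image_graph f E) (f x) (f y) S) w ^+ size p.
Proof.
move=> finj.
have adjf u v : adj (image_graph f E) (f u) (f v) = adj E u v.
  by rewrite /adj -imfset_pair mem_imfset //; exact: imfset_inj.
have sawf p : saw (image_graph f E) (f x) (f y) (map f p) = saw E x y p.
  rewrite /saw -map_cons (map_inj_uniq finj) last_map (inj_eq finj) path_map.
  by congr (_ && _); apply: eq_path => u v; rewrite /= adjf.
have vf z : z \in vtx (image_graph f E) -> exists u, z = f u.
  move=> /vtxP [e /imfsetP [e' /= _ ->] /imfsetP [u _ ->]]; by exists u.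
have -> : saws (image_graph f E) (f x) (f y) S = map f @` saws E x y (S \o f).
  apply/seteqP; split=> [p /andP [sp ap]|_ [p /andP [sp ap] <-]]; last first.
    by apply/andP; rewrite sawf; split=> //; rewrite -map_cons all_map.
  have [q pE] : exists q, p = map f q.
    have := path_vtx (proj1 (andP sp)).
    elim: p {sp ap} => [|z p IH] h; first by exists [::].
    have [u ->] := vf z (h z (mem_head _ _)).
    have [|q ->] := IH; last by exists (u :: q).
    by move=> v vp; apply: h; rewrite inE vp orbT.
  exists q => //; rewrite pE in sp ap; apply/andP; rewrite -sawf; split=> //.
  by move: ap; rewrite -map_cons all_map.
rewrite fsbig_image //; last by move=> p q _ _; exact: inj_map.
by apply: eq_fsbigr => p _; rewrite size_map.
Qed.

End WalkSums.

(** * Open chains of graphs in which consecutive ones share one vertex *)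

Section Chains.
Context {R : realType} {T : choiceType} (w : R).
Context (f : nat -> {fset {fset T}}) (k : nat -> T) (lo hi : nat).
(** [k u] is the vertex shared by [f u.-1] and [f u]. The window from [lo] to [hi] keeps the chain
    open: for the ring of cells it runs from 1 to [N], omitting cell 0, where the ring closes. *)
Hypothesis f_meet : forall t u z, (lo <= t < u)%N -> (u < hi)%N ->
  z \in vtx (f t) -> z \in vtx (f u) -> u = t.+1 /\ z = k u.
Hypothesis f_edge : forall t u v, adj (f t) u v -> u != v.
Hypothesis k_in : forall t, (lo <= t < hi)%N -> k t \in vtx (f t).
Hypothesis k_in' : forall t, (lo <= t)%N -> (t.+1 < hi)%N -> k t.+1 \in vtx (f t).
Hypothesis k_neq : forall t, (lo <= t)%N -> (t.+1 < hi)%N -> k t != k t.+1.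

Fixpoint chain t n : {fset {fset T}} :=
  if n is n'.+1 then (f t `|` chain t.+1 n')%fset else fset0.

Lemma in_chain t n e :
  reflect (exists2 u, (t <= u < t + n)%N & e \in f u) (e \in chain t n).
Proof.
elim: n t => [|n IH] t /=.
  by rewrite in_fset0; constructor => -[u]; lia.
rewrite inE; apply: (iffP orP) => [[et|/IH [u tu eu]]|[u tu eu]].
- by exists t => //; lia.
- by exists u => //; lia.
- have [e0|e0] := eqVneq u t; [left|right]; first by rewrite -e0.
  by apply/IH; exists u => //; lia.
Qed.

Lemma vtx_chain t n z :
  reflect (exists2 u, (t <= u < t + n)%N & z \in vtx (f u)) (z \in vtx (chain t n)).
Proof.
apply: (iffP (vtxP _ _)) => [[e /in_chain [u tu eu] ze]|[u tu /vtxP [e eu ze]]].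
  by exists u => //; apply/vtxP; exists e.
by exists e => //; apply/in_chain; exists u.
Qed.

Lemma chain_meet t n z : (lo <= t)%N -> (t.+1 + n <= hi)%N ->
  z \in vtx (f t) -> z \in vtx (chain t.+1 n) -> z = k t.+1.
Proof.
move=> lt tn zt /vtx_chain [u tu zu].
by have [] := @f_meet t u z _ _ zt zu; [lia|lia|move=> <-].
Qed.

(** Both ends of a common edge would be the single common vertex [k t.+1]. *)
Lemma chain_disj t n u v : (lo <= t)%N -> (t.+1 + n <= hi)%N ->
  adj (f t) u v -> ~~ adj (chain t.+1 n) u v.
Proof.
move=> lt tn a1; apply/negP => a2; have /negP := f_edge a1; apply; apply/eqP.
have /andP [u1 v1] := adj_vtx a1; have /andP [u2 v2] := adj_vtx a2.
by rewrite (chain_meet lt tn u1 u2) (chain_meet lt tn v1 v2).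
Qed.

Lemma k_notin_chain t n : (lo <= t)%N -> (t.+1 + n <= hi)%N ->
  k t \notin vtx (chain t.+1 n).
Proof.
move=> lt tn; apply/negP => kc.
have /vtx_chain [u tu _] := kc.
have := chain_meet lt tn (k_in _) kc; have := @k_neq t lt.
move=> h1 h2; have := h1 ltac:(lia); rewrite {1}h2 ?eqxx //; lia.
Qed.

(** Cells before [b] are cut off one at a time at their shared vertices; the cells after [b] hang on
    a single vertex and are a dead end. *)
Lemma walk_sum_chain t n b y S : (lo <= t)%N -> (t <= b < t + n)%N ->
  (t + n <= hi)%N -> y \in vtx (f b) ->
  (forall u, (lo <= u < hi)%N -> u != b -> y \notin vtx (f u)) ->
  walk_sum w (chain t n) (k t) y S =
  (\prod_(t <= u < b) walk_sum w (f u) (k u) (k u.+1) S) *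
  walk_sum w (f b) (k b) y S.
Proof.
move=> lt tb tn yb yN; elim: n t lt tb tn => [|n IH] t lt tb tn /=; first by lia.
have mt z := @chain_meet t n z lt ltac:(lia).
have dt u v := @chain_disj t n u v lt ltac:(lia).
have kN := @k_notin_chain t n lt ltac:(lia).
have [e0|e0] := eqVneq t b.
  rewrite -e0 big_geq // mul1r; apply: walk_sum_deadend mt dt _ kN.
  apply/negP => /vtx_chain [u tu]; apply/negP; apply: yN; lia.
have yt : y \notin vtx (f t) by apply: yN => //; lia.
have ktt : k t.+1 \in vtx (f t) by apply: k_in' => //; lia.
have yk : y != k t.+1 by apply: contraNneq yt => ->.
have ky : k t != y by apply: contraNneq yt => <-; apply: k_in; lia.
rewrite (walk_sum_cut w S mt dt kN yt yk ky); last 2 first.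
- apply/vtx_chain; exists t.+1; first by lia.
  by apply: k_in; lia.
- by apply/vtx_chain; exists b => //; lia.
rewrite IH; [|lia..].
by rewrite [in RHS]big_ltn ?mulrA //; lia.
Qed.

End Chains.

(** * Linear forests under bijections *)

Section BijectiveImages.
Context (T T' : choiceType) (f : T -> T') (g : T' -> T).
Hypothesis fK : cancel f g.
Hypothesis gK : cancel g f.
Implicit Types E G : {fset {fset T}}.

Lemma image_graphK : cancel (image_graph f) (image_graph g).
Proof.
move=> E; rewrite image_graph_comp; apply/fsetP => e.
have gf e0 : ((g \o f) @` (e0 : {fset T}))%fset = e0.
  apply/fsetP => z; apply/imfsetP/idP => [[y /= ye ->]|ze]; first by rewrite fK.
  by exists z; rewrite /= ?fK.
by apply/image_graphP/idP => [[e' e'E ->]|eE]; [rewrite gf|exists e; rewrite ?gf].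
Qed.

Lemma adj_image E x y : adj (image_graph f E) x y = adj E (g x) (g y).
Proof.
rewrite -{1}(gK x) -{1}(gK y) /adj -imfset_pair mem_imfset //.
exact: imfset_inj (can_inj fK).
Qed.

Lemma card_image_graph E : #|` image_graph f E| = #|` E|.
Proof. by rewrite card_imfset //; exact: imfset_inj (can_inj fK). Qed.

Lemma degree_image E x : degree (image_graph f E) x = degree E (g x).
Proof.
rewrite /degree -[RHS]card_image_graph; congr #|` _|; apply/fsetP => e.
rewrite !inE /=; apply/andP/image_graphP => [[/image_graphP [e' e'E ->] xe]|].
  exists e' => //; rewrite !inE /= e'E /=.
  by case/imfsetP: xe => z /= ze ->; rewrite fK.
move=> [e']; rewrite !inE /= => /andP [e'E xe] ->; split.
  by apply/image_graphP; exists e'.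
by apply/imfsetP; exists (g x); rewrite //= gK.
Qed.

Lemma linear_forest_image E : linear_forest E -> linear_forest (image_graph f E).
Proof.
move=> [E2 aE dE]; split.
- move=> _ /image_graphP [e /E2 e2 ->]; rewrite card_imfset //.
  exact: can_inj fK.
- move=> c c2 uc; have := aE (map g c); rewrite size_map map_inj_uniq; last exact: can_inj gK.
  move=> /(_ c2 uc); apply: contra.
  by rewrite (mono_cycle (e := adj (image_graph f E))) // => x y /=; rewrite adj_image.
- by move=> x; rewrite degree_image.
Qed.

End BijectiveImages.

(** * Paths as linear forests *)

Section PathEdges.
Context {T : choiceType}.
Implicit Types (E G : {fset {fset T}}) (x y z : T) (p c : seq T).

Lemma path_edges1 x : path_edges [:: x] = fset0.
Proof. by apply/fsetP => e; rewrite in_fset0; apply/imfsetP => -[]. Qed.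

Lemma path_edges_cons x y p :
  path_edges (x :: y :: p) = ([fset x; y] |` path_edges (y :: p))%fset.
Proof.
apply/fsetP => e; rewrite !inE; apply/imfsetP/orP => [[f /=]|].
  rewrite inE => /orP [/eqP ->|fp] ->; first by left; rewrite eqxx.
  by right; apply/imfsetP; exists f.
case=> [/eqP ->|/imfsetP [f /= fp ->]]; first by exists (x, y); rewrite //= inE eqxx.
by exists f; rewrite //= inE fp orbT.
Qed.

Lemma fset_pair_eq x y z : x \notin [:: z] -> [fset x; y]%fset = [fset x; z]%fset -> y = z.
Proof.
rewrite inE => xz e; have : z \in [fset x; y]%fset by rewrite e !inE eqxx orbT.
by rewrite !inE eq_sym (negbTE xz) /= => /eqP.
Qed.

Lemma path_edges_mem p e : e \in path_edges p -> forall z, z \in e -> z \in p.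
Proof.
case: p => [|x p]; first by move=> /imfsetP [].
elim: p x => [|y p IH] x; first by rewrite path_edges1.
rewrite path_edges_cons !inE => /orP [/eqP -> z|/IH h z /h zp].
  by rewrite !inE => /orP [] /eqP ->; rewrite eqxx ?orbT.
by rewrite inE zp orbT.
Qed.

Lemma path_path_edges E x p : path (adj E) x p = (path_edges (x :: p) `<=` E)%fset.
Proof.
elim: p x => [|y p IH] x; first by rewrite path_edges1 fsub0set.
by rewrite path_edges_cons /= IH fsubUset fsub1set.
Qed.

Lemma path_own_edges x p : path (adj (path_edges (x :: p))) x p.
Proof. by rewrite path_path_edges. Qed.

Lemma card_path_edges x p : uniq (x :: p) -> #|` path_edges (x :: p)| = size p.
Proof.
elim: p x => [|y p IH] x u; first by rewrite path_edges1 cardfs0.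
rewrite path_edges_cons cardfsU1 IH; last by case/andP: u.
rewrite (_ : _ \notin _) //; apply/negP => h.
have := path_edges_mem h; move=> /(_ x); rewrite !inE eqxx => /(_ isT) xp.
by move: u; rewrite /= inE xp.
Qed.

Lemma path_edges_card2 p e : uniq p -> e \in path_edges p -> #|` e| = 2%N.
Proof.
case: p => [|x p]; first by move=> _ /imfsetP [].
elim: p x => [|y p IH] x u; first by rewrite path_edges1.
rewrite path_edges_cons !inE => /orP [/eqP ->|]; last by apply: IH; case/andP: u.
by rewrite cardfs2; move: u; rewrite /= inE => /andP [+ _]; case: eqVneq.
Qed.

Lemma degree_set E x : degree E x = #|` [fset e in E | x \in e]%fset|.
Proof. by []. Qed.

Lemma degreeU1 E f x : f \notin E -> degree (f |` E)%fset x = ((x \in f) + degree E x)%N.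
Proof.
move=> fE; rewrite /degree.
have -> : [fset e in (f |` E)%fset | x \in e]%fset =
   if x \in f then (f |` [fset e in E | x \in e])%fset else [fset e in E | x \in e]%fset.
  apply/fsetP => e; rewrite !inE /=; case: ifP => xf; rewrite !inE /=.
    by case: (eqVneq e f) => [->|] //=; rewrite xf.
  by case: (eqVneq e f) => [->|] //=; rewrite xf andbF.
case: ifP => xf //; rewrite cardfsU1 !inE /= (negbTE fE) //.
Qed.

Lemma degree_le E G x : (E `<=` G)%fset -> (degree E x <= degree G x)%N.
Proof.
move=> EG; apply: fsubset_leq_card; apply/fsubsetP => e; rewrite !inE /=.
by move=> /andP [/(fsubsetP EG) -> ->].
Qed.

Lemma degree_notin E x : (forall e, e \in E -> x \notin e) -> degree E x = 0%N.
Proof.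
move=> h; apply/eqP; rewrite cardfs_eq0; apply/eqP/fsetP => e.
by rewrite !inE /=; apply/negP => /andP [/h /negP].
Qed.

Lemma head_edge_notin x y p : uniq (x :: y :: p) ->
  [fset x; y]%fset \notin path_edges (y :: p).
Proof.
move=> /andP [xp _]; apply/negP => /path_edges_mem /(_ x); rewrite !inE eqxx.
by move=> /(_ isT); apply/negP; rewrite -in_cons.
Qed.

Lemma path_degree_out x p z : z \notin x :: p -> degree (path_edges (x :: p)) z = 0%N.
Proof.
move=> zp; apply: degree_notin => e ep; apply: contra zp => ze.
exact: (path_edges_mem ep).
Qed.

Lemma path_degree x p z : uniq (x :: p) -> z \in x :: p ->
  degree (path_edges (x :: p)) z = ((z != x) + (z != last x p))%N.
Proof.
elim: p x => [|y p IH] x u.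
  by rewrite inE path_edges1 => /eqP ->; rewrite /= eqxx degree_notin.
have uy : uniq (y :: p) by case/andP: u.
have xyp : x \notin y :: p by case/andP: u.
rewrite path_edges_cons degreeU1 ?head_edge_notin // !inE.
have [->|zx] := eqVneq z x.
  rewrite path_degree_out //= => _.
  have -> // : x != last y p by apply: contraNneq xyp => ->; exact: mem_last.
rewrite /= => zp; rewrite IH ?inE //.
by case: (z == y).
Qed.

Lemma acyclic_sub E G : (E `<=` G)%fset -> acyclic G -> acyclic E.
Proof.
move=> EG aG c c2 uc; apply: contra (aG c c2 uc).
by apply: sub_cycle; exact: adj_sub.
Qed.

Lemma cycle_degree E c x : (2 < size c)%N -> uniq c -> cycle (adj E) c ->
  x \in c -> (1 < degree E x)%N.
Proof.
move=> c2 uc cc xc.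
have [i c' cE] := rot_to xc.
have : cycle (adj E) (x :: c') by rewrite -cE rot_cycle.
have : uniq (x :: c') by rewrite -cE rot_uniq.
have : (2 < size (x :: c'))%N by rewrite -cE size_rot.
case: c' {cE} => [|y c'] // c2' u /=.
rewrite rcons_path => /and3P [xy _ zx]; set z := last y c' in zx.
have yz : y != z.
  move: u; rewrite /z /=; case: (c') c2' => [|a c''] //= _.
  by move=> /and3P [_ + _]; apply: contraNneq => ->; exact: mem_last.
have xz : x \notin [:: z].
  move: u; rewrite inE => /andP [+ _]; apply: contraNneq => ->; exact: mem_last.
have sub : ([fset [fset x; y]; [fset x; z]] `<=` [fset e in E | x \in e])%fset.
  apply/fsubsetP => e; rewrite !inE /= => /orP [] /eqP ->; rewrite !inE eqxx andbT //.
  by rewrite fsetUC.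
apply: leq_trans (fsubset_leq_card sub); rewrite cardfs2 ltnS lt0n eqb0 negbK.
apply: contra yz => /eqP e; apply/eqP.
exact: fset_pair_eq xz e.
Qed.

(** The head of the path has degree one, so a cycle avoids it and already lies in the tail. *)
Lemma path_acyclic p : uniq p -> acyclic (path_edges p).
Proof.
case: p => [|x p] u c c2 uc; apply/negP.
  case: c c2 uc => [|a [|b c]] //= _ _ /andP [/imfsetP []] //.
elim: p x u => [|y p IH] x u cc.
  case: c c2 uc cc => [|a [|b c]] //= _ _ /andP [].
  by rewrite /adj path_edges1.
have uy : uniq (y :: p) by case/andP: u.
have xc : x \notin c.
  apply/negP => /(cycle_degree c2 uc cc).
  rewrite path_degree ?mem_head // eqxx /=.
  by case: (_ == _).
apply: (IH y uy); move: cc; rewrite path_edges_cons.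
have sub : {in c &, subrel (adj ([fset x; y] |` path_edges (y :: p))%fset)
    (adj (path_edges (y :: p)))}.
  move=> a b ac bc; rewrite /adj !inE => /orP [/eqP e|//].
  have : x \in [fset a; b]%fset by rewrite e !inE eqxx.
  by rewrite !inE => /orP [] /eqP xE; rewrite xE ?ac ?bc in xc.
by move=> cc'; apply: (sub_in_cycle sub _ cc'); exact: allss.
Qed.

Lemma path_linear_forest p : uniq p -> linear_forest (path_edges p).
Proof.
move=> u; split=> [e /(path_edges_card2 u) //||x]; first exact: path_acyclic.
case: p u => [|y p] u.
  by rewrite degree_notin // => e /imfsetP [].
have [xp|xp] := boolP (x \in y :: p); last by rewrite path_degree_out.
by rewrite path_degree //; case: (_ == _); case: (_ == _).
Qed.

Lemma linear_forest_sub E G : (E `<=` G)%fset -> linear_forest G -> linear_forest E.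
Proof.
move=> EG [G2 aG dG]; split; [|exact: acyclic_sub aG|].
  by move=> e /(fsubsetP EG) /G2.
by move=> x; apply: leq_trans (dG x); exact: degree_le.
Qed.

Lemma path_edges_inj x p c : uniq (x :: p) -> uniq (x :: c) ->
  path_edges (x :: p) = path_edges (x :: c) -> p = c.
Proof.
elim: p x c => [|y p IH] x [|z c] u v //.
- rewrite path_edges1 path_edges_cons => /fsetP /(_ [fset x; z]%fset).
  by rewrite !inE eqxx.
- rewrite path_edges1 path_edges_cons => /fsetP /(_ [fset x; y]%fset).
  by rewrite !inE eqxx.
move=> e.
have yz : y = z.
  have : [fset x; y]%fset \in path_edges [:: x, z & c].
    by rewrite -e path_edges_cons !inE eqxx.
  rewrite path_edges_cons !inE => /orP [/eqP|/path_edges_mem /(_ x)].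
    by apply: fset_pair_eq; move: v; rewrite /= !inE => /andP [/norP []].
  by rewrite !inE eqxx => /(_ isT) xc; move: v; rewrite /= inE xc.
rewrite -yz in v e *; congr cons; apply: (IH y).
- by case/andP: u.
- by case/andP: v.
have hu := head_edge_notin u; have hv := head_edge_notin v.
move: e; rewrite !path_edges_cons => /(congr1 (fun s => s `\ [fset x; y])%fset).
by rewrite !fsetU1K.
Qed.

Lemma path_edges_rcons p x y :
  path_edges (rcons (rcons p x) y) = ([fset x; y] |` path_edges (rcons p x))%fset.
Proof.
elim: p => [|a p IH]; first by rewrite /= path_edges_cons !path_edges1.
case: p IH => [|b p] IH; rewrite /= !path_edges_cons.
  by rewrite !path_edges1 fsetUCA.
by rewrite /= in IH; rewrite IH fsetUCA.
Qed.

Lemma path_edges_rev p : path_edges (rev p) = path_edges p.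
Proof.
case: p => [|x p] //; elim: p x => [|y p IH] x //.
rewrite rev_cons; move: (IH y); rewrite rev_cons path_edges_cons => <-.
by rewrite path_edges_rcons [[fset y; x]%fset]fsetUC.
Qed.

Lemma path_invariant (e : rel T) (P : pred T) a p : symmetric e ->
  (forall z z', e z z' -> P z -> P z') -> path e a p ->
  forall z w, z \in a :: p -> w \in a :: p -> P z -> P w.
Proof.
move=> sym_e clos.
have fwd b r : path e b r -> P b -> forall w, w \in b :: r -> P w.
  elim: r b => [|d r IH] b /=; first by move=> _ bc w; rewrite inE => /eqP ->.
  move=> /andP [bd pr] bc w; rewrite inE => /orP [/eqP -> //|].
  by apply: IH => //; exact: (clos b).
elim: p a => [|b p IH] a pq z w; first by rewrite !inE => /eqP -> /eqP ->.
have /= /andP [ab pq'] := pq.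
rewrite [z \in _]inE => /orP [/eqP -> wq ac|zq]; first exact: (fwd a (b :: p)).
rewrite [w \in _]inE => /orP [/eqP -> zc|wq zc]; last exact: (IH b pq' z w).
apply: (clos b); first by rewrite sym_e.
exact: (IH b pq' z b zq (mem_head _ _) zc).
Qed.

(** The definition of [trace] quantifies over all listings of a component, and this determines them
    for a single path. Connectedness gives [c] the same edges as the path, and the head of [c] has
    degree one, so it is one of the two ends. *)
Lemma component_path_own x p c : p != [::] -> uniq (x :: p) ->
  component_path (path_edges (x :: p)) c -> c = x :: p \/ c = rev (x :: p).
Proof.
move=> p0 u [c1 uc cE clos].
case: c c1 uc cE clos => [|y c] // c1 uc cE clos.
have closed z z' : adj (path_edges (x :: p)) z z' -> z \in y :: c -> z' \in y :: c.
  move=> zz' zc; apply: (@path_edges_mem _ [fset z; z']%fset); last by rewrite !inE eqxx orbT.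
  by apply: (clos _ z) => //; rewrite !inE eqxx.
have all_in : forall z, z \in x :: p -> z \in y :: c.
  have yp : y \in x :: p.
    have := cE; rewrite -path_path_edges; case: (c) c1 => [|d c'] //= _ /andP [yd _].
    by apply: (path_edges_mem yd); rewrite !inE eqxx.
  move=> z zp; apply: (path_invariant (adj_sym _) closed (path_own_edges x p) yp zp).
  exact: mem_head.
have E : path_edges (y :: c) = path_edges (x :: p).
  apply/eqP; rewrite eqEfsubset cE /=; apply/fsubsetP => e ep.
  have e2 := path_edges_card2 u ep.
  have : e != fset0 by rewrite -cardfs_gt0 e2.
  move=> /fset0Pn [z ze]; apply: (clos e z) => //; apply: all_in.
  exact: (path_edges_mem ep).
have dy : degree (path_edges (x :: p)) y = 1%N.
  rewrite -E path_degree ?mem_head // eqxx.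
  have -> // : y != last y c.
  case: (c) c1 uc => [|d c'] //= _ /andP [+ _]; apply: contraNneq => ->; exact: mem_last.
have yp : y \in x :: p.
  by rewrite -[_ \in _]negbK; apply/negP => /path_degree_out; rewrite dy.
move: dy; rewrite path_degree //.
have [yx|yx] := eqVneq y x.
  move=> _; left; rewrite yx in uc E *; congr cons.
  exact: (path_edges_inj uc u E).
have [yl|//] := eqVneq y (last x p).
move=> _; right.
have rE : rev (x :: p) = y :: rev (belast x p) by rewrite lastI rev_rcons -yl.
rewrite rE; congr cons; apply: (path_edges_inj uc).
  by rewrite -rE rev_uniq.
by rewrite -rE path_edges_rev.
Qed.

Lemma path_head_degree E x y p : path (adj E) x (y :: p) -> (0 < degree E x)%N.
Proof.
move=> /= /andP [xy _]; rewrite cardfs_gt0; apply/fset0Pn; exists [fset x; y]%fset.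
by rewrite !inE /= eqxx andbT.
Qed.

Lemma fset_pairP e x : #|` e| = 2%N -> x \in e ->
  exists z, z != x /\ e = [fset x; z]%fset.
Proof.
move=> /eqP + xe; rewrite (cardfsD1 x) xe eqSS => /cardfs1P [z ez]; exists z.
split; last by rewrite -(fsetD1K xe) ez.
have : z \in (e `\ x)%fset by rewrite ez !inE.
by rewrite !inE => /andP [].
Qed.

(** An end that is not a leaf has a second edge. Its other endpoint is new, as it would otherwise
    close a cycle. *)
Lemma path_extend E x p : linear_forest E -> p != [::] -> uniq (x :: p) ->
  path (adj E) x p -> degree E x != 1%N ->
  exists z, adj E z x /\ z \notin x :: p.
Proof.
move=> [E2 aE _]; case: p => // y p _ u pp dx.
have d2 : (1 < degree E x)%N by have := path_head_degree pp; case: degree dx => [|[]].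
have xy : adj E x y by case/andP: pp.
have : ([fset e in E | x \in e] `\ [fset x; y])%fset != fset0.
  rewrite -cardfs_gt0; have := cardfsD1 [fset x; y]%fset [fset e in E | x \in e]%fset.
  rewrite -degree_set => dE; move: d2; rewrite dE.
  by rewrite !inE /= eqxx andbT (_ : _ \in E).
move=> /fset0Pn [e]; rewrite !inE /= => /andP [exy /andP [eE xe]].
have [z [zx eE']] := fset_pairP (E2 e eE) xe.
have xz : adj E x z by rewrite /adj -eE'.
exists z; split; first by rewrite adj_sym.
have zy : z != y by apply: contraNneq exy => <-; rewrite eE'.
rewrite !inE (negbTE zx) (negbTE zy) /=; apply/negP => zp.
case/splitPr: zp u pp => p1 p2 u pp.
have := aE (x :: rcons (y :: p1) z); rewrite /= size_rcons => /(_ isT).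
move=> /(_ _)/negP; apply.
  move: u; rewrite -cat_rcons -[y :: _]/((y :: rcons p1 z) ++ p2) -cat_cons cat_uniq.
  by case/and3P.
move: pp; rewrite /= -cat_rcons cat_path => /and3P [-> ppz _].
by rewrite rcons_path ppz last_rcons adj_sym.
Qed.

Lemma path_maximal E e : linear_forest E -> e \in E ->
  exists x p, [/\ p != [::], uniq (x :: p), path (adj E) x p,
    e \in path_edges (x :: p) & degree E x = 1%N /\ degree E (last x p) = 1%N].
Proof.
move=> lE eE; have [E2 aE _] := lE.
suff ext n x p : (#|` vtx E| < size (x :: p) + n)%N -> p != [::] ->
    uniq (x :: p) -> path (adj E) x p -> e \in path_edges (x :: p) ->
    exists x p, [/\ p != [::], uniq (x :: p), path (adj E) x p,
      e \in path_edges (x :: p) & degree E x = 1%N /\ degree E (last x p) = 1%N].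
  have e2 := E2 e eE; have : e != fset0 by rewrite -cardfs_gt0 e2.
  move=> /fset0Pn [x xe]; have [y [yx ee]] := fset_pairP e2 xe.
  apply: (ext #|` vtx E|%N x [:: y]) => //.
  - by rewrite /= inE eq_sym yx.
  - by rewrite /= /adj -ee eE.
  - by rewrite path_edges_cons path_edges1 fsetU0 ee !inE.
elim: n x p => [|n IH] x p sz p0 u pp ep.
  have : (size (x :: p) <= #|` vtx E|)%N.
    rewrite -(undup_id u) -card_fseq; apply: fsubset_leq_card.
    apply/fsubsetP => z; rewrite inE => zp.
    case: p p0 pp zp {sz u ep} => // y p _ pp.
    rewrite !inE => /orP [/eqP ->|zp]; last first.
      by apply: (path_vtx pp); rewrite inE.
    by case/andP: pp => /adj_vtx /andP [].
  by move: sz; rewrite addn0; lia.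
have [dx|dx] := eqVneq (degree E x) 1%N; last first.
  have [z [zx zp]] := path_extend lE p0 u pp dx.
  apply: (IH z (x :: p)) => //=; first by rewrite /= in sz *; lia.
  - by rewrite zp; move: u => /= ->.
  - by rewrite zx.
  - by rewrite path_edges_cons inE ep orbT.
have [dl|dl] := eqVneq (degree E (last x p)) 1%N; first by exists x, p.
have rE : rev (x :: p) = last x p :: rev (belast x p) by rewrite lastI rev_rcons.
have ru : uniq (last x p :: rev (belast x p)) by rewrite -rE rev_uniq.
have rp : path (adj E) (last x p) (rev (belast x p)).
  by rewrite rev_path; apply: sub_path pp => a b; rewrite adj_sym.
have r0 : rev (belast x p) != [::] by rewrite -size_eq0 size_rev size_belast size_eq0.
have [z [zx zp]] := path_extend lE r0 ru rp dl.
apply: (IH z (last x p :: rev (belast x p))) => //=.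
- by move: sz; rewrite /= size_rev size_belast; lia.
- by rewrite zp; move: ru => /= ->.
- by rewrite zx.
- by rewrite path_edges_cons inE -rE path_edges_rev ep orbT.
Qed.

Lemma uniq_last_neq x p : p != [::] -> uniq (x :: p) -> x != last x p.
Proof.
case: p => // y q _ /andP [xn _] /=.
by apply: contraNneq xn => {1}->; exact: mem_last.
Qed.

(** The path uses up the degree of each of its vertices: one at the two leaves, two elsewhere, which
    is the maximum in a linear forest. *)
Lemma degree_closed E x p z e : linear_forest E -> p != [::] -> uniq (x :: p) ->
  path (adj E) x p -> degree E x = 1%N -> degree E (last x p) = 1%N ->
  z \in x :: p -> e \in E -> z \in e -> e \in path_edges (x :: p).
Proof.
move=> [_ _ d2] p0 u pp dx dl zp eE ze.
have sub : (path_edges (x :: p) `<=` E)%fset by rewrite -path_path_edges.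
have sub' : ([fset f in path_edges (x :: p) | z \in f] `<=` [fset f in E | z \in f])%fset.
  by apply/fsubsetP => f; rewrite !inE /= => /andP [/(fsubsetP sub) -> ->].
have xl := uniq_last_neq p0 u.
have : (degree E z <= degree (path_edges (x :: p)) z)%N.
  rewrite path_degree //; have [->|zx] := eqVneq z x; first by rewrite dx xl.
  by have [->|zl] := eqVneq z (last x p); [rewrite dl | exact: d2].
move=> cle.
have /eqP E1 : [fset f in path_edges (x :: p) | z \in f]%fset == [fset f in E | z \in f]%fset.
  by rewrite -(geq_leqif (fsubset_leqif_cards sub')).
have : e \in [fset f in E | z \in f]%fset by rewrite !inE /= eE ze.
by rewrite -E1 !inE /= => /andP [].
Qed.

(* Every component of a linear forest has two leaves, so three possible leaves
   leave room for one component only. *)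
Lemma linear_forest_three_leaves E (a b c : T) : linear_forest E -> E != fset0 ->
  (forall x, degree E x = 1%N -> x \in [:: a; b; c]) ->
  exists x p, [/\ p != [::], uniq (x :: p), path_edges (x :: p) = E,
    x \in [:: a; b; c] & last x p \in [:: a; b; c]].
Proof.
move=> lE /fset0Pn [e eE] leaf.
have [x [p [p0 u pp ep [dx dl]]]] := path_maximal lE eE.
exists x, p; split; rewrite ?leaf //.
apply/eqP; rewrite eqEfsubset -path_path_edges pp /=; apply/fsubsetP => f fE.
rewrite -[_ \in _]negbK; apply/negP => fp.
have [x' [p' [p0' u' pp' fp' [dx' dl']]]] := path_maximal lE fE.
have clos z z' : adj E z z' -> z \in x :: p -> z' \in x :: p.
  move=> zz zp; have := degree_closed lE p0 u pp dx dl zp zz.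
  rewrite !inE eqxx => /(_ isT) /path_edges_mem; apply.
  by rewrite !inE eqxx orbT.
have disj z : z \in x' :: p' -> z \notin x :: p.
  move=> zp'; apply: contra fp => zp.
  have [f2 _ _] := lE; have : f != fset0 by rewrite -cardfs_gt0 f2.
  move=> /fset0Pn [w wf].
  have wp' := path_edges_mem fp' wf.
  have wp := path_invariant (@adj_sym _ E) clos pp' zp' wp' zp.
  exact: (degree_closed lE p0 u pp dx dl wp fE wf).
have h1 := uniq_last_neq p0 u; have h2 := uniq_last_neq p0' u'.
have := disj _ (mem_head x' p'); have := disj _ (mem_last x' p').
move=> d1 d2.
have n1 : x' != x by apply: contraNneq d2 => ->; exact: mem_head.
have n2 : x' != last x p by apply: contraNneq d2 => ->; exact: mem_last.
have n3 : last x' p' != x by apply: contraNneq d1 => ->; exact: mem_head.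
have n4 : last x' p' != last x p by apply: contraNneq d1 => ->; exact: mem_last.
have : uniq [:: x; last x p; x'; last x' p'].
  by rewrite /= !inE !negb_or h1 h2 ![_ == x']eq_sym ![_ == last x' p']eq_sym n1 n2 n3 n4.
move=> u4; have : (4 <= size [:: a; b; c])%N; last by [].
apply: (uniq_leq_size u4) => z; rewrite !inE => /or4P [] /eqP ->.
- by have := leaf _ dx; rewrite !inE.
- by have := leaf _ dl; rewrite !inE.
- by have := leaf _ dx'; rewrite !inE.
- by have := leaf _ dl'; rewrite !inE.
Qed.

End PathEdges.
(** * Asymptotics of the recursions *)

Section LinearRecurrences.
Context {R : realType}.
Implicit Types (L C a b c d l : R) (f g h u v : nat -> R).

Lemma cvg_expVn L : 1 < L -> (fun m => L ^- m) @ \oo --> (0 : R).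
Proof.
move=> L1; have -> : (fun m => L ^- m) = (fun m => L^-1 ^+ m).
  by apply/funext => m; rewrite exprVn.
have L0 : 0 < L by apply: lt_trans L1.
by apply: cvg_expr; rewrite ger0_norm ?invr_ge0 ?ltW // invf_lt1.
Qed.

Lemma cvg_bounded_ratio L C u v l (m0 : nat) : 1 < L ->
  (forall m, (m0 <= m)%N -> `|v m - u m| <= C) ->
  (fun m => L ^- m * u m) @ \oo --> l ->
  (fun m => L ^- m * v m) @ \oo --> l.
Proof.
move=> L1 uv ul; have L0 : 0 < L by apply: lt_trans L1.
have C0 : 0 <= C by apply: le_trans (uv m0 (leqnn _)).
have -> : (fun m => L ^- m * v m) =
    (fun m => L ^- m * u m) \+ (fun m => L ^- m * (v m - u m)).
  by apply/funext => m /=; rewrite -mulrDr addrC subrK.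
rewrite -[l]addr0; apply: cvgD => //.
have K0 : (fun m => L ^- m * C) @ \oo --> (0 : R).
  by rewrite -[0](mul0r C); apply: cvgMl; exact: cvg_expVn.
have K0' : (fun m => - (L ^- m * C)) @ \oo --> (0 : R).
  by rewrite -oppr0; exact: cvgN.
apply: (squeeze_cvgr _ K0' K0); exists m0 => // m /= m0m.
have Lm : 0 < L ^- m by rewrite invr_gt0 exprn_gt0.
have := uv m m0m; rewrite ler_norml => /andP [h1 h2].
by rewrite -mulrN !ler_pM2l // h1 h2.
Qed.

(** With [K = C / (L - 1)], the sequence [L ^- m * (f m - K)] is nondecreasing and
    [L ^- m * (f m + K)] nonincreasing. The first becomes positive as soon as [f] exceeds [K] once,
    which makes the limit positive. *)
Lemma growth_cvg L C f (m0 : nat) : 1 < L ->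
  (forall m, (m0 <= m)%N -> `|f m.+1 - L * f m| <= C) ->
  (exists2 m1, (m0 <= m1)%N & C / (L - 1) < f m1) ->
  exists2 l : R, 0 < l & (fun m => L ^- m * f m) @ \oo --> l.
Proof.
move=> L1 fC [m1 m01 fm1]; have L0 : 0 < L by apply: lt_trans L1.
have C0 : 0 <= C by apply: le_trans (fC m0 (leqnn _)).
pose K := C / (L - 1); have L10 : 0 < L - 1 by rewrite subr_gt0.
have KE : K * (L - 1) = C by rewrite /K divfK // gt_eqF.
have step m : (m0 <= m)%N ->
    L ^- m * (f m - K) <= L ^- m.+1 * (f m.+1 - K) /\
    L ^- m.+1 * (f m.+1 + K) <= L ^- m * (f m + K).
  move=> m0m; have Lm : 0 < L ^- m.+1 by rewrite invr_gt0 exprn_gt0.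
  have -> : L ^- m = L ^- m.+1 * L.
    by rewrite exprS invfM mulrAC mulVf ?mul1r // gt_eqF.
  rewrite -!mulrA !ler_pM2l //.
  by have := fC m m0m; rewrite ler_norml => /andP [h1 h2]; split; nra.
pose b (m : nat) := L ^- (m + m1) * (f (m + m1)%N - K).
have bnd : nondecreasing_seq b.
  by apply/nondecreasing_seqP => m; apply: (step _ _).1; lia.
have bub m : b m <= L ^- m1 * (f m1 + K).
  have K0 : 0 <= K by rewrite /K divr_ge0 // ltW.
  apply: (@le_trans _ _ (L ^- (m + m1) * (f (m + m1)%N + K))).
    by rewrite ler_pM2l ?invr_gt0 ?exprn_gt0 // lerD2l ge0_cp.
  elim: m => [//|m IH]; apply: le_trans IH; rewrite addSn; apply: (step (m + m1)%N _).2; lia.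
have bcv : cvgn b.
  apply: nondecreasing_is_cvgn => //.
  by exists (L ^- m1 * (f m1 + K)) => _ [m _ <-].
exists (limn b).
  apply: (@lt_le_trans _ _ (b 0%N)).
    by rewrite /b add0n mulr_gt0 ?invr_gt0 ?exprn_gt0 // subr_gt0.
  exact: nondecreasing_cvgn_le.
have bl : (fun m => L ^- m * (f m - K)) @ \oo --> limn b.
  by rewrite -(cvg_shiftn m1).
apply: (@cvg_bounded_ratio L `|K| (fun m => f m - K) _ _ 0%N) => // m _.
by rewrite opprB addrC subrK.
Qed.

Lemma contraction_cvg0 (q : R) g h (m0 : nat) : 0 <= q < 1 ->
  (forall m, (m0 <= m)%N -> `|g m.+1| <= q * `|g m| + h m) ->
  h @ \oo --> (0 : R) -> g @ \oo --> (0 : R).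
Proof.
move=> /andP [q0 q1] gh /cvgrPdist_lt h0; apply/cvgrPdist_lt => e e0.
have [m1 _ hm1] : \forall m \near \oo, `|0 - h m| < e / 2 * (1 - q).
  by apply: h0; rewrite mulr_gt0 ?divr_gt0 // subr_gt0.
pose m2 := maxn m0 m1.
(* From [m2] on the forcing is below [(e / 2) * (1 - q)], whose fixed point is [e / 2]; hence the
   excess over [e / 2] contracts by [q]. *)
have step m : `|g (m + m2)%N| - e / 2 <= q ^+ m * `|g m2|.
  elim: m => [|m IH]; first by rewrite expr0 mul1r gerBl; lra.
  have := gh (m + m2)%N ltac:(lia); have := hm1 (m + m2)%N ltac:(rewrite /=; lia).
  rewrite sub0r normrN ltr_norml exprS addSn => /andP [_ h1] h2.
  by have := ler_wpM2l q0 IH; rewrite -mulrA; nra.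
have q0l : (fun m => q ^+ m * `|g m2|) @ \oo --> (0 : R).
  rewrite -[0](mul0r `|g m2|); apply: cvgMl; apply: cvg_expr.
  by rewrite ger0_norm.
have [m3 _ hm3] : \forall m \near \oo, `|0 - q ^+ m * `|g m2| | < e / 2.
  by move/cvgrPdist_lt : q0l; apply; rewrite divr_gt0.
exists (m3 + m2)%N => // m /= mm.
have := step (m - m2)%N; rewrite subnK; last by lia.
have := hm3 (m - m2)%N ltac:(rewrite /=; lia).
by rewrite !sub0r !normrN ltr_norml => /andP [_ h1] h2; lra.
Qed.

(** A solution of size [k * L ^+ m] must satisfy [k * (L - a) = l]; the deviation from it contracts
    by [|a| / L] up to a vanishing error. *)
Lemma forced_cvg L a (l : R) u h (m0 : nat) : `|a| < L ->
  (forall m, (m0 <= m)%N -> u m.+1 = a * u m + h m) ->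
  (fun m => L ^- m * h m) @ \oo --> l ->
  (fun m => L ^- m * u m) @ \oo --> l / (L - a).
Proof.
move=> aL uh hl; have L0 : 0 < L by apply: le_lt_trans aL.
have La : 0 < L - a by rewrite subr_gt0; apply: le_lt_trans aL; exact: ler_norm.
pose k := l / (L - a); have kE : k * (L - a) = l by rewrite /k divfK // gt_eqF.
pose g m := L ^- m * u m - k.
suff g0 : g @ \oo --> (0 : R).
  have -> : (fun m => L ^- m * u m) = g \+ cst k.
    by apply/funext => m /=; rewrite /g subrK.
  by rewrite -/k -[X in _ --> X]add0r; apply: cvgD => //; exact: cvg_cst.
apply: (@contraction_cvg0 (`|a| / L) g (fun m => L^-1 * `|L ^- m * h m - l|) m0).
- by rewrite divr_ge0 ?(ltW L0) //= ltr_pdivrMr // mul1r.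
- move=> m m0m.
  have -> : g m.+1 = a / L * g m + L^-1 * (L ^- m * h m - l).
    rewrite /g uh // -kE exprS; field.
    by rewrite !gt_eqF // exprn_gt0.
  apply: (le_trans (ler_normD _ _)).
  by rewrite !normrM normfV (gtr0_norm L0).
- rewrite -[0](mulr0 L^-1); apply: cvgMr.
  rewrite -(normr0 R); apply: cvg_norm.
  by rewrite -[0](subrr l); apply: cvgB => //; exact: cvg_cst.
Qed.

(** [L] is an eigenvalue of the matrix with rows [(a, b)] and [(c, d)], and [a + d - L] is the other
    one, smaller in modulus. The combination [c * u + (L - a) * v] is a left eigenvector for [L], so
    [growth_cvg] applies to it. By the trace relation it also equals [v m.+1 - (a + d - L) * v m] up
    to a bounded error, so [forced_cvg] gives [v], and [u] follows without diagonalization. *)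
Lemma planar_cvg L C a b c d u v (m0 : nat) : 1 < L ->
  L ^+ 2 - (a + d) * L + (a * d - b * c) = 0 ->
  `|a + d - L| < L -> 0 < c -> a <= L -> d < L ->
  (forall m, (m0 <= m)%N -> `|u m.+1 - (a * u m + b * v m)| <= C) ->
  (forall m, (m0 <= m)%N -> `|v m.+1 - (c * u m + d * v m)| <= C) ->
  (forall K, exists2 m1, (m0 <= m1)%N & K < c * u m1 + (L - a) * v m1) ->
  exists l1 l2 : R, [/\ 0 < l1, 0 < l2,
    (fun m => L ^- m * u m) @ \oo --> l1 &
    (fun m => L ^- m * v m) @ \oo --> l2].
Proof.
move=> L1 ch mu c0 aL dL uC vC fK.
pose f m := c * u m + (L - a) * v m.
have f_rec m : (m0 <= m)%N -> `|f m.+1 - L * f m| <= C * (c + (L - a)).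
  move=> m0m; have := uC m m0m; have := vC m m0m.
  rewrite !ler_norml => /andP [h1 h2] /andP [h3 h4].
  have E : L * f m = c * (a * u m + b * v m) + (L - a) * (c * u m + d * v m).
    rewrite /f; apply/eqP; rewrite -subr_eq0; apply/eqP.
    by rewrite -[RHS](mul0r (v m)) -ch; ring.
  rewrite E /f; have La : 0 <= L - a by rewrite subr_ge0.
  have := ler_wpM2l (ltW c0) h3; have := ler_wpM2l (ltW c0) h4.
  have := ler_wpM2l La h1; have := ler_wpM2l La h2.
  by move=> ? ? ? ?; apply/andP; split; lra.
have [l l0 fl] := growth_cvg L1 f_rec (fK _).
have Lmu : 0 < L - (a + d - L).
  by rewrite subr_gt0; apply: le_lt_trans mu; exact: ler_norm.
pose h m := v m.+1 - (a + d - L) * v m.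
have hl : (fun m => L ^- m * h m) @ \oo --> l.
  apply: (@cvg_bounded_ratio L C f _ _ m0) => // m m0m.
  rewrite (_ : h m - f m = v m.+1 - (c * u m + d * v m)) ?vC //.
  by rewrite /h /f; ring.
have vl := @forced_cvg L (a + d - L) l v h 0 mu (fun m _ => ltac:(rewrite /h; ring)) hl.
exists ((l - (L - a) * (l / (L - (a + d - L)))) / c), (l / (L - (a + d - L))).
split => //.
- rewrite divr_gt0 // (_ : _ - _ = l * (L - d) / (L - (a + d - L))).
    by rewrite divr_gt0 // mulr_gt0 // subr_gt0.
  by field; rewrite gt_eqF.
- by rewrite divr_gt0.
- have -> : (fun m => L ^- m * u m) =
     (fun m => (L ^- m * f m - (L - a) * (L ^- m * v m)) / c).
    by apply/funext => m; rewrite /f; field; rewrite !gt_eqF ?exprn_gt0 // (lt_trans _ L1).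
  by apply: cvgMl; apply: cvgB => //; exact: cvgMr.
Qed.

End LinearRecurrences.

(** * Logarithms of sums dominated by one power *)

Section LogPowers.
Context {R : realType}.
Implicit Types (x y : R).

Lemma ln2_gt0 : 0 < ln 2 :> R.
Proof. by rewrite ln_gt0 // ltr1n. Qed.

Lemma lnX (n : nat) y : 0 < y -> ln (y ^+ n) = n%:R * ln y.
Proof. by move=> y0; rewrite lnXn // mulr_natl. Qed.

Lemma ln_sqrM x y : 0 < x -> 0 < y -> ln (x ^+ 2 * y) = 2 * ln x + ln y.
Proof. by move=> x0 y0; rewrite lnM ?posrE ?exprn_gt0 // lnX. Qed.

Lemma ln_between x y (c : R) : 0 < x -> x <= y -> y <= c * x -> 0 < c ->
  ln x <= ln y <= ln x + ln c.
Proof.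
move=> x0 xy yc c0; have y0 : 0 < y by apply: lt_le_trans xy.
rewrite ler_ln // xy /= -lnM // ler_ln ?posrE ?mulr_gt0 //.
by rewrite mulrC.
Qed.

Lemma ln_dist x y (c1 c2 : R) : 0 < x -> 0 < c1 -> c1 * x <= y <= c2 * x ->
  `|ln y - ln x| <= `|ln c1| + `|ln c2|.
Proof.
move=> x0 c10 /andP [h1 h2].
have y0 : 0 < y by apply: lt_le_trans h1; rewrite mulr_gt0.
have c20 : 0 < c2 by rewrite -(pmulr_lgt0 _ x0); apply: lt_le_trans h2.
have H1 : ln c1 + ln x <= ln y by rewrite -lnM ?posrE // ler_ln ?posrE // mulr_gt0.
have H2 : ln y <= ln c2 + ln x by rewrite -lnM ?posrE // ler_ln ?posrE // mulr_gt0.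
have := ler_norm (ln c2); have := ler_norm (- ln c1); rewrite normrN.
have := normr_ge0 (ln c2); have := normr_ge0 (ln c1).
by rewrite ler_norml => *; apply/andP; split; lra.
Qed.

Lemma ln_sum_large y (i j : nat) : 1 <= y -> (i <= j)%N ->
  j%:R * ln y <= ln (y ^+ i + y ^+ j) <= j%:R * ln y + ln 2.
Proof.
move=> y1 ij; have y0 : 0 < y by apply: lt_le_trans y1.
rewrite -lnX //; apply: ln_between => //; rewrite ?exprn_gt0 //.
  by rewrite lerDr exprn_ge0 // ltW.
have : y ^+ i <= y ^+ j by rewrite ler_weXn2l.
lra.
Qed.

Lemma ln_sum_small y (i j : nat) : 0 < y <= 1 -> (i <= j)%N ->
  i%:R * ln y <= ln (y ^+ i + y ^+ j) <= i%:R * ln y + ln 2.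
Proof.
move=> /andP [y0 y1] ij.
rewrite -lnX //; apply: ln_between => //; rewrite ?exprn_gt0 //.
  by rewrite lerDl exprn_ge0 // ltW.
have : y ^+ j <= y ^+ i by rewrite ler_wiXn2l // ltW.
lra.
Qed.

Lemma ln_geometric (v : nat -> R) (m0 : nat) : 0 < v m0 ->
  (forall m, (m0 <= m)%N -> 2 * v m <= v m.+1) ->
  forall K, exists2 m1, (m0 <= m1)%N & forall m, (m1 <= m)%N -> K < v m.
Proof.
move=> v0 vS K.
have grow n : n%:R * v m0 <= v (m0 + n)%N.
  suff : n.+1%:R * v m0 <= v (m0 + n)%N by rewrite -natr1; lra.
  elim: n => [|n IH]; first by rewrite addn0 mul1r.
  rewrite addnS; apply: (le_trans _ (vS _ (leq_addr _ _))).
  have n0 : (0 : R) <= n%:R by [].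
  by move: IH; rewrite -!natr1; nra.
pose n := (Num.truncn (`|K| / v m0)).+1.
have nK : K < n%:R * v m0.
  rewrite -ltr_pdivrMr //; apply: le_lt_trans (truncnS_gt _).
  by rewrite ler_pM2r ?invr_gt0 // ler_norm.
exists (m0 + n)%N; first by lia.
move=> m mm; have -> : m = (m0 + (m - m0))%N by lia.
apply: lt_le_trans (grow _); apply: (lt_le_trans nK).
by rewrite ler_pM2r // ler_nat; lia.
Qed.

Lemma ln_to_pinfty (u : nat -> R) : (forall m, 0 < u m) ->
  (u @ \oo --> (0 : R)) ->
  forall K, exists m1, forall m, (m1 <= m)%N -> K < - ln (u m).
Proof.
move=> u0 /cvgrPdist_lt ul K.
have [m1 _ hm] := ul (expR (- K)) (expR_gt0 _).
exists m1 => m mm; have := hm m mm.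
rewrite sub0r normrN gtr0_norm // => h1.
by rewrite ltrNr -[X in _ < X]expRK ltr_ln ?posrE ?expR_gt0.
Qed.

End LogPowers.

(** * The generic recursion in two variables *)

Section GenericPhases.
Context {R : realType} (X Y : nat -> R) (k l : nat).
Hypothesis k_gt0 : (0 < k)%N.
Hypothesis l_bounds : (0 < l < 4)%N.
Hypothesis kl : (3 <= k + l)%N.
Hypothesis X_gt0 : forall m, 0 < X m.
Hypothesis Y_gt0 : forall m, 0 < Y m.
Hypothesis X_rec : forall m,
  X m.+1 = X m ^+ 2 * (Y m ^+ k + Y m ^+ (3 * k + l - 2)).
Hypothesis Y_rec : forall m,
  Y m.+1 = X m ^+ 2 * (Y m ^+ (2 * k + l - 3) + Y m ^+ (2 * k + 1)).

(** The two exponents in [X_rec] have the same sum as those in [Y_rec]. The difference therefore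
    factors as [X ^+ 2 * y ^+ k * (1 - y ^+ (k + l - 3)) * (1 - y ^+ (k + 1))], and the last two
    factors never have opposite signs. *)
Lemma generic_le m : Y m.+1 <= X m.+1.
Proof.
rewrite X_rec Y_rec ler_pM2l ?exprn_gt0 //.
have -> : (2 * k + l - 3 = k + (k + l - 3))%N by lia.
have -> : (2 * k + 1 = k + (k + 1))%N by lia.
have -> : (3 * k + l - 2 = k + ((k + l - 3) + (k + 1)))%N by lia.
rewrite !exprD -subr_ge0; set y := Y m; set p := y ^+ (k + l - 3).
rewrite (_ : _ - _ = y ^+ k * ((1 - p) * (1 - y ^+ k * y ^+ 1))); last by ring.
rewrite mulr_ge0 ?exprn_ge0 // ?(ltW (Y_gt0 _)) // -exprD.
have [y1|y1] := lerP y 1.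
  by rewrite mulr_ge0 // subr_ge0 /p exprn_ile1 // ltW // Y_gt0.
by rewrite mulr_le0 // subr_le0 /p exprn_ege1 // ltW.
Qed.

(** Suppose [Y] stays below 1 at positive levels. If [Y m] is at least one half, then [Y m.+1 < 1]
    bounds [X m ^+ 2] by [2 ^+ n], hence [X m.+1] by [B]. If [Y m] is smaller, [X] does not
    increase, because the square of [X m.+1 / X m] is at most [Y m.+1]. *)
Lemma generic_dichotomy :
  (exists2 m, (0 < m)%N & 1 <= Y m) \/ (exists B, forall m, X m <= B /\ Y m <= B).
Proof.
have [[m [m0 Y1]]|H] := pselect (exists m, (0 < m)%N /\ 1 <= Y m).
  by left; exists m.
right.
have Ylt m : (0 < m)%N -> Y m < 1.
  by move=> m0; rewrite ltNge; apply/negP => Y1; apply: H; exists m.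
pose n := (2 * k + l - 3)%N.
pose B := 2 * 2 ^+ n : R.
have B1 : 1 <= B by rewrite /B -exprS exprn_ege1 // ler1n.
have step m : (0 < m)%N -> X m.+1 <= Num.max (X m) B.
  move=> m0; rewrite le_max; have := Ylt m.+1 isT; rewrite Y_rec X_rec -/n.
  have y0 := Y_gt0 m; have y1 := Ylt m m0; have x0 := X_gt0 m.
  set y := Y m in y0 y1 *; set x := X m in x0 *.
  have yn0 : 0 < y ^+ n by rewrite exprn_gt0.
  have [yh|yh] := lerP (2^-1) y => h1; apply/orP; [right|left].
    have h2 : x ^+ 2 * y ^+ n < 1.
      by apply: le_lt_trans h1; rewrite ler_pM2l ?exprn_gt0 // lerDl exprn_ge0 // ltW.
    have h3 : x ^+ 2 <= 2 ^+ n.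
      have h4 : 1 <= 2 ^+ n * y ^+ n.
        by rewrite -exprMn exprn_ege1 //; lra.
      have : 0 < 2 ^+ n :> R by rewrite exprn_gt0.
      have : 0 < x ^+ 2 by rewrite exprn_gt0.
      by move: h2 h4 yn0; set a := x ^+ 2; set c := y ^+ n; set d := 2 ^+ n; nra.
    have h5 : y ^+ k <= 1 by rewrite exprn_ile1 // ltW.
    have h6 : y ^+ (3 * k + l - 2) <= 1 by rewrite exprn_ile1 // ltW.
    have : 0 < x ^+ 2 by rewrite exprn_gt0.
    rewrite /B; nra.
  rewrite expr2 -mulrA ger_pMr //.
  set z := x * _; have z0 : 0 <= z.
    by rewrite /z mulr_ge0 ?addr_ge0 ?exprn_ge0 // ltW.
  suff : z ^+ 2 <= 1 by rewrite expr_le1.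
  rewrite /z exprMn.
  (* Divided by [y ^+ n], with [w = y ^+ (2 * k + l - 2)], this reads [y ^+ (3 - l) * (1 + w) ^+ 2
     <= 1 + y ^+ (4 - l)]. For [l <= 2] the left side is at most [2 * y], hence at most 1; for
     [l = 3] it suffices that [w <= y / 4]. *)
  have key : (y ^+ k + y ^+ (3 * k + l - 2)) ^+ 2 <= y ^+ n + y ^+ (2 * k + 1).
    have -> : (3 * k + l - 2 = k + (2 * k + l - 2))%N by lia.
    have -> : (2 * k + 1 = n + (4 - l))%N by rewrite /n; lia.
    rewrite !exprD -[X in (X + _) ^+ 2]mulr1 -mulrDr exprMn -exprM.
    have -> : (k * 2 = n + (3 - l))%N by rewrite /n; lia.
    rewrite exprD -mulrA -[X in _ <= X + _]mulr1 -mulrDr ler_pM2l //.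
    set e := (2 * k + l - 2)%N.
    have le_e i : (i <= e)%N -> y ^+ e <= y ^+ i.
      by move=> ie; rewrite ler_wiXn2l // ltW.
    have e0 : 0 <= y ^+ e by rewrite exprn_ge0 // ltW.
    have -> : (4 - l = (3 - l).+1)%N by lia.
    rewrite [y ^+ _.+1]exprS; set w := y ^+ e in e0 *.
    have [l2|l3] : (l <= 2)%N \/ l = 3%N by lia.
      have w2 : w <= y ^+ 2 by apply: le_e; rewrite /e; lia.
      have a1 : y ^+ (3 - l) <= y.
        by rewrite -[leRHS]expr1 ler_wiXn2l ?ltW //; lia.
      have a0 : 0 <= y ^+ (3 - l) by rewrite exprn_ge0 // ltW.
      move: w2 a1 a0; set a := y ^+ (3 - l) => w2 a1 a0.
      have w4 : w <= 1 / 4 by nra.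
      have : (1 + w) ^+ 2 <= 2 by nra.
      by set t := (1 + w) ^+ 2; nra.
    have w3 : w <= y ^+ 3 by apply: le_e; rewrite /e; lia.
    rewrite l3 subnn expr0 mul1r mulr1.
    have w4 : w <= y / 4 by rewrite exprS in w3; nra.
    nra.
  apply: le_trans (ltW h1); rewrite ler_pM2l ?exprn_gt0 //.
have bX m : X m.+1 <= Num.max (X 1%N) B.
  elim: m => [|m IH]; first by rewrite le_max lexx.
  by apply: (le_trans (step m.+1 isT)); rewrite ge_max IH le_max lexx orbT.
exists (X 0%N + Y 0%N + Num.max (X 1%N) B) => m.
have M1 : 1 <= Num.max (X 1%N) B by rewrite le_max B1 orbT.
have := X_gt0 0; have := Y_gt0 0.
by case: m => [|m]; [|have := bX m; have := Ylt m.+1 isT]; move=> *; split; lra.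
Qed.

(** Once [Y] reaches 1, both variables stay at least 1 and the larger exponents dominate. Their
    matrix has rows [(2, 3k + l - 2)] and [(2, 2k + 1)], with trace [2k + 3] and determinant
    [- 2 (k + l - 3)]. *)
Lemma generic_supercritical (L : R) (m0 : nat) : (0 < m0)%N -> 1 <= Y m0 ->
  L ^+ 2 - (2 * k%:R + 3) * L - 2 * (k%:R + l%:R - 3) = 0 ->
  2 * k%:R + 3 <= L ->
  exists l1 l2 : R, [/\ 0 < l1, 0 < l2,
    (fun m => L ^- m * ln (X m)) @ \oo --> l1 &
    (fun m => L ^- m * ln (Y m)) @ \oo --> l2].
Proof.
move=> m00 Ym0 Lch Lge.
have kR : (1 : R) <= k%:R by rewrite ler1n.
have ge1 m : (m0 <= m)%N -> 1 <= Y m /\ 1 <= X m.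
  elim: m => [|m IH]; first by lia.
  rewrite leq_eqVlt => /orP [/eqP <-|m0m].
    by split => //; apply: (le_trans Ym0); case: m0 m00 {Ym0 IH} => // n _; exact: generic_le.
  have [Y1 X1] := IH m0m.
  have Y1' : 1 <= Y m.+1.
    rewrite Y_rec; have := exprn_ege1 (2 * k + l - 3) Y1.
    have := exprn_ege1 (2 * k + 1) Y1; have := exprn_ege1 2 X1.
    set p := X m ^+ 2; set q := Y m ^+ _; set r := Y m ^+ _; nra.
  by split => //; apply: (le_trans Y1'); exact: generic_le.
have ln2 := @ln2_gt0 R.
have b_ge : (1 < 3 * k + l)%N by lia.
have bE : (3 * k + l - 2)%N%:R = 3 * k%:R + l%:R - 2 :> R.
  by rewrite natrB; [rewrite natrD natrM | lia].
apply: (@planar_cvg R L (ln 2) 2 ((3 * k + l - 2)%N%:R) 2 ((2 * k + 1)%N%:R) _ _ m0).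
- lra.
- rewrite bE natrD natrM -[RHS]Lch; ring.
- rewrite natrD natrM ltr_norml; apply/andP; split; lra.
- by [].
- lra.
- rewrite natrD natrM; lra.
- move=> m m0m; have [Y1 X1] := ge1 m m0m.
  rewrite X_rec ln_sqrM ?addr_gt0 ?exprn_gt0 //.
  have /andP [h1 h2] := @ln_sum_large R _ k (3 * k + l - 2) Y1 ltac:(lia).
  by rewrite ler_norml; apply/andP; split; lra.
- move=> m m0m; have [Y1 X1] := ge1 m m0m.
  rewrite Y_rec ln_sqrM ?addr_gt0 ?exprn_gt0 //.
  have /andP [h1 h2] := @ln_sum_large R _ (2 * k + l - 3) (2 * k + 1) Y1 ltac:(lia).
  by rewrite ler_norml; apply/andP; split; lra.
- move=> K.
  have YS m : (m0 <= m)%N -> 2 * Y m <= Y m.+1.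
    move=> m0m; have [Y1 X1] := ge1 m m0m.
    have XY : Y m <= X m by case: m m0m {Y1 X1} => [|m] m0m; [lia|exact: generic_le].
    rewrite Y_rec; have := exprn_ege1 (2 * k + l - 3) Y1.
    have := exprn_ege1 (2 * k + 1) Y1.
    set q := Y m ^+ _; set r := Y m ^+ _ => *.
    apply: (@le_trans _ _ (X m ^+ 2 * 2)); nra.
  have [m1 m01 hm1] := ln_geometric (Y_gt0 m0) YS (expR `|K|).
  exists m1 => //; have [Y1 X1] := ge1 m1 m01.
  have hY : `|K| < ln (Y m1).
    by rewrite -[X in X < _]expRK ltr_ln ?posrE ?expR_gt0 ?Y_gt0 // hm1.
  have lX : 0 <= ln (X m1) by rewrite ln_ge0.
  have := ler_norm K; have := normr_ge0 K; nra.
Qed.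

(** For values below 1 the smaller exponents dominate. Their matrix has rows [(2, k)] and
    [(2, 2k + l - 3)], with trace [2k + l - 1] and determinant [2 (k + l - 3)]. *)
Lemma generic_subcritical (L : R) :
  X @ \oo --> (0 : R) -> Y @ \oo --> (0 : R) ->
  L ^+ 2 - (2 * k%:R + l%:R - 1) * L + 2 * (k%:R + l%:R - 3) = 0 ->
  2 <= L -> 2 * k%:R + l%:R - 3 < L -> 2 * k%:R + l%:R - 1 < 2 * L ->
  exists l1 l2 : R, [/\ 0 < l1, 0 < l2,
    (fun m => L ^- m * - ln (X m)) @ \oo --> l1 &
    (fun m => L ^- m * - ln (Y m)) @ \oo --> l2].
Proof.
move=> X0 Y0 Lch L2 Ld Lmu.
have kR : (1 : R) <= k%:R by rewrite ler1n.
have lR : (1 : R) <= l%:R by rewrite ler1n; case/andP: l_bounds.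
have [m0 hm0] := ln_to_pinfty Y_gt0 Y0 0.
have le1 m : (m0 <= m)%N -> 0 < Y m <= 1.
  move=> /hm0 h; rewrite Y_gt0 /=.
  rewrite leNgt; apply/negP => Y1; have := ln_gt0 Y1; lra.
have dE : (2 * k + l - 3)%N%:R = 2 * k%:R + l%:R - 3 :> R.
  by rewrite natrB; [rewrite natrD natrM | lia].
apply: (@planar_cvg R L (ln 2) 2 k%:R 2 ((2 * k + l - 3)%N%:R) _ _ m0).
- lra.
- rewrite dE -[RHS]Lch; ring.
- rewrite dE ltr_norml; apply/andP; split; lra.
- by [].
- lra.
- by rewrite dE.
- move=> m m0m; have Y1 := le1 m m0m.
  rewrite X_rec ln_sqrM ?addr_gt0 ?exprn_gt0 //.
  have /andP [h1 h2] := @ln_sum_small R _ k (3 * k + l - 2) Y1 ltac:(lia).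
  have ln2 := @ln2_gt0 R.
  by rewrite ler_norml; apply/andP; split; lra.
- move=> m m0m; have Y1 := le1 m m0m.
  rewrite Y_rec ln_sqrM ?addr_gt0 ?exprn_gt0 //.
  have /andP [h1 h2] := @ln_sum_small R _ (2 * k + l - 3) (2 * k + 1) Y1 ltac:(lia).
  have ln2 := @ln2_gt0 R.
  by rewrite ler_norml; apply/andP; split; lra.
- move=> K; have [m1 hm1] := ln_to_pinfty X_gt0 X0 `|K|.
  exists (maxn m0 m1); first by lia.
  have h1 := hm1 (maxn m0 m1) ltac:(lia); have h2 := hm0 (maxn m0 m1) ltac:(lia).
  have := ler_norm K; have := normr_ge0 K; nra.
Qed.

End GenericPhases.
Section RatioBound.
Context {R : realType}.

(* The losses [K / z] are summable, and [t * (1 - 2 * K / z)] is nondecreasing. *)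
Lemma ratio_lower_bound (K : R) (t z : nat -> R) (m0 : nat) : 0 <= K ->
  (forall m, 0 < t m) -> (forall m, (m0 <= m)%N -> 0 < z m) ->
  (forall m, (m0 <= m)%N -> 2 * z m <= z m.+1) ->
  (forall m, (m0 <= m)%N -> t m <= t m.+1 * (1 + K / z m)) ->
  exists m1, (m0 <= m1)%N /\
    exists2 c, 0 < c & forall m, (m1 <= m)%N -> c <= t m.
Proof.
move=> K0 t0 z0 zS tS.
have [m1 m01 zbig] := ln_geometric (z0 _ (leqnn m0)) zS (4 * K).
pose p m := t m * (1 - 2 * K / z m).
have half m : (m1 <= m)%N -> 2 * K / z m <= 1 / 2.
  move=> mm; have zm := z0 m (leq_trans m01 mm).
  by rewrite ler_pdivrMr //; have := zbig m mm; lra.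
have pS m : (m1 <= m)%N -> p m <= p m.+1.
  move=> mm; have m0m := leq_trans m01 mm.
  have zm := z0 m m0m; have zm' := z0 m.+1 (leq_trans m0m (leqnSn m)).
  have h1 : K / z m.+1 <= K / z m / 2.
    rewrite -mulrA -invfM ler_wpM2l // lef_pV2 ?posrE //.
      by rewrite mulrC; exact: zS.
    by rewrite mulr_gt0.
  have h2 := tS m m0m; have h3 := half m mm; have h4 := half m.+1 (leqW mm).
  have K1 : 0 <= K / z m by rewrite divr_ge0 // ltW.
  have K2 : 0 <= K / z m.+1 by rewrite divr_ge0 // ltW.
  have tm := t0 m; have tm' := t0 m.+1.
  rewrite /p -!mulrA; rewrite -!mulrA in h3 h4.
  move: h1 h2 h3 h4 K1 K2; set a := K / z m; set b := K / z m.+1.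
  move=> h1 h2 h3 h4 K1 K2.
  apply: (@le_trans _ _ (t m.+1 * ((1 + a) * (1 - 2 * a)))).
    by rewrite mulrA ler_wpM2r //; lra.
  by rewrite ler_pM2l //; nra.
exists m1; split => //; exists (p m1).
  by rewrite /p mulr_gt0 // subr_gt0; have := half m1 (leqnn _); lra.
move=> m mm; apply: (@le_trans _ _ (p m)).
  have -> : m = (m1 + (m - m1))%N by lia.
  elim: (m - m1)%N => [|n IH]; first by rewrite addn0.
  by rewrite addnS; apply: (le_trans IH); apply: pS; lia.
have zm := z0 m (leq_trans m01 mm).
have : 0 <= 2 * K / z m by rewrite divr_ge0 ?mulr_ge0 // ltW.
by have := t0 m; rewrite /p; nra.
Qed.

Lemma cvg_ln_comparable (L c1 c2 l : R) (u v : nat -> R) (m0 : nat) : 1 < L ->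
  0 < c1 -> (forall m, 0 < u m) ->
  (forall m, (m0 <= m)%N -> c1 * u m <= v m <= c2 * u m) ->
  (fun m => L ^- m * ln (u m)) @ \oo --> l ->
  (fun m => L ^- m * ln (v m)) @ \oo --> l.
Proof.
move=> L1 c10 u0 uv; apply: (@cvg_bounded_ratio _ _ (`|ln c1| + `|ln c2|) _ _ _ m0) => //.
by move=> m m0m; apply: ln_dist (uv m m0m).
Qed.

Lemma cvg_Nln_comparable (L c1 c2 l : R) (u v : nat -> R) (m0 : nat) : 1 < L ->
  0 < c1 -> (forall m, 0 < u m) ->
  (forall m, (m0 <= m)%N -> c1 * u m <= v m <= c2 * u m) ->
  (fun m => L ^- m * - ln (u m)) @ \oo --> l ->
  (fun m => L ^- m * - ln (v m)) @ \oo --> l.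
Proof.
move=> L1 c10 u0 uv ul.
have NE (f : nat -> R) : (fun m => L ^- m * - ln (f m)) =
    (fun m => - (L ^- m * ln (f m))).
  by apply/funext => m; rewrite mulrN.
rewrite NE -[l]opprK; apply: cvgN.
apply: (cvg_ln_comparable L1 c10 u0 uv).
have -> : (fun m => L ^- m * ln (u m)) = (fun m => - (L ^- m * - ln (u m))).
  by apply/funext => m; rewrite mulrN opprK.
exact: cvgN.
Qed.

End RatioBound.

(** * The recursion of the triangle *)

Section TriangularPhases.
Context {R : realType} (x y : nat -> R).
Hypothesis x_gt0 : forall m, 0 < x m.
Hypothesis y_gt0 : forall m, 0 < y m.
Hypothesis x_rec : forall m,
  x m.+1 = (x m + y m) ^+ 2 + x m * (x m ^+ 2 + 2 * x m * y m).
Hypothesis y_rec : forall m, y m.+1 = y m * (x m ^+ 2 + 2 * x m * y m).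

Let T := y 0 / x 0.

Let T_gt0 : 0 < T.
Proof. by rewrite divr_gt0. Qed.

(** The ratio [y / x] decreases: both variables are multiplied by the same factor and [x] receives
    [(x + y) ^+ 2] in addition. *)
Lemma triangular_ratio m : y m <= T * x m.
Proof.
elim: m => [|m IH]; first by rewrite /T divfK // gt_eqF.
have := x_gt0 m; have := y_gt0 m; have := T_gt0 => t0 y0 x0.
rewrite x_rec y_rec; have p0 : 0 < x m ^+ 2 + 2 * x m * y m by nra.
have q0 : 0 <= T * (x m + y m) ^+ 2 by rewrite mulr_ge0 ?sqr_ge0 // ltW.
have := ler_wpM2r (ltW p0) IH; lra.
Qed.

Lemma triangular_dichotomy :
  (exists m, 1 <= x m) \/ (exists B, forall m, x m <= B /\ y m <= B).
Proof.
have [|H] := pselect (exists m, 1 <= x m); first by left.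
right; exists (1 + T) => m.
have x1 : x m < 1 by rewrite ltNge; apply/negP => h; apply: H; exists m.
by have := triangular_ratio m; have := x_gt0 m; have := T_gt0; split; nra.
Qed.

(** As [y] is at most a multiple of [x], the next [x] lies between multiples of [x ^+ 3]. The limit
    for [y] is the same because [y / x] also stays away from zero: its relative loss at each level
    is of order [1 / x], and [x] at least doubles. *)
Lemma triangular_supercritical (m0 : nat) : 1 <= x m0 ->
  exists2 l : R, 0 < l &
    (fun m => 3 ^- m * ln (x m)) @ \oo --> l /\
    (fun m => 3 ^- m * ln (y m)) @ \oo --> l.
Proof.
move=> xm0.
have lower m : x m ^+ 2 + x m ^+ 3 <= x m.+1.
  by rewrite x_rec; have := x_gt0 m; have := y_gt0 m; nra.
have ge1 m : (m0 <= m)%N -> 1 <= x m.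
  elim: m => [|m IH]; first by rewrite leqn0 => /eqP <-.
  rewrite leq_eqVlt => /orP [/eqP <- //|/IH x1].
  by apply: le_trans (lower m); nra.
have xS m : (m0 <= m)%N -> 2 * x m <= x m.+1.
  by move=> /ge1 x1; apply: le_trans (lower m); nra.
have T0 := T_gt0.
pose c := (1 + T) ^+ 2 + (1 + 2 * T).
have c0 : 0 < c by rewrite /c; nra.
have upper m : (m0 <= m)%N -> x m.+1 <= c * x m ^+ 3.
  move=> /ge1 x1; rewrite x_rec /c; have := triangular_ratio m.
  have := y_gt0 m; move: x1; set a := x m; set b := y m => a1 b0 bT.
  have h1 : (a + b) ^+ 2 <= ((1 + T) * a) ^+ 2.
    by rewrite ler_pXn2r ?nnegrE //; nra.
  have h2 : ((1 + T) * a) ^+ 2 <= (1 + T) ^+ 2 * a ^+ 3.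
    rewrite exprMn ler_wpM2l ?sqr_ge0 //; nra.
  have h3 : a * (a ^+ 2 + 2 * a * b) <= (1 + 2 * T) * a ^+ 3 by nra.
  lra.
have lx : exists2 l : R, 0 < l & (fun m => 3 ^- m * ln (x m)) @ \oo --> l.
  apply: (@growth_cvg _ 3 `|ln c| _ m0); first by lra.
    move=> m m0m; have x1 := ge1 m m0m.
    have x3 : 0 < x m ^+ 3 by rewrite exprn_gt0.
    have h1 : x m ^+ 3 <= x m.+1 by apply: le_trans (lower m); rewrite lerDr sqr_ge0.
    have /andP [h2 h3] := ln_between x3 h1 (upper m m0m) c0.
    rewrite lnX // in h2 h3; have := ler_norm (ln c).
    by rewrite ler_norml => *; apply/andP; split; lra.
  have [m1 m01 h] := ln_geometric (x_gt0 m0) xS (expR (`|ln c| / (3 - 1))).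
  by exists m1 => //; rewrite -[X in X < _]expRK ltr_ln ?posrE ?expR_gt0 // h.
have [l l0 xl] := lx; exists l => //; split=> //.
have tpos m : 0 < y m / x m by rewrite divr_gt0.
have [m1 [m01 [d d0 hd]]] : exists m1, (m0 <= m1)%N /\
    exists2 c, 0 < c & forall m, (m1 <= m)%N -> c <= y m / x m.
  (* The ratio loses the factor [1 + (x + y) ^+ 2 / (x * P)], where [P] is at least [x ^+ 2] and
     [x + y] at most [(1 + T) * x]; the loss is thus at most [(1 + T) ^+ 2 / x]. *)
  apply: (@ratio_lower_bound _ ((1 + T) ^+ 2) _ x) => //.
    by rewrite sqr_ge0.
  move=> m m0m; have x1 := ge1 m m0m.
  have a0 := x_gt0 m; have b0 := y_gt0 m; have a'0 := x_gt0 m.+1.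
  pose P := x m ^+ 2 + 2 * x m * y m; pose K := (1 + T) ^+ 2.
  have P0 : 0 < P by rewrite /P; nra.
  have -> : y m.+1 / x m.+1 * (1 + K / x m) =
      y m / x m * (P * (x m + K) / x m.+1).
    by rewrite y_rec -/P; field; rewrite !gt_eqF.
  rewrite ler_peMr ?divr_ge0 ?(ltW a0) ?(ltW b0) // ler_pdivlMr // mul1r x_rec -/P.
  have h1 : (x m + y m) ^+ 2 <= ((1 + T) * x m) ^+ 2.
    have := triangular_ratio m; rewrite ler_pXn2r ?nnegrE //; nra.
  have h2 : K * x m ^+ 2 <= K * P.
    by rewrite ler_wpM2l ?sqr_ge0 // /P; nra.
  by rewrite exprMn -/K in h1; lra.
apply: (@cvg_ln_comparable _ _ d T _ x _ m1) => //; first by lra.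
by move=> m mm; rewrite triangular_ratio -ler_pdivlMr // hd.
Qed.

(** Up to constant factors the next values are [x ^+ 2] and [x ^+ 2 * y]; the exponent rows [(2, 0)]
    and [(2, 1)] have eigenvalues 2 and 1. *)
Lemma triangular_subcritical : x @ \oo --> (0 : R) ->
  exists l1 l2 : R, [/\ 0 < l1, 0 < l2,
    (fun m => 2 ^- m * - ln (x m)) @ \oo --> l1 &
    (fun m => 2 ^- m * - ln (y m)) @ \oo --> l2].
Proof.
move=> x0; have T0 := T_gt0.
have [m0 hm0] := ln_to_pinfty x_gt0 x0 0.
have le1 m : (m0 <= m)%N -> x m <= 1.
  move=> /hm0 h; rewrite leNgt; apply/negP => x1; have := ln_gt0 x1; lra.
pose c := (1 + T) ^+ 2 + (1 + 2 * T).
have c0 : 0 < c by rewrite /c; nra.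
have boundx m : (m0 <= m)%N -> x m ^+ 2 <= x m.+1 <= c * x m ^+ 2.
  move=> /le1 x1; rewrite x_rec /c; have := triangular_ratio m.
  have := x_gt0 m; have := y_gt0 m; move: x1; set a := x m; set b := y m => a1 b0 a0 bT.
  have h1 : (a + b) ^+ 2 <= ((1 + T) * a) ^+ 2.
    by rewrite ler_pXn2r ?nnegrE //; nra.
  rewrite exprMn in h1.
  have h3 : a * (a ^+ 2 + 2 * a * b) <= (1 + 2 * T) * a ^+ 2.
    have : a ^+ 2 + 2 * a * b <= (1 + 2 * T) * a ^+ 2 by nra.
    have : 0 <= a ^+ 2 + 2 * a * b by nra.
    by set p := a ^+ 2 + _; nra.
  apply/andP; split; last by lra.
  nra.
have boundy m : (m0 <= m)%N -> x m ^+ 2 * y m <= y m.+1 <= c * (x m ^+ 2 * y m).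
  move=> /le1 x1; rewrite y_rec /c; have := triangular_ratio m.
  have := x_gt0 m; have := y_gt0 m; move: x1; set a := x m; set b := y m => a1 b0 a0 bT.
  have h2 : a ^+ 2 <= a ^+ 2 + 2 * a * b by nra.
  have h3 : a ^+ 2 + 2 * a * b <= (1 + 2 * T) * a ^+ 2 by nra.
  have h4 : 0 <= (1 + T) ^+ 2 * a ^+ 2 by rewrite mulr_ge0 ?sqr_ge0.
  apply/andP; split; first by rewrite [leRHS]mulrC ler_pM2r.
  by rewrite mulrA mulrC ler_pM2r //; lra.
apply: (@planar_cvg _ 2 `|ln c| 2 0 2 1 _ _ m0).
- lra.
- lra.
- by rewrite ltr_norml; apply/andP; split; lra.
- by [].
- lra.
- lra.
- move=> m m0m; have /andP [h1 h2] := boundx m m0m.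
  have x2 : 0 < x m ^+ 2 by rewrite exprn_gt0.
  have /andP [h3 h4] := ln_between x2 h1 h2 c0.
  rewrite lnX // in h3 h4; have := ler_norm (ln c).
  by rewrite ler_norml => *; apply/andP; split; lra.
- move=> m m0m; have /andP [h1 h2] := boundy m m0m.
  have x2 : 0 < x m ^+ 2 * y m by rewrite mulr_gt0 ?exprn_gt0.
  have /andP [h3 h4] := ln_between x2 h1 h2 c0.
  rewrite ln_sqrM // in h3 h4; have := ler_norm (ln c).
  by rewrite ler_norml => *; apply/andP; split; lra.
- move=> K; have [m1 hm1] := ln_to_pinfty x_gt0 x0 `|K|.
  exists (maxn m0 m1); first by lia.
  have h1 := hm1 (maxn m0 m1) ltac:(lia).
  by have := ler_norm K; have := normr_ge0 K; nra.
Qed.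

End TriangularPhases.

(** * The recursion of the pentagon *)

Section PentagonalPhases.
Context {R : realType} (f1 f2 t1 t2 : nat -> R).
Local Notation X m := (f1 m + f2 m).
Local Notation Y m := (t1 m + t2 m).
Hypothesis f1_gt0 : forall m, 0 < f1 m.
Hypothesis f2_gt0 : forall m, 0 < f2 m.
Hypothesis t1_gt0 : forall m, 0 < t1 m.
Hypothesis t2_gt0 : forall m, 0 < t2 m.
Hypothesis f1_rec : forall m, f1 m.+1 = X m ^+ 2 * (Y m * (1 + t1 m)).
Hypothesis f2_rec : forall m, f2 m.+1 = X m ^+ 2 * (Y m * t2 m).
Hypothesis t1_rec : forall m,
  t1 m.+1 = X m ^+ 2 + (X m ^+ 2 - f2 m ^+ 2) * Y m ^+ 2 * t1 m.
Hypothesis t2_rec : forall m,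
  t2 m.+1 = (X m ^+ 2 - f2 m ^+ 2) * Y m ^+ 2 * t2 m.

(** The summand 1 makes [T] at least 1, which lets the same constant bound both [t2 / t1] and
    [f2 / f1]; then [c0] bounds the share of [t1] in the [Y] total and of [f1] in the [X] total. *)
Let T := 1 + t2 0 / t1 0.
Let D m := X m ^+ 2 - f2 m ^+ 2.
Let c0 := (1 + T)^-1.

Let T_ge1 : 1 <= T.
Proof. by rewrite /T lerDl divr_ge0 // ltW. Qed.

Let X_gt0 m : 0 < X m. Proof. exact: addr_gt0. Qed.
Let Y_gt0 m : 0 < Y m. Proof. exact: addr_gt0. Qed.

Let D_gt0 m : 0 < D m.
Proof. by have := f1_gt0 m; have := f2_gt0 m; rewrite /D; nra. Qed.

Let c0_gt0 : 0 < c0.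
Proof. by rewrite invr_gt0; have := T_ge1; lra. Qed.

Let c0T : c0 * (1 + T) = 1.
Proof. by rewrite mulVf // gt_eqF //; have := T_ge1; lra. Qed.

Let X_rec m : X m.+1 = X m ^+ 2 * (Y m ^+ 1 + Y m ^+ 2).
Proof. by rewrite f1_rec f2_rec; ring. Qed.

Let Y_rec m : Y m.+1 = X m ^+ 2 + D m * Y m ^+ 3.
Proof. by rewrite t1_rec t2_rec -/(D m); ring. Qed.

Lemma pentagonal_ratio m : t2 m <= T * t1 m.
Proof.
elim: m => [|m IH].
  by rewrite /T mulrDl divfK ?gt_eqF // mul1r lerDr ltW.
rewrite t1_rec t2_rec -/(D m) mulrDr.
have p0 : 0 <= D m * Y m ^+ 2 by rewrite mulr_ge0 ?sqr_ge0 // ltW.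
have := ler_wpM2l p0 IH; have : 0 <= T * X m ^+ 2.
  by rewrite mulr_ge0 ?sqr_ge0 //; have := T_ge1; lra.
lra.
Qed.

Let t1_ge m : c0 * Y m <= t1 m.
Proof.
have c1 := c0_gt0; rewrite -[leRHS]mul1r -c0T -mulrA ler_pM2l //.
have := pentagonal_ratio m; lra.
Qed.

(** Here [f2 / f1] is [t2 / (1 + t1)] at the previous level, so nothing is claimed at level 0. The
    bounds on [D] inherit this shift. *)
Lemma pentagonal_ratio' m : f2 m.+1 <= T * f1 m.+1.
Proof.
rewrite f1_rec f2_rec [leRHS]mulrCA ler_pM2l ?exprn_gt0 // [leRHS]mulrCA ler_pM2l //.
by have := pentagonal_ratio m; have := T_ge1; nra.
Qed.

Let f1_ge m : c0 * X m.+1 <= f1 m.+1.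
Proof.
have c1 := c0_gt0; rewrite -[leRHS]mul1r -c0T -mulrA ler_pM2l //.
have := pentagonal_ratio' m; lra.
Qed.

Let D_bounds m : c0 * X m.+1 ^+ 2 <= D m.+1 <= X m.+1 ^+ 2.
Proof.
apply/andP; split; last by rewrite /D gerBl sqr_ge0.
have -> : D m.+1 = f1 m.+1 * (X m.+1 + f2 m.+1) by rewrite /D; ring.
rewrite expr2 mulrA.
apply: (@le_trans _ _ (f1 m.+1 * X m.+1)).
  by rewrite ler_wpM2r ?f1_ge // ltW.
by rewrite ler_wpM2l ?lerDl // ltW.
Qed.

(** Neither total controls the other, so reaching 1 is asked of both at one level. If this never
    happens after level 0, one of the two is below 1 at each level, which bounds first [X] and then
    [Y]. *)
Lemma pentagonal_dichotomy :
  (exists2 m, (0 < m)%N & 1 <= X m /\ 1 <= Y m) \/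
  (exists B, forall m, X m <= B /\ Y m <= B).
Proof.
have [[m [m0 XY]]|H] := pselect (exists m, (0 < m)%N /\ (1 <= X m /\ 1 <= Y m)).
  by left; exists m.
right.
have alt m : (0 < m)%N -> X m < 1 \/ Y m < 1.
  move=> m0; have [|X1] := ltrP (X m) 1; [by left|right].
  by rewrite ltNge; apply/negP => Y1; apply: H; exists m.
have c1 := c0_gt0; have cT := c0T; have T1 := T_ge1.
have c12 : c0 <= 1 / 2 by nra.
pose b := 2 / c0; have bE : b * c0 = 2 by rewrite /b divfK // gt_eqF.
have b2 : 2 <= b by nra.
pose K := b + b ^+ 2.
(* If [X m.+2 > 1] then [Y m.+2 < 1]. In terms of [a] and [y] one level before, [a ^+ 2 * (1 + c0 *
   y ^+ 3) < 1 < a ^+ 2 * (y + y ^+ 2)]. So [a] is at most 1, and comparing the brackets gives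
   [y < 2 / c0 = b]. *)
have XK m : X m.+2 <= K.
  have [X2|X2] := lerP (X m.+2) 1; first by rewrite /K; nra.
  have Y2 : Y m.+2 < 1 by case: (alt m.+2 isT) => // h; lra.
  move: X2 Y2; rewrite (X_rec m.+1) (Y_rec m.+1) expr1.
  have /andP [h1 h2] := D_bounds m; have x0 := X_gt0 m.+1; have y0 := Y_gt0 m.+1.
  move: h1 h2 x0 y0; set d := D _; set a := X _; set y := Y _.
  move=> h1 h2 x0 y0 h3 h4.
  have y3 : 0 < y ^+ 3 by rewrite exprn_gt0.
  have h5 : a ^+ 2 * (1 + c0 * y ^+ 3) < 1.
    by apply: le_lt_trans h4; rewrite mulrDr mulr1 lerD2l mulrA ler_pM2r // mulrC.
  have a2 : 0 < a ^+ 2 by rewrite exprn_gt0.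
  have h6 : 1 + c0 * y ^+ 3 < y + y ^+ 2.
    by rewrite -(ltr_pM2l a2); apply: lt_trans h3.
  have yb : y < b.
    have [y1|y1] := lerP y 1; first by lra.
    have h7 : c0 * y ^+ 3 < 2 * y ^+ 2 by nra.
    rewrite (_ : c0 * y ^+ 3 = c0 * y * y ^+ 2) in h7; last by ring.
    by rewrite ltr_pM2r ?exprn_gt0 // in h7; nra.
  have a21 : a ^+ 2 <= 1 by have : 0 <= c0 * y ^+ 3 by [rewrite mulr_ge0 // ltW]; nra.
  apply: (@le_trans _ _ (y + y ^+ 2)); first by rewrite ger_pMl //; nra.
  have : y ^+ 2 <= b ^+ 2 by nra.
  by rewrite /K; lra.
(* If [Y m.+2 >= 1] and [X m.+3 < 1], then [Y m.+3 <= Y m.+2 * X m.+3], because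
   [1 + y ^+ 3 <= y * (y + y ^+ 2)]. The bound [2 * K ^+ 2] covers [Y m.+2 < 1], and also the case
   where [Y m.+3] itself is below 1. *)
have YS m : Y m.+3 <= Num.max (Y m.+2) (2 * K ^+ 2).
  rewrite le_max; apply/orP.
  have K1 : 1 <= K by rewrite /K; nra.
  have K2 : 1 <= K ^+ 2 by rewrite exprn_ege1.
  have /andP [_ h2] := D_bounds m.+1; have x0 := X_gt0 m.+2; have y0 := Y_gt0 m.+2.
  have xK := XK m; have xK' := XK m.+1; have al := alt m.+3 isT.
  have [y1|y1] := ltrP (Y m.+2) 1.
    right; rewrite (Y_rec m.+2).
    apply: (@le_trans _ _ (X m.+2 ^+ 2 * 2)).
      have : Y m.+2 ^+ 3 <= 1 by rewrite exprn_ile1 // ltW.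
      have := D_gt0 m.+2; nra.
    by rewrite mulrC ler_pM2l // ler_pXn2r ?nnegrE ?(ltW x0) //; lra.
  have [x1|x1] := ltrP (X m.+3) 1; last by case: al => h; right; lra.
  left; move: x1; rewrite (X_rec m.+2) (Y_rec m.+2) expr1; move: h2 x0 y0 y1.
  set d := D _; set a := X _; set y := Y _ => h2 x0 y0 y1 h3.
  have y3 : 0 < y ^+ 3 by rewrite exprn_gt0.
  apply: (@le_trans _ _ (a ^+ 2 * (1 + y ^+ 3))).
    by rewrite mulrDr mulr1 lerD2l ler_pM2r.
  apply: (@le_trans _ _ (y * (a ^+ 2 * (y + y ^+ 2)))); last by rewrite ger_pMr // ltW.
  rewrite mulrCA ler_pM2l ?exprn_gt0 //; nra.
have bY m : Y m.+2 <= Num.max (Y 2%N) (2 * K ^+ 2).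
  elim: m => [|m IH]; first by rewrite le_max lexx.
  by apply: (le_trans (YS m)); rewrite ge_max IH le_max lexx orbT.
exists (X 0%N + X 1%N + K + (Y 0%N + Y 1%N + Num.max (Y 2%N) (2 * K ^+ 2))) => m.
have M0 : 0 < Num.max (Y 2%N) (2 * K ^+ 2) by rewrite lt_max Y_gt0.
have K0 : 0 < K by rewrite /K; nra.
have := X_gt0 0; have := X_gt0 1; have := Y_gt0 0; have := Y_gt0 1.
case: m => [|[|m]]; [| |have := XK m; have := bY m]; by move=> *; split; lra.
Qed.

(** The totals have dominant exponent rows [(2, 2)] and [(2, 3)], of trace 5 and determinant 2. Each
    entry is then comparable with its total: [f1] and [t1] by the ratio bounds, [t2] by summable
    losses, and [f2] through [t2] at the previous level. *)
Lemma pentagonal_supercritical (L : R) (m0 : nat) :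
  (0 < m0)%N -> 1 <= X m0 -> 1 <= Y m0 ->
  L ^+ 2 - 5 * L + 2 = 0 -> 4 <= L ->
  exists l1 l2 : R, [/\ 0 < l1, 0 < l2,
    (fun m => L ^- m * ln (f1 m)) @ \oo --> l1 /\
    (fun m => L ^- m * ln (f2 m)) @ \oo --> l1,
    (fun m => L ^- m * ln (t1 m)) @ \oo --> l2 &
    (fun m => L ^- m * ln (t2 m)) @ \oo --> l2].
Proof.
move=> m00 Xm0 Ym0 Lch L4.
have c1 := c0_gt0; have cT := c0T; have T1 := T_ge1.
have L5 : L < 5 by nra.
have Db m : (m0 <= m)%N -> c0 * X m ^+ 2 <= D m <= X m ^+ 2.
  by case: m => [|m] mm; [lia|exact: D_bounds].
have ge1 m : (m0 <= m)%N -> 1 <= X m /\ 1 <= Y m.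
  elim: m => [|m IH]; first by lia.
  rewrite leq_eqVlt => /orP [/eqP <- //|m0m].
  have [X1 Y1] := IH m0m; rewrite X_rec Y_rec expr1; have := D_gt0 m.
  have : 0 < Y m ^+ 3 by rewrite exprn_gt0.
  move: X1 Y1; set a := X m; set y := Y m; set d := D m => X1 Y1 y3 d0.
  have := mulr_gt0 d0 y3; set dy := d * _; split; nra.
have XS m : (m0 <= m)%N -> 2 * X m <= X m.+1.
  move=> /ge1 [X1 Y1]; rewrite X_rec expr1; move: X1 Y1; set a := X m; set y := Y m => a1 y1.
  have a0 : 0 < a ^+ 2 by rewrite exprn_gt0 // (lt_le_trans _ a1).
  by apply: (@le_trans _ _ (a ^+ 2 * 2)); [nra | rewrite ler_pM2l //; nra].
have [m1 m01 Xbig] := ln_geometric (X_gt0 m0) XS (2 / c0 + expR 1).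
have YS m : (m1 <= m)%N -> 2 * Y m <= Y m.+1.
  move=> mm; have [X1 Y1] := ge1 m (leq_trans m01 mm).
  have /andP [h1 _] := Db m (leq_trans m01 mm); have h2 := Xbig m mm.
  rewrite Y_rec; have e0 := @expR_gt0 R 1.
  have h3 : 2 <= c0 * X m ^+ 2.
    have : 2 / c0 < X m by lra.
    by rewrite ltr_pdivrMr //; nra.
  have : Y m <= Y m ^+ 3 by rewrite -[leLHS]expr1 ler_weXn2l.
  have : 0 <= X m ^+ 2 by rewrite sqr_ge0.
  set p := X m ^+ 2 in h1 h3 *; set y3 := Y m ^+ 3; nra.
have bY m : (m0 <= m)%N -> c0 * (X m ^+ 2 * Y m ^+ 3) <= Y m.+1 <= 2 * (X m ^+ 2 * Y m ^+ 3).
  move=> m0m; have [X1 Y1] := ge1 m m0m; have /andP [h1 h2] := Db m m0m.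
  have y31 : 1 <= Y m ^+ 3 by rewrite exprn_ege1.
  have x2 : 0 <= X m ^+ 2 by rewrite sqr_ge0.
  rewrite Y_rec; move: h1 h2 y31 x2; set p := X m ^+ 2; set r := Y m ^+ 3; set d := D m.
  by move=> *; apply/andP; split; nra.
have lnc2 := @ln2_gt0 R.
have [l1 [l2 [l10 l20 Xl Yl]]] : exists l1 l2 : R, [/\ 0 < l1, 0 < l2,
    (fun m => L ^- m * ln (X m)) @ \oo --> l1 &
    (fun m => L ^- m * ln (Y m)) @ \oo --> l2].
  apply: (@planar_cvg R L (`|ln c0| + `|ln 2|) 2 2 2 3 _ _ m0).
  - lra.
  - rewrite -[RHS]Lch; ring.
  - rewrite ltr_norml; apply/andP; split; lra.
  - by [].
  - lra.
  - lra.
  - move=> m m0m; have [X1 Y1] := ge1 m m0m.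
    rewrite X_rec ln_sqrM ?addr_gt0 ?exprn_gt0 //.
    have /andP [h1 h2] := @ln_sum_large R _ 1 2 Y1 isT.
    have := normr_ge0 (ln c0); have := ler_norm (ln (2 : R)).
    by rewrite ler_norml => *; apply/andP; split; lra.
  - move=> m m0m; have z0 : 0 < X m ^+ 2 * Y m ^+ 3 by rewrite mulr_gt0 ?exprn_gt0.
    have E : ln (X m ^+ 2 * Y m ^+ 3) = 2 * ln (X m) + 3 * ln (Y m).
      by rewrite ln_sqrM ?exprn_gt0 // lnX.
    by rewrite -E; apply: ln_dist (bY m m0m).
  - move=> K; have [m2 m02 hm2] := ln_geometric (X_gt0 m0) XS (expR `|K|).
    exists m2 => //; have [X1 Y1] := ge1 m2 m02.
    have hX : `|K| < ln (X m2).
      by rewrite -[ltLHS]expRK ltr_ln ?posrE ?expR_gt0 // hm2.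
    have lY : 0 <= ln (Y m2) by rewrite ln_ge0.
    have := ler_norm K; have := normr_ge0 K; nra.
have [m2 [m12 [d d0 hd]]] : exists m2, (m1 <= m2)%N /\
    exists2 c, 0 < c & forall m, (m2 <= m)%N -> c <= t2 m / t1 m.
  (* The loss is [X ^+ 2 / (D * Y ^+ 2 * t1)]; one factor [c0] comes from [D >= c0 * X ^+ 2], the
     other from [t1 >= c0 * Y]. *)
  apply: (@ratio_lower_bound _ (c0 ^- 2) _ (fun m => Y m)) => //.
  - by rewrite invr_ge0 sqr_ge0.
  - by move=> m; rewrite divr_gt0.
  move=> m mm; have [X1 Y1] := ge1 m (leq_trans m01 mm).
  have /andP [h1 _] := Db m (leq_trans m01 mm).
  have t10 := t1_gt0 m; have t20 := t2_gt0 m; have Dm := D_gt0 m.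
  have y0 := Y_gt0 m; have h2 := t1_ge m.
  have DY : 0 < D m * Y m ^+ 2 by rewrite mulr_gt0 ?exprn_gt0.
  have p0 : 0 < D m * Y m ^+ 2 * t1 m by rewrite mulr_gt0.
  have x2 : 0 < X m ^+ 2 by rewrite exprn_gt0.
  have E : t2 m / t1 m = t2 m.+1 / t1 m.+1 * (1 + X m ^+ 2 / (D m * Y m ^+ 2 * t1 m)).
    rewrite t1_rec t2_rec -/(D m); move: DY x2 p0.
    set p := D m * Y m ^+ 2; set a := X m ^+ 2 => DY x2 p0.
    field; rewrite !gt_eqF //; exact: addr_gt0.
  rewrite {1}E ler_pM2l ?divr_gt0 // lerD2l ler_pdivrMr //.
  have h3 : c0 ^+ 2 * (X m ^+ 2 * Y m ^+ 2) <= D m * (Y m * t1 m).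
    rewrite (_ : c0 ^+ 2 * _ = (c0 * X m ^+ 2) * (Y m * (c0 * Y m))); last by ring.
    have h4 : Y m * (c0 * Y m) <= Y m * t1 m by rewrite ler_pM2l.
    by apply: ler_pM => //; rewrite ltW // ?mulr_gt0.
  rewrite (_ : _ * _ = c0 ^- 2 * (D m * (Y m * t1 m))); last by field; rewrite !gt_eqF.
  have c20 : 0 < c0 ^+ 2 by rewrite exprn_gt0.
  rewrite [leRHS]mulrC ler_pdivlMr // mulrC.
  apply: le_trans h3; rewrite ler_pM2l // ler_peMr ?(ltW x2) //.
  by rewrite exprn_ege1.
have t2b m : (m2 <= m)%N -> d * c0 * Y m <= t2 m.
  move=> mm; have := hd m mm; rewrite ler_pdivlMr // => h1.
  by apply: le_trans h1; rewrite -mulrA ler_pM2l.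
exists l1, l2; split => //.
- split.
    apply: (@cvg_ln_comparable _ _ c0 1 _ (fun m => X m) _ 1%N) => //; first by lra.
    by case=> [//|m] _; rewrite f1_ge mul1r lerDl ltW.
  apply: (@cvg_ln_comparable _ _ (d * c0 / 2) 1 _ (fun m => X m) _ m2.+1) => //.
  + by lra.
  + by rewrite !mulr_gt0.
  case=> [//|m] mm; apply/andP; split; last by rewrite mul1r lerDr ltW.
  have [X1 Y1] := ge1 m (leq_trans m01 (leq_trans m12 mm)).
  have h1 := t2b m mm.
  rewrite X_rec f2_rec expr1 mulrCA ler_pM2l ?exprn_gt0 //.
  rewrite (_ : _ * (_ + _) = Y m * (d * c0 * ((1 + Y m) / 2))); last by field.
  rewrite ler_pM2l //; apply: le_trans h1; rewrite ler_pM2l ?mulr_gt0 //; lra.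
- apply: (@cvg_ln_comparable _ _ c0 1 _ (fun m => Y m) _ 0%N) => //; first by lra.
  by move=> m _; rewrite t1_ge mul1r lerDl ltW.
- apply: (@cvg_ln_comparable _ _ (d * c0) 1 _ (fun m => Y m) _ m2) => //; first by lra.
    by rewrite mulr_gt0.
  by move=> m mm; rewrite t2b // mul1r lerDr ltW.
Qed.

(** The totals behave like [X ^+ 2 * Y] and [X ^+ 2], with exponent rows [(2, 1)] and [(2, 0)]. The
    visiting entries need not be comparable with them: [- ln (t2 m)] solves a recursion with
    coefficient 1 forced by the totals, and [f2] is an explicit monomial in the totals and [t2]. *)
Lemma pentagonal_subcritical (L : R) :
  (fun m => X m) @ \oo --> (0 : R) -> (fun m => Y m) @ \oo --> (0 : R) ->
  L ^+ 2 - 2 * L - 2 = 0 -> 2 <= L ->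
  exists l1 l2 l3 l4 : R, [/\ 0 < l1, 0 < l2, 0 < l3, 0 < l4 &
    [/\ (fun m => L ^- m * - ln (f1 m)) @ \oo --> l1,
    (fun m => L ^- m * - ln (f2 m)) @ \oo --> l2,
    (fun m => L ^- m * - ln (t1 m)) @ \oo --> l3 &
    (fun m => L ^- m * - ln (t2 m)) @ \oo --> l4]].
Proof.
move=> Xl0 Yl0 Lch L2.
have c1 := c0_gt0; have cT := c0T; have T1 := T_ge1.
have L3 : L < 3 by nra.
have [m1 hm1] := ln_to_pinfty X_gt0 Xl0 0.
have [m2 hm2] := ln_to_pinfty Y_gt0 Yl0 0.
pose m0 := (maxn m1 m2).+1.
have le1 m : (m0 <= m)%N -> X m <= 1 /\ Y m <= 1.
  move=> mm; have h1 := hm1 m ltac:(lia); have h2 := hm2 m ltac:(lia).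
  by split; rewrite leNgt; apply/negP => /ln_gt0; lra.
have Db m : (m0 <= m)%N -> c0 * X m ^+ 2 <= D m <= X m ^+ 2.
  by case: m => [|m] mm; [lia|exact: D_bounds].
have f1b m : (m0 <= m)%N -> c0 * X m <= f1 m.
  by case: m => [|m] mm; [lia|exact: f1_ge].
have lnc2 := @ln2_gt0 R.
have [l1 [l2 [l10 l20 Xl Yl]]] : exists l1 l2 : R, [/\ 0 < l1, 0 < l2,
    (fun m => L ^- m * - ln (X m)) @ \oo --> l1 &
    (fun m => L ^- m * - ln (Y m)) @ \oo --> l2].
  apply: (@planar_cvg R L (ln 2) 2 1 2 0 _ _ m0).
  - lra.
  - rewrite -[RHS]Lch; ring.
  - rewrite ltr_norml; apply/andP; split; lra.
  - by [].
  - lra.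
  - lra.
  - move=> m m0m; have [X1 Y1] := le1 m m0m.
    rewrite X_rec ln_sqrM ?addr_gt0 ?exprn_gt0 //.
    have Y01 : 0 < Y m <= 1 by rewrite Y_gt0.
    have /andP [h1 h2] := @ln_sum_small R _ 1 2 Y01 isT.
    by rewrite ler_norml; apply/andP; split; lra.
  - move=> m m0m; have [X1 Y1] := le1 m m0m; have /andP [_ h2] := Db m m0m.
    have x2 : 0 < X m ^+ 2 by rewrite exprn_gt0.
    have y31 : Y m ^+ 3 <= 1 by rewrite exprn_ile1 // ltW.
    have y30 : 0 < Y m ^+ 3 by rewrite exprn_gt0.
    have h3 : X m ^+ 2 <= Y m.+1.
      by rewrite Y_rec lerDl mulr_ge0 // ltW // D_gt0.
    have h4 : Y m.+1 <= 2 * X m ^+ 2.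
      by rewrite Y_rec; have := D_gt0 m; nra.
    have /andP [h5 h6] := ln_between x2 h3 h4 ltac:(lra).
    rewrite lnX // in h5 h6.
    by rewrite ler_norml; apply/andP; split; lra.
  - move=> K; have [m3 hm3] := ln_to_pinfty X_gt0 Xl0 `|K|.
    exists (maxn m0 m3); first by lia.
    have h1 := hm3 (maxn m0 m3) ltac:(lia); have h2 := hm2 (maxn m0 m3) ltac:(lia).
    have := ler_norm K; have := normr_ge0 K; nra.
pose l4 := (2 * l1 + 2 * l2) / (L - 1).
have t2l : (fun m => L ^- m * - ln (t2 m)) @ \oo --> l4.
  apply: (@forced_cvg _ L 1 _ _ (fun m => - ln (t2 m.+1) + ln (t2 m)) 0%N).
  - by rewrite normr1; lra.
  - by move=> m _; ring.
  - apply: (@cvg_bounded_ratio _ L (`|ln c0| + `|ln 1|) (fun m => 2 * - ln (X m) + 2 * - ln (Y m)) _ _ m0).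
    + lra.
    + move=> m m0m; have x2 : 0 < X m ^+ 2 by rewrite exprn_gt0.
      have E : ln (t2 m.+1) = ln (D m) + 2 * ln (Y m) + ln (t2 m).
        rewrite t2_rec -/(D m) lnM ?posrE ?mulr_gt0 ?exprn_gt0 ?D_gt0 //.
        by rewrite lnM ?posrE ?exprn_gt0 ?D_gt0 // lnX.
      have := ln_dist x2 c1 (_ : _ <= D m <= 1 * _); rewrite mul1r => /(_ (Db m m0m)).
      by rewrite distrC lnX // E; congr (`|_| <= _); ring.
    + have -> : (fun m => L ^- m * (2 * - ln (X m) + 2 * - ln (Y m))) =
          (fun m => 2 * (L ^- m * - ln (X m)) + 2 * (L ^- m * - ln (Y m))).
        by apply/funext => m; ring.
      by apply: cvgD; apply: cvgMr.
have f2l : (fun m => L ^- m * - ln (f2 m)) @ \oo --> (2 * l1 + (l2 + l4)) / (L - 0).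
  apply: (@forced_cvg _ L 0 _ _ (fun m => - ln (f2 m.+1)) 0%N).
  - by rewrite normr0; lra.
  - by move=> m _; rewrite mul0r add0r.
  - have -> : (fun m => L ^- m * - ln (f2 m.+1)) = (fun m => 2 * (L ^- m * - ln (X m)) +
        (L ^- m * - ln (Y m) + L ^- m * - ln (t2 m))).
      apply/funext => m; rewrite f2_rec ln_sqrM ?mulr_gt0 // lnM ?posrE //; ring.
    by apply: cvgD; [apply: cvgMr | apply: cvgD].
have l40 : 0 < l4 by rewrite /l4 divr_gt0 //; lra.
exists l1, ((2 * l1 + (l2 + l4)) / (L - 0)), l2, l4; split => //.
  by rewrite divr_gt0 //; lra.
split => //.
- apply: (@cvg_Nln_comparable _ _ c0 1 _ (fun m => X m) _ m0) => //; first by lra.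
  by move=> m m0m; rewrite f1b // mul1r lerDl ltW.
- apply: (@cvg_Nln_comparable _ _ c0 1 _ (fun m => Y m) _ 0%N) => //; first by lra.
  by move=> m _; rewrite t1_ge mul1r lerDl ltW.
Qed.

End PentagonalPhases.
(** * Geometry of the gasket *)

Section Geometry.
Context {R : realType} (N : nat) (N_ge3 : (3 <= N)%N) (N_ndvd4 : ~~ (4 %| N)%N).
Implicit Types (i j t : int) (x y z : R[i]).

Let h : R := pi / N%:R.
Let s : int := (sN N)%:Z.
(** The largest sine of an odd multiple of [h]: [2 * s - 1] is the odd number closest to [N / 2], at
    distance at most one half. *)
Let M : R := sin (h * (2 * s - 1)%:~R).
Local Notation q := (vertex R N).
Local Notation rho := (rho R N).

Let N_gt0R : (0 : R) < N%:R.
Proof. by rewrite ltr0n; apply: leq_trans N_ge3. Qed.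

Let N_ge3R : (3 : R) <= N%:R.
Proof. by rewrite ler_nat. Qed.

Let hNpi : h * N%:R = pi.
Proof. by rewrite /h divfK // gt_eqF. Qed.

Let h_gt0 : 0 < h.
Proof. by rewrite divr_gt0 // pi_gt0. Qed.

Let vertexE j : q j = (cos (2 * h * j%:~R) +i* sin (2 * h * j%:~R))%C.
Proof.
rewrite /vertex (_ : 2 * pi * j%:~R / N%:R = 2 * h * j%:~R) //.
by rewrite /h; field; rewrite gt_eqF.
Qed.

Lemma sin_mulh_gt0 (a : R) : 0 < a < N%:R -> 0 < sin (h * a).
Proof.
move=> /andP [a0 aN]; apply: sin_gt0_pi.
by rewrite mulr_gt0 //= -hNpi ltr_pM2l.
Qed.

Lemma vertex_periodic j (n : int) : q (j + N%:Z * n) = q j.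
Proof.
have step t : q (t + N%:Z) = q t.
  rewrite !vertexE (_ : 2 * h * (t + N%:Z)%:~R = 2 * h * t%:~R + pi *+ 2).
    by rewrite cosD2pi sinD2pi.
  by rewrite rmorphD /= -hNpi -pmulrn mulrDr -mulr_natr; ring.
elim: n => [|n IH|n IH]; first by rewrite mulr0 addr0.
  by rewrite -[RHS]IH -[RHS]step; congr q; lia.
by rewrite -[RHS]IH -[LHS]step; congr q; lia.
Qed.

Lemma vertex_shift (j0 j : int) : exists2 n : nat, (n < N)%N & q j = q (j0 + n%:Z).
Proof.
have N0 : N%:Z != 0 by lia.
exists `|((j - j0) %% N%:Z)%Z|%N.
  by rewrite -ltz_nat gez0_abs ?modz_ge0 // ltz_pmod //; lia.
rewrite gez0_abs ?modz_ge0 //.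
rewrite -[RHS](vertex_periodic _ ((j - j0) %/ N%:Z)%Z); congr q.
by have := divz_eq (j - j0) N%:Z; lia.
Qed.

Definition dot x y : R := complex.Re x * complex.Re y + complex.Im x * complex.Im y.

Lemma dot_homothety z r x y :
  dot (homothety z r x) y = (1 - r) * dot z y + r * dot x y.
Proof.
case: z x y => [z1 z2] [x1 x2] [y1 y2].
by rewrite /dot /homothety /=; simpc; rewrite /=; ring.
Qed.

Lemma dot_vertex i j : dot (q i) (q j) = cos (2 * h * (i - j)%:~R).
Proof. by rewrite !vertexE /dot /= -cosB; congr cos; rewrite rmorphB /=; ring. Qed.

Lemma sN_val : (4 * sN N = N + (4 - lN N))%N /\ (0 < lN N < 4)%N.
Proof.
move: N_ndvd4; rewrite /sN /lN /kN /dvdn.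
have := divn_eq N 4; have := ltn_pmod N (isT : 0 < 4)%N; lia.
Qed.

Let sR : exists l : R, [/\ 4 * s%:~R = N%:R + (4 - l) :> R, 1 <= l & l <= 3].
Proof.
have [e l14] := sN_val; exists (lN N)%:R; split.
- rewrite /s -pmulrn -[4 in LHS]/(4%:R) -natrM e natrD natrB //.
  by case/andP: l14 => _ /ltnW.
- by rewrite ler1n; case/andP: l14.
- by rewrite ler_nat -ltnS; case/andP: l14.
Qed.

(** The difference is [2 * sin b * - cos a], where [a] lies strictly between [pi / 2] and
    [3 * pi / 2]. Strictness comes from [l <= 3] at the lower end and from [1 <= l], that is 4 not
    dividing [N], at the upper one. *)
Lemma sin_odd_lt (v : nat) : (0 < v < N)%N ->
  sin (h * (2 * (s + v%:Z) - 1)%:~R) < M.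
Proof.
move=> /andP [v0 vN].
have [l [sl l1 l3]] := sR.
have v0R : (1 : R) <= v%:R by rewrite ler1n.
have vNR : (v%:R : R) <= N%:R - 1.
  by rewrite lerBrDr -[1]/(1%:R) -natrD ler_nat addn1.
rewrite -subr_gt0 /M.
pose a : R := h * (2 * s%:~R - 1 + v%:R); pose b : R := h * v%:R.
rewrite (_ : h * (2 * s - 1)%:~R = a - b); last first.
  by rewrite /a /b rmorphB rmorphM /=; ring.
rewrite (_ : h * (2 * (s + v%:Z) - 1)%:~R = a + b); last first.
  by rewrite /a /b rmorphB rmorphM rmorphD /= -pmulrn; ring.
rewrite sinB sinD (_ : _ - _ = 2 * (sin b * - cos a)); last by ring.
rewrite mulr_gt0 // mulr_gt0 //.
  by apply: sin_mulh_gt0; rewrite ltr0n v0 ltr_nat.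
have -> : - cos a = cos (a - pi).
  by rewrite -[in LHS](subrK pi a) cosDpi opprK.
apply: cos_gt0_pihalf; rewrite -hNpi /a.
rewrite -mulrBr -mulrA -mulrN !ltr_pM2l //; apply/andP; split; lra.
Qed.

(** [sinE] expresses the sine through the point [q u], so it is [N]-periodic in [u] and [sin_odd_lt]
    covers all residues. *)
Lemma sin_odd_le t : sin (h * (2 * t - 1)%:~R) <= M /\ (sin (h * (2 * t - 1)%:~R) = M -> q t = q s).
Proof.
have sinE u : sin (h * (2 * u - 1)%:~R) * (2 * sin h) =
    dot (q u) (q 1) - dot (q u) (q 0).
  rewrite !dot_vertex subr0 (_ : 2 * h * u%:~R = h * (2 * u - 1)%:~R + h); last first.
    by rewrite rmorphB rmorphM /=; ring.
  rewrite (_ : 2 * h * (u - 1)%:~R = h * (2 * u - 1)%:~R - h); last first.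
    by rewrite !rmorphB rmorphM /=; ring.
  by rewrite cosB cosD; ring.
have sh : 0 < 2 * sin h.
  rewrite mulr_gt0 // -[h]mulr1; apply: sin_mulh_gt0.
  by rewrite ltr01 /=; apply: lt_le_trans N_ge3R; rewrite ltr1n.
have [n nN tE] := vertex_shift s t.
have -> : sin (h * (2 * t - 1)%:~R) = sin (h * (2 * (s + n%:Z) - 1)%:~R).
  by apply: (mulIf (lt0r_neq0 sh)); rewrite !sinE tE.
case: n nN tE => [|n] nN tE; first by rewrite addr0 in tE *.
have lt := @sin_odd_lt n.+1 nN.
by split; [exact: ltW | move=> e; rewrite e ltxx in lt].
Qed.

(** Here [cosh] stands for [cos h], and [sinh] below for [sin h], not for hyperbolic functions. [M]
    is the cosine of an angle of size at most [h / 2]. *)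
Lemma cosh_le_M : cos h <= M.
Proof.
have [l [sl l1 l3]] := sR.
rewrite /M -cosBpihalf -[cos (_ - _)]cos_norm.
rewrite leNgt; apply/negP.
rewrite ltr_cos; first 1 last.
- by rewrite in_itv /= ltW //= -hNpi; have h0 := h_gt0; have h3 := N_ge3R; nra.
- rewrite in_itv /= normr_ge0 /= -hNpi rmorphB rmorphM /= ler_norml.
  have h0 := h_gt0; have h3 := N_ge3R; apply/andP; split; nra.
apply/negP; rewrite -leNgt -hNpi rmorphB rmorphM /= ler_norml.
have h0 := h_gt0; have h3 := N_ge3R; apply/andP; split; nra.
Qed.

Lemma M_gt0 : 0 < M.
Proof.
apply: lt_le_trans cosh_le_M; apply: cos_gt0_pihalf; rewrite -hNpi.
have h0 := h_gt0; have h3 := N_ge3R; apply/andP; split; nra.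
Qed.

Lemma sinh_gt0 : 0 < sin h.
Proof.
rewrite -[h]mulr1; apply: sin_mulh_gt0.
by rewrite ltr01 /=; apply: lt_le_trans N_ge3R; rewrite ltr1n.
Qed.

Lemma rhoE : rho = sin h / (sin h + M).
Proof.
rewrite /Defs.rho /M /s; congr (_ / (_ + sin _)).
rewrite -mulrA mulrC /h; congr (_ * _).
Qed.

Lemma rho_bounds : 0 < rho < 1.
Proof.
rewrite rhoE; have h1 := sinh_gt0; have h2 := M_gt0.
by rewrite divr_gt0 ?addr_gt0 //= ltr_pdivrMr ?addr_gt0 // mul1r ltrDl.
Qed.

(** The equation that determines [rho]: neighbouring cells touch ([contactE]) and do not overlap
    ([gap_cell_edge]). *)
Lemma rho_eq : (1 - rho) * sin h = rho * M.
Proof.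
rewrite rhoE; field; apply: lt0r_neq0; apply: addr_gt0; [exact: sinh_gt0|exact: M_gt0].
Qed.

Lemma vertexB_dot i d t :
  dot (q t) (q i) - dot (q t) (q (i + d)) =
  - (2 * sin (h * d%:~R) * sin (h * (2 * (t - i) - d)%:~R)).
Proof.
rewrite !dot_vertex.
rewrite (_ : 2 * h * (t - i)%:~R = h * (2 * (t - i) - d)%:~R + h * d%:~R); last first.
  by rewrite !(rmorphB, rmorphM) /=; ring.
rewrite (_ : 2 * h * (t - (i + d))%:~R = h * (2 * (t - i) - d)%:~R - h * d%:~R); last first.
  by rewrite !(rmorphB, rmorphM, rmorphD) /=; ring.
by rewrite cosD cosB; ring.
Qed.

Lemma vertexD i j : q (i + j) = q i * q j.
Proof.
rewrite !vertexE; simpc; rewrite rmorphD /= mulrDr cosD sinD.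
by congr (_ +i* _)%C; ring.
Qed.

Lemma vertexN i : q (- i) = conjc (q i).
Proof. by rewrite !vertexE /conjc; rewrite rmorphN /= mulrN cosN sinN. Qed.

Lemma vertexB_edge i t (e : int) : e \in [:: 1; -1] ->
  - (2 * sin h * M) <= dot (q t) (q i) - dot (q t) (q (i + e)) /\
  (dot (q t) (q i) - dot (q t) (q (i + e)) = - (2 * sin h * M) ->
   q t = q (i + e * s)).
Proof.
have sh := sinh_gt0; have sh2 : 2 * sin h != 0 by rewrite mulf_neq0 ?gt_eqF.
have te : t = i + (t - i) by lia.
rewrite !inE vertexB_dot => /orP [] /eqP ->.
  rewrite mulr1 mul1r; have [h1 h2] := sin_odd_le (t - i); split.
    by rewrite lerN2 ler_pM2l // mulr_gt0.
  move/oppr_inj/(mulfI sh2)/h2 => h3.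
  by rewrite te vertexD h3 -vertexD.
have [] := sin_odd_le (i - t).
have -> : h * (2 * (t - i) - -1)%:~R = - (h * (2 * (i - t) - 1)%:~R).
  by rewrite !(rmorphB, rmorphM, rmorphN) /=; ring.
rewrite mulrN1 !sinN !mulrN mulNr opprK mulN1r => h1 h2; split.
  by rewrite lerN2 ler_pM2l // mulr_gt0.
move/oppr_inj/(mulfI sh2)/h2 => h3.
by rewrite te vertexD (_ : t - i = - (i - t)) ?vertexN ?h3 -?vertexN -?vertexD //; lia.
Qed.

Lemma vertex_neq i (n : nat) : (0 < n < N)%N -> q (i + n%:Z) != q i.
Proof.
move=> /andP [n0 nN]; apply/eqP => e.
have := dot_vertex i (i + n%:Z); rewrite e dot_vertex subrr mulr0 cos0.
have -> : (i - (i + n%:Z))%:~R = - n%:R :> R.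
  by rewrite (_ : _ - _ = - n%:Z) ?rmorphN //; lia.
rewrite mulrN cosN -mulrA [2 * _]mulr_natl.
have : 0 < sin (h * n%:R) by apply: sin_mulh_gt0; rewrite ltr0n n0 ltr_nat.
rewrite cos_mulr2n cos2sin2 => sp; nra.
Qed.

Lemma sin_mid_ge (d : nat) : (1 < d < N.-1)%N -> sin (h * 2) <= sin (h * d%:R).
Proof.
move=> /andP [d1 dN].
have d1R : (2 : R) <= d%:R by rewrite ler_nat.
have dNR : (d%:R : R) + 2 <= N%:R by rewrite -natrD ler_nat; lia.
pose a := h * (d%:R + 2) / 2; pose b := h * (d%:R - 2) / 2.
rewrite -subr_ge0 (_ : h * 2 = a - b); last by rewrite /a /b; field.
rewrite (_ : h * d%:R = a + b); last by rewrite /a /b; field.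
rewrite sinB sinD (_ : _ - _ = 2 * (cos a * sin b)); last by ring.
have h0 := h_gt0; have h3 := N_ge3R.
rewrite mulr_ge0 // mulr_ge0 //.
  by apply: cos_ge0_pihalf; rewrite -hNpi /a; apply/andP; split; nra.
by apply: sin_ge0_pi; rewrite -hNpi /b; apply/andP; split; nra.
Qed.

(** The right side is at least [cos h * sin (2 h) = 2 * cos h ^+ 2 * sin h], and
    [2 * cos h ^+ 2 > 1] because [cos (2 h) > 0]. Such a [d] forces [N >= 4], hence [N >= 5]. *)
Lemma sin_mid_gt (d : nat) : (1 < d < N.-1)%N -> sin h < M * sin (h * d%:R).
Proof.
move=> dN; have N5R : (4 : R) < N%:R by rewrite ltr_nat; move: N_ndvd4; lia.
have h0 := h_gt0; have sh := sinh_gt0; have M0 := M_gt0; have cM := cosh_le_M.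
have ch : 0 < cos (h * 2).
  by apply: cos_gt0_pihalf; rewrite -hNpi; apply/andP; split; nra.
have := sin_mid_ge dN; rewrite mulr_natr sin_mulr2n => sd.
have c1 : 1 < 2 * cos h * cos h.
  by move: ch; rewrite mulr_natr cos_mulr2n; lra.
have chp : 0 < cos h.
  by apply: cos_gt0_pihalf; rewrite -hNpi; apply/andP; split; nra.
apply: (@lt_le_trans _ _ (2 * cos h * cos h * sin h)); first by rewrite ltr_pMl.
apply: (@le_trans _ _ (cos h * sin (h * d%:R))).
  rewrite (_ : _ * sin h = cos h * (cos h * sin h *+ 2)) ?ler_pM2l //; ring.
rewrite ler_wpM2r // (le_trans _ sd) // -mulr_natl.
by rewrite !mulr_ge0 // ltW.
Qed.

Lemma contactE j : Psi N j (q (j + s)) = Psi N (j + 1) (q (j + 1 - s)).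
Proof.
rewrite /Psi /homothety !vertexE; simpc.
pose a := h * (2 * j + 1)%:~R; pose b := h * (2 * s - 1)%:~R.
have -> : 2 * h * j%:~R = a - h by rewrite /a rmorphD rmorphM /=; ring.
have -> : 2 * h * (j + 1)%:~R = a + h by rewrite /a !rmorphD rmorphM /=; ring.
have -> : 2 * h * (j + s)%:~R = a + b.
  by rewrite /a /b !(rmorphD, rmorphN, rmorphM) /=; ring.
have -> : 2 * h * (j + 1 - s)%:~R = a - b.
  by rewrite /a /b !(rmorphD, rmorphN, rmorphM) /=; ring.
have e : (1 - rho) * sin h = rho * sin b := rho_eq.
congr (_ +i* _)%C; apply/eqP; rewrite -subr_eq0; apply/eqP.
  transitivity (2 * sin a * ((1 - rho) * sin h - rho * sin b)).
    by rewrite !(cosB, cosD); ring.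
  by rewrite e subrr mulr0.
transitivity (- (2 * cos a * ((1 - rho) * sin h - rho * sin b))).
  by rewrite !(sinB, sinD); ring.
by rewrite e subrr mulr0 oppr0.
Qed.

Definition contact (e : int) j : R[i] := Psi N j (q (j + e * s)).

Lemma contact_sym (e : int) j : e \in [:: 1; -1] ->
  contact e j = contact (- e) (j + e).
Proof.
rewrite !inE /contact => /orP [] /eqP ->.
  by rewrite mul1r contactE mulN1r.
have := contactE (j - 1); rewrite subrK => e1.
by rewrite mulN1r opprK mul1r; exact: esym e1.
Qed.

Lemma Psi_inj j : injective (Psi N j : R[i] -> R[i]).
Proof.
have /andP [r0 _] := rho_bounds => x y; rewrite /Psi /homothety.
move=> /addrI /mulfI h0; have /h0 /addIr // : (rho%:C)%C != 0 :> R[i].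
by rewrite eq_complex /= eqxx andbT gt_eqF.
Qed.

Lemma Psi_fix j : Psi N j (q j) = q j.
Proof. by rewrite /Psi /homothety subrr mulr0 addr0. Qed.

Lemma Psi_periodic i j : q i = q j -> Psi N i =1 (Psi N j : R[i] -> R[i]).
Proof. by move=> e x; rewrite /Psi e. Qed.

(* The gasket before rescaling: [gasket R N m] is its image under the [m]-th
   iterate of [PsiV N 0]. *)
Fixpoint level (m : nat) : {fset {fset R[i]}} :=
  if m is n.+1 then
    (\bigcup_(i in 'I_N) image_graph (Psi N (i : nat)%:Z) (level n))%fset
  else base_cycle R N.

Definition level_cell (m : nat) j : {fset {fset R[i]}} :=
  image_graph (Psi N j) (level m).

Lemma level_cell_periodic m i j : q i = q j -> level_cell m i = level_cell m j.
Proof. by move=> e; apply: eq_image_graph; exact: Psi_periodic. Qed.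

Lemma in_levelS m e : reflect (exists j, e \in level_cell m j) (e \in level m.+1).
Proof.
apply: (iffP (bigfcupP _ _ _ _)) => [[i _ ei]|[j ej]]; first by exists (i : nat)%:Z.
have [n nN jE] := vertex_shift 0 j; rewrite add0r in jE.
exists (Ordinal nN); first by rewrite mem_index_enum.
by rewrite (level_cell_periodic _ jE) in ej.
Qed.

Lemma vtx_levelS m x : reflect (exists j, x \in vtx (level_cell m j))
  (x \in vtx (level m.+1)).
Proof.
apply: (iffP (vtxP _ _)) => [[e /in_levelS [j ej] xe]|[j /vtxP [e ej xe]]].
  by exists j; apply/vtxP; exists e.
by exists e => //; apply/in_levelS; exists j.
Qed.

Lemma vtx_level_ind (P : R[i] -> Prop) : (forall t, P (q t)) ->
  (forall t y, P y -> P (Psi N t y)) -> forall m x, x \in vtx (level m) -> P x.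
Proof.
move=> P0 PS; elim=> [|m IH] x.
  move=> /vtxP [_ /imfsetP [i _ ->]]; rewrite !inE => /orP [] /eqP -> //.
by move=> /vtx_levelS [j /vtx_image_graph [y /IH Py ->]]; exact: PS.
Qed.

Lemma vertex_level m t : q t \in vtx (level m).
Proof.
elim: m => [|m IH]; last first.
  by apply/vtx_levelS; exists t; apply/vtx_image_graph; exists (q t); rewrite ?Psi_fix.
have [n nN ->] := vertex_shift 0 t; rewrite add0r.
apply/vtxP; exists [fset q n%:Z; q (n%:Z + 1)]%fset; last by rewrite !inE eqxx.
by apply/imfsetP; exists (Ordinal nN).
Qed.

(* [gap i (i + d)] separates cell [i], where it is nonnegative, from cell
   [i + d], where it is nonpositive; for neighbouring cells it vanishes on a
   cell only at the contact point, thanks to the choice of [rho]. *)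
Definition gap i j x : R := dot x (q i) - dot x (q j).

Lemma gap_Psi i j t x : gap i j (Psi N t x) = (1 - rho) * gap i j (q t) + rho * gap i j x.
Proof. by rewrite /gap /Psi !dot_homothety; ring. Qed.

(** By [gap_Psi], the value at an image point is a convex combination of a value at a corner and one
    at the previous level. *)
Lemma gap_level i j (B : R) m x : (forall t, B <= gap i j (q t)) ->
  x \in vtx (level m) -> B <= gap i j x.
Proof.
have /andP [r0 r1] := rho_bounds => h0.
apply: (@vtx_level_ind (fun x => B <= gap i j x)) => // t y hy.
by rewrite gap_Psi; have := h0 t; nra.
Qed.

(** Equality in a convex combination forces both terms to be minimal, so by induction [x] is the
    image of [q u] under the map that fixes [q u]. *)
Lemma gap_level_eq i j (B : R) u m x : (forall t, B <= gap i j (q t)) ->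
  (forall t, gap i j (q t) = B -> q t = q u) ->
  x \in vtx (level m) -> gap i j x = B -> x = q u.
Proof.
have /andP [r0 r1] := rho_bounds => h0 h1.
suff : forall x, x \in vtx (level m) -> B <= gap i j x /\ (gap i j x = B -> x = q u).
  by move=> h2 /h2 [].
apply: (@vtx_level_ind (fun x => _ <= gap i j x /\ (_ -> x = q u))).
  by move=> t; split; [exact: h0 | exact: h1].
move=> t y [hy hy1]; rewrite gap_Psi; have ht := h0 t.
split; first by nra.
move=> e; have gy : gap i j y = B by nra.
have gt : gap i j (q t) = B by nra.
by rewrite (hy1 gy) (Psi_periodic (h1 _ gt)) Psi_fix.
Qed.

Lemma gap_cell_edge m i (e : int) x : e \in [:: 1; -1] ->
  x \in vtx (level_cell m i) ->
  0 <= gap i (i + e) x /\ (gap i (i + e) x = 0 -> x = contact e i).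
Proof.
move=> e1 /vtx_image_graph [y ym ->]; rewrite gap_Psi.
have /andP [r0 r1] := rho_bounds; have := rho_eq; have sh := sinh_gt0.
have -> : gap i (i + e) (q i) = 2 * sin h * sin h.
  rewrite /gap vertexB_dot subrr mulr0 sub0r.
  by move: e1; rewrite !inE => /orP [] /eqP ->; rewrite ?opprK mulr1 ?mulrN1 ?rmorphN /= ?mulrN ?mulr1 sinN; ring.
move=> re; have hb t := (vertexB_edge i t e1).1.
have he t := (vertexB_edge i t e1).2.
have yB := gap_level hb ym.
have E : (1 - rho) * (2 * sin h * sin h) = rho * (2 * sin h * M).
  transitivity (2 * sin h * ((1 - rho) * sin h)); first by ring.
  by rewrite re; ring.
rewrite E -mulrDr; split.
  by apply: mulr_ge0; [exact: ltW | rewrite -lerBlDl sub0r].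
move=> /eqP; rewrite mulf_eq0 gt_eqF //= addrC addr_eq0 => /eqP ye.
by rewrite (gap_level_eq hb he ym ye).
Qed.

Lemma gap_cell_far m i (d : nat) x : (1 < d < N.-1)%N ->
  x \in vtx (level_cell m i) -> 0 < gap i (i + d%:Z) x.
Proof.
move=> dN /vtx_image_graph [y ym ->]; rewrite gap_Psi.
have /andP [r0 r1] := rho_bounds; have re := rho_eq; have sh := sinh_gt0.
have sd := sin_mid_gt dN.
have sd0 : 0 < sin (h * d%:R) by have := M_gt0; nra.
have -> : gap i (i + d%:Z) (q i) = 2 * sin (h * d%:R) * sin (h * d%:R).
  rewrite /gap vertexB_dot subrr mulr0 sub0r rmorphN /= mulrN sinN -pmulrn; ring.
have yB : - (2 * sin (h * d%:R)) <= gap i (i + d%:Z) y.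
  apply: gap_level ym => t; rewrite /gap vertexB_dot -pmulrn lerN2.
  by rewrite -{2}[2 * _]mulr1 ler_pM2l ?sin_le1 // mulr_gt0.
(* After bounding a sine at the corners by 1, this is what positivity of [gap] on the cell requires;
   multiplied by [sin h] and rewritten with [rho_eq], it is [sin_mid_gt]. *)
have key : rho < (1 - rho) * sin (h * d%:R).
  rewrite -(ltr_pM2r sh).
  have -> : (1 - rho) * sin (h * d%:R) * sin h = rho * (M * sin (h * d%:R)).
    transitivity ((1 - rho) * sin h * sin (h * d%:R)); first by ring.
    by rewrite re; ring.
  by rewrite ltr_pM2l.
apply: (@lt_le_trans _ _ (2 * sin (h * d%:R) * ((1 - rho) * sin (h * d%:R) - rho))).
  by rewrite !mulr_gt0 // subr_gt0.
nra.
Qed.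

(** A common point has [gap] of both signs. For neighbours it is then zero, attained at the contact
    only; otherwise both inequalities are strict. The step [d = N.-1] is the neighbour on the other
    side. *)
Lemma cell_meet m i (d : nat) x : (0 < d < N)%N ->
  x \in vtx (level_cell m i) -> x \in vtx (level_cell m (i + d%:Z)) ->
  (d = 1%N /\ x = contact 1 i) \/ (d = N.-1 /\ x = contact (-1) i).
Proof.
move=> dN xi xj.
have [d1|d1] := eqVneq d 1%N.
  left; split=> //; rewrite d1 in xj.
  have [g0 ->//] := @gap_cell_edge m i 1 x isT xi.
  have [g1 _] := @gap_cell_edge m (i + 1) (-1) x isT xj.
  by move: g0 g1; rewrite addrK /gap; lra.
have [d2|d2] := eqVneq d N.-1.
  right; split=> //.
  have e : q (i + d%:Z) = q (i - 1).
    by rewrite -[RHS](vertex_periodic _ 1); congr q; lia.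
  rewrite (level_cell_periodic _ e) in xj.
  have [g0 ->//] := @gap_cell_edge m i (-1) x isT xi.
  have [g1 _] := @gap_cell_edge m (i - 1) 1 x isT xj.
  by move: g0 g1; rewrite subrK /gap; lra.
have g0 := @gap_cell_far m i d x.
have g1 := @gap_cell_far m (i + d%:Z) (N - d)%N x.
have e : q (i + d%:Z + (N - d)%N%:Z) = q i.
  by rewrite -[RHS](vertex_periodic _ 1); congr q; lia.
have c0 : (1 < d < N.-1)%N by lia.
have c1 : (1 < N - d < N.-1)%N by lia.
by exfalso; move: (g0 c0 xi) (g1 c1 xj); rewrite /gap e; lra.
Qed.


Lemma vertex_eq_mod i j : (exists n : int, i = j + N%:Z * n) -> q i = q j.
Proof. by move=> [n ->]; exact: vertex_periodic. Qed.

Lemma level_card2 m e : e \in level m -> #|` e| = 2%N.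
Proof.
elim: m e => [|m IH] e.
  move=> /imfsetP [i _ ->]; rewrite cardfs2 eq_sym.
  by rewrite vertex_neq //; exact: leq_trans N_ge3.
move=> /in_levelS [j /image_graphP [e' /IH e2 ->]].
by rewrite card_imfset //; exact: Psi_inj.
Qed.

Lemma level_edge2 m u v : adj (level m) u v -> u != v.
Proof. by move=> /level_card2; rewrite cardfs2; case: eqVneq. Qed.

Lemma level_cell_edge2 m j u v : adj (level_cell m j) u v -> u != v.
Proof.
move=> a; apply: (@level_edge2 m.+1).
by apply: adj_sub a; apply/fsubsetP => e ej; apply/in_levelS; exists j.
Qed.

Lemma cell_meet_dir m (e : int) i (d : nat) x : e \in [:: 1; -1] ->
  (0 < d < N)%N -> x \in vtx (level_cell m i) ->
  x \in vtx (level_cell m (i + e * d%:Z)) ->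
  (d = 1%N /\ x = contact e i) \/ (d = N.-1 /\ x = contact (- e) i).
Proof.
rewrite !inE => /orP [] /eqP -> dN; first by rewrite mul1r; exact: cell_meet.
move=> xi xj; rewrite opprK.
have e0 : q (i + -1 * d%:Z) = q (i + (N - d)%N%:Z).
  by apply: vertex_eq_mod; exists (-1); lia.
rewrite (level_cell_periodic _ e0) in xj.
have [] := cell_meet _ xi xj; first by lia.
  by move=> [h1 ->]; right; split=> //; lia.
by move=> [h1 ->]; left; split=> //; lia.
Qed.

(** An edge has two distinct vertices, while two distinct cells share at most one; the two contact
    cases cannot both occur since [N.-1] is not 1. *)
Lemma cell_edge_disj m (e : int) i (d : nat) g : e \in [:: 1; -1] -> (0 < d < N)%N ->
  g \in level_cell m i -> g \notin level_cell m (i + e * d%:Z).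
Proof.
move=> e1 dN gi; apply/negP => gi'.
have g2 : #|` g| = 2%N.
  move: (gi); case/image_graphP => g0 g0m ->.
  by rewrite card_imfset; [exact: level_card2 g0m | exact: Psi_inj].
have : g != fset0 by rewrite -cardfs_gt0 g2.
move=> /fset0Pn [x xg]; have [y [yx ge]] := fset_pairP g2 xg.
have meet z : z \in g -> (d = 1%N /\ z = contact e i) \/ (d = N.-1 /\ z = contact (- e) i).
  by move=> zg; apply: (@cell_meet_dir m e i d) => //; apply/vtxP; exists g.
have N1 : N.-1 <> 1%N by clear -N_ge3; lia.
have yg : y \in g by rewrite ge !inE eqxx orbT.
have [[d1 xE]|[d1 xE]] := meet x xg; have [[d2 yE]|[d2 yE]] := meet y yg;
  by [rewrite xE yE eqxx in yx | case: N1; rewrite -d1 -d2].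
Qed.

Lemma sN_bounds : (0 < sN N)%N /\ (2 * sN N < N)%N.
Proof. by have [h1 h2] := sN_val; split; lia. Qed.

Lemma vertex_contact_neq (e : int) j : e \in [:: 1; -1] -> q (j + e * s) != q j.
Proof.
have [s0 sN2] := sN_bounds.
rewrite !inE => /orP [] /eqP ->; first by rewrite mul1r; apply: vertex_neq; lia.
rewrite (vertex_eq_mod (j := j + (N - sN N)%N%:Z)); last by exists (-1); lia.
by apply: vertex_neq; lia.
Qed.

Lemma contact_neq (e : int) j : e \in [:: 1; -1] -> contact e j != contact (- e) j.
Proof.
have [s0 sN2] := sN_bounds => e1; rewrite (inj_eq (@Psi_inj j)).
rewrite (_ : j + e * s = j + - e * s + e * (2 * sN N)%N%:Z); last by lia.
move: e1; rewrite !inE => /orP [] /eqP ->.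
  by rewrite mul1r; apply: vertex_neq; lia.
rewrite [X in X != _](vertex_eq_mod (j := j + - -1 * s + (N - 2 * sN N)%N%:Z)).
  by apply: vertex_neq; lia.
by exists (-1); lia.
Qed.

Lemma contact_in m (e : int) j : contact e j \in vtx (level_cell m j).
Proof. by apply/vtx_image_graph; exists (q (j + e * s)) => //; exact: vertex_level. Qed.

Lemma contact_in_next m (e : int) j : e \in [:: 1; -1] ->
  contact e j \in vtx (level_cell m (j + e)).
Proof. by move=> /contact_sym ->; exact: contact_in. Qed.

Lemma corner_in_cell m j : q j \in vtx (level_cell m j).
Proof. by apply/vtx_image_graph; exists (q j); rewrite ?Psi_fix //; exact: vertex_level. Qed.

(** A corner lying in a second cell would be a contact of its own cell, but it is the fixed point of
    that cell's map and a contact is not. *)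
Lemma corner_cell m j t : q t \in vtx (level_cell m j) -> q j = q t.
Proof.
have [n nN jE] := vertex_shift t j; rewrite (level_cell_periodic _ jE) => tj.
case: n nN jE tj => [|n] nN jE tj; first by rewrite jE addr0.
have tN (e : int) : e \in [:: 1; -1] -> q t <> contact e t.
  move=> e1 te; have /eqP := vertex_contact_neq t e1; apply.
  by apply: (@Psi_inj t); rewrite Psi_fix -/(contact e t) -te.
by have [[_ e]|[_ e]] := cell_meet (d := n.+1) nN (corner_in_cell m t) tj;
  case: (tN _ _ e).
Qed.

(** * Dihedral symmetries of the gasket *)

Definition flip (b : bool) (j : int) : int := if b then - j else j.

Definition symmetry (a : int) (b : bool) (x : R[i]) : R[i] :=
  q a * (if b then conjc x else x).

Lemma conjc_mul x y : conjc (x * y) = conjc x * conjc y.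
Proof. by case: x y => [x1 x2] [y1 y2]; simpc; congr (_ +i* _)%C; ring. Qed.

Lemma conjc_homothety z r x :
  conjc (homothety z r x) = homothety (conjc z) r (conjc x).
Proof.
case: z x => [z1 z2] [x1 x2]; rewrite /homothety; simpc.
by congr (_ +i* _)%C; ring.
Qed.

Lemma symmetry_vertex a b j : symmetry a b (q j) = q (a + flip b j).
Proof. by rewrite vertexD /symmetry; case: b; rewrite //= vertexN. Qed.

Lemma symmetry_Psi a b j x :
  symmetry a b (Psi N j x) = Psi N (a + flip b j) (symmetry a b x).
Proof.
rewrite /Psi -symmetry_vertex /symmetry.
by case: b; rewrite ?conjc_homothety /homothety; ring.
Qed.

Lemma vertex0 : q 0 = 1.
Proof. by rewrite vertexE mulr0 cos0 sin0. Qed.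

Lemma symmetryK a b : cancel (symmetry a b) (symmetry (if b then a else - a) b).
Proof.
case: b => x; rewrite /symmetry ?conjc_mul ?conjcK mulrA -?vertexN -vertexD;
by rewrite ?addrN ?addNr vertex0 mul1r.
Qed.

Lemma symmetry_inj a b : injective (symmetry a b).
Proof. exact: can_inj (symmetryK a b). Qed.

Lemma symmetry_level a b m : image_graph (symmetry a b) (level m) = level m.
Proof.
have sub a' : (image_graph (symmetry a' b) (level m) `<=` level m)%fset.
  apply/fsubsetP; elim: m => [|m IH] e /image_graphP [e' e'm ->].
    case/imfsetP: e'm => i _ ->.
    rewrite imfset_pair.
    rewrite !symmetry_vertex /flip; case: (b).
      rewrite fsetUC; have [n nN jE] := vertex_shift 0 (a' + - (i%:Z + 1)).
      rewrite add0r in jE; apply/imfsetP; exists (Ordinal nN) => //=.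
      rewrite -jE (_ : a' + - i%:Z = a' - (i%:Z + 1) + 1); last by lia.
      by rewrite (vertexD (a' - (i%:Z + 1)) 1) jE -vertexD.
    have [n nN jE] := vertex_shift 0 (a' + i%:Z).
    rewrite add0r in jE; apply/imfsetP; exists (Ordinal nN) => //=.
    rewrite -jE (_ : a' + (i%:Z + 1) = a' + i%:Z + 1); last by lia.
    by rewrite (vertexD (a' + i%:Z) 1) jE -vertexD.
  case/in_levelS: e'm => j /image_graphP [e'' e2 ->].
  apply/in_levelS; exists (a' + flip b j); apply/image_graphP.
  exists (symmetry a' b @` (e'' : {fset R[i]}))%fset.
    by apply: IH; apply/image_graphP; exists e''.
  rewrite -!imfset_comp; apply: eq_imfset => // x /=; exact: symmetry_Psi.
apply/eqP; rewrite eqEfsubset sub /=; apply/fsubsetP => e em.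
pose a' := if b then a else - a.
have e1 : (symmetry a' b @` (e : {fset R[i]}))%fset \in level m.
  by apply: (fsubsetP (sub a')); apply/image_graphP; exists e.
apply/image_graphP; exists (symmetry a' b @` (e : {fset R[i]}))%fset => //.
rewrite -imfset_comp.
have sK : symmetry a b \o symmetry a' b =1 id.
  move=> x /=; have := @symmetryK a' b x; congr (_ = _); congr (symmetry _ _ _).
  by rewrite /a'; case: (b); rewrite ?opprK.
by rewrite (eq_imfset (q := mem e) _ sK) //= imfset_id.
Qed.

(** * Crossing recursions *)

Section Crossings.
Context (w : R).

Definition avoiding (o : option int) : pred R[i] :=
  if o is Some t then pred1 (q t) else pred0.

Definition crossing m i j o : R := walk_sum w (level m) (q i) (q j) (avoiding o).

Lemma crossing_periodic m i j o i' j' o' : q i = q i' -> q j = q j' ->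
  avoiding o =1 avoiding o' -> crossing m i j o = crossing m i' j' o'.
Proof.
move=> ei ej eo; rewrite /crossing ei ej; apply: eq_fsbigl.
apply/funext => p; rewrite /saws; congr (is_true (_ && all _ _)).
by apply/funext => x; rewrite /= eo.
Qed.

Lemma crossing_sym m i j o a b :
  crossing m (a + flip b i) (a + flip b j) (omap (fun t => a + flip b t) o) =
  crossing m i j o.
Proof.
rewrite /crossing -!symmetry_vertex -{1}(symmetry_level a b m).
rewrite /walk_sum -walk_sum_image; last exact: symmetry_inj.
apply: eq_fsbigl; apply/funext => p; rewrite /saws.
congr (is_true (_ && all _ _)); apply/funext => x; case: o => //= t.
by rewrite -symmetry_vertex (inj_eq (@symmetry_inj a b)).
Qed.

Lemma crossing_rev m i j o : crossing m i j o = crossing m j i o.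
Proof. exact: walk_sum_rev. Qed.

(** Side and base refer to the isosceles triangle with apex [q 0] and base corners [q (- s)], [q s].
    [cross_side] and [cross_base] are [X] and [Y]; the avoiding versions give [phi_1] and [theta_1]
    for [N = 5], and [cross_side_avoid] gives [x] for [N = 3]. *)
Definition cross_side m := crossing m 0 s None.
Definition cross_side_avoid m := crossing m 0 s (Some (- s)).
Definition cross_base m := crossing m (- s) s None.
Definition cross_base_avoid m := crossing m (- s) s (Some 0).

Local Notation X := cross_side.
Local Notation X1 := cross_side_avoid.
Local Notation Y := cross_base.
Local Notation Y1 := cross_base_avoid.

Definition dir (b : bool) : int := flip b 1.

Lemma dirP b : dir b \in [:: 1; -1].
Proof. by case: b. Qed.

Lemma dirE b j : flip b j = dir b * j.
Proof. by case: b; rewrite /dir /= ?mulN1r ?mul1r. Qed.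

Lemma dirN b : dir (~~ b) = - dir b.
Proof. by case: b; rewrite /dir /= ?opprK. Qed.

Lemma cross_sideE m b t o : crossing m t (t + dir b * s) o = crossing m 0 s (omap (fun u => dir b * (u - t)) o).
Proof.
rewrite -[RHS](@crossing_sym m _ _ _ t b).
have -> : t + flip b 0 = t by case: (b); rewrite /= ?oppr0 addr0.
rewrite dirE; congr crossing; case: o => //= u; congr Some.
by rewrite dirE; move: (dirP b); rewrite !inE => /orP [] /eqP ->; lia.
Qed.

Lemma cross_sideE' m b t o : crossing m (t - dir b * s) t o = crossing m 0 s (omap (fun u => - dir b * (u - t)) o).
Proof. by rewrite crossing_rev -mulNr -dirN cross_sideE. Qed.

Lemma cross_baseE m b t o : crossing m (t - dir b * s) (t + dir b * s) o = crossing m (- s) s (omap (fun u => dir b * (u - t)) o).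
Proof.
rewrite -[RHS](@crossing_sym m _ _ _ t b) !dirE mulrN.
congr crossing; case: o => //= u; congr Some.
by rewrite dirE; move: (dirP b); rewrite !inE => /orP [] /eqP ->; lia.
Qed.

(** By [corner_cell], avoiding the corner [q u] constrains a walk only inside the cell whose own
    corner is [q u]. *)
Definition local_avoid (o : option int) t : option int :=
  if o is Some u then if q u == q t then Some t else None else None.

Lemma cell_crossing m t i j o : q i != q j ->
  walk_sum w (level_cell m t) (Psi N t (q i)) (Psi N t (q j)) (avoiding o) =
  crossing m i j (local_avoid o t).
Proof.
move=> ij; rewrite /walk_sum -walk_sum_image; last exact: Psi_inj.
apply: eq_walk_sum => // x xm; case: o => [u|] //=.
case: (eqVneq (q u) (q t)) => [->|/eqP ut] /=.
  by rewrite -{1}(Psi_fix t) (inj_eq (@Psi_inj t)).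
apply/eqP => e; apply: ut; apply/esym/(@corner_cell m).
by rewrite -e; apply/vtx_image_graph; exists x.
Qed.

Lemma cell_crossing_avoid m t i j k o : q i != q j -> local_avoid o t = None ->
  walk_sum w (level_cell m t) (Psi N t (q i)) (Psi N t (q j))
    [predU1 (Psi N t (q k)) & avoiding o] = crossing m i j (Some k).
Proof.
move=> ij ot; rewrite /walk_sum -walk_sum_image; last exact: Psi_inj.
apply: eq_walk_sum => // x xm; rewrite /= (inj_eq (@Psi_inj t)).
case: eqP => //= _; case: o ot => [u|] //=; case: eqP => // ut _.
apply/eqP => e; apply: ut; apply/esym/(@corner_cell m).
by rewrite -e; apply/vtx_image_graph; exists x.
Qed.

(** * The ring of cells, seen from cell [a] in direction [b] *)

Section Rings.
Context (m : nat) (a : int) (b : bool).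
Let e : int := dir b.

Definition ring_cell (u : nat) := level_cell m (a + e * u%:Z).
Definition ring_entry (u : nat) := contact e (a + e * u%:Z - e).
Definition ring_rest := chain ring_cell 1 N.-1.

Let e1 : e \in [:: 1; -1] := dirP b.

Lemma ring_entryS (u : nat) : ring_entry u.+1 = contact e (a + e * u%:Z).
Proof. by rewrite /ring_entry intS mulrDr mulr1 addrA addrAC addrK. Qed.

Lemma ring_entryE (u : nat) : ring_entry u = contact (- e) (a + e * u%:Z).
Proof. by rewrite /ring_entry contact_sym // subrK. Qed.

Lemma ring_meet (t u : nat) z : (1 <= t < u)%N -> (u < N)%N ->
  z \in vtx (ring_cell t) -> z \in vtx (ring_cell u) -> u = t.+1 /\ z = ring_entry u.
Proof.
move=> tu uN zt zu.
have E : a + e * u%:Z = a + e * t%:Z + e * (u - t)%N%:Z by lia.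
rewrite /ring_cell E in zu.
have [|[d1 ->]|[d1 _]] := cell_meet_dir e1 _ zt zu; first by lia.
  have -> : u = t.+1 by lia.
  by rewrite ring_entryS.
lia.
Qed.

Lemma ring_cell_edge (t : nat) u v : adj (ring_cell t) u v -> u != v.
Proof. exact: level_cell_edge2. Qed.

Lemma ring_entry_in (t : nat) : ring_entry t \in vtx (ring_cell t).
Proof. by rewrite ring_entryE contact_in. Qed.

Lemma ring_entry_in' (t : nat) : ring_entry t.+1 \in vtx (ring_cell t).
Proof. by rewrite ring_entryS contact_in. Qed.

Lemma ring_entry_neq (t : nat) : ring_entry t != ring_entry t.+1.
Proof. by rewrite ring_entryS ring_entryE eq_sym contact_neq. Qed.

Lemma levelS_ring : level m.+1 = (level_cell m a `|` ring_rest)%fset.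
Proof.
apply/fsetP => g; rewrite inE; apply/in_levelS/orP => [[j gj]|].
  have [n nN jE] := vertex_shift 0 (e * (j - a)).
  have jE' : q j = q (a + e * n%:Z).
    have -> : j = a + flip b (e * (j - a)).
      by rewrite dirE -/e; move: e1; rewrite !inE => /orP [] /eqP ->; lia.
    by rewrite -symmetry_vertex jE symmetry_vertex dirE add0r.
  rewrite (level_cell_periodic _ jE') in gj.
  case: n nN jE jE' gj => [|n] nN jE jE' gj; first by left; rewrite mulr0 addr0 in gj.
  by right; apply/in_chain; exists n.+1 => //; lia.
move=> [ga|/in_chain [u _ gu]]; first by exists a.
by exists (a + e * u%:Z).
Qed.

Lemma corner_ring (r u : nat) : (r < N)%N -> (u < N)%N -> u != r ->
  q (a + e * r%:Z) \notin vtx (ring_cell u).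
Proof.
move=> rN uN ur; apply/negP => /corner_cell E.
wlog ru : r u rN uN ur E / (r < u)%N.
  move=> W; case: (ltnP r u) => ru; first exact: (W r u).
  by apply: (W u r) => //; [rewrite eq_sym | rewrite ltn_neqAle ur].
have /eqP : q (0 + (u - r)%N%:Z) != q 0 by apply: vertex_neq; lia.
rewrite add0r; apply.
have : symmetry (- flip b (a + e * r%:Z)) b (q (a + e * u%:Z)) =
   symmetry (- flip b (a + e * r%:Z)) b (q (a + e * r%:Z)) by rewrite E.
rewrite !symmetry_vertex addNr => <-; congr q.
by rewrite !dirE -/e; move: e1; rewrite !inE => /orP [] /eqP ->; lia.
Qed.

Lemma ring_rest_walk (r : nat) S : (0 < r < N)%N ->
  walk_sum w ring_rest (contact e a) (q (a + e * r%:Z)) S =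
  (\prod_(1 <= u < r) walk_sum w (ring_cell u) (ring_entry u) (ring_entry u.+1) S) *
  walk_sum w (ring_cell r) (ring_entry r) (q (a + e * r%:Z)) S.
Proof.
move=> rN; have <- : ring_entry 1 = contact e a.
  by rewrite ring_entryS mulr0 addr0.
apply: (@walk_sum_chain _ _ w ring_cell ring_entry 1 N) => //.
- exact: ring_meet.
- exact: ring_cell_edge.
- by move=> t _; exact: ring_entry_in.
- by move=> t _ _; exact: ring_entry_in'.
- by move=> t _ _; exact: ring_entry_neq.
- lia.
- lia.
- exact: corner_in_cell.
- by move=> u uN ur; apply: corner_ring => //; lia.
Qed.

Definition middle o (j : int) : R := if avoiding o (q j) then Y1 m else Y m.

Lemma ring_cell_cross (u : nat) o :
  walk_sum w (ring_cell u) (ring_entry u) (ring_entry u.+1) (avoiding o) =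
  middle o (a + e * u%:Z).
Proof.
set t := a + e * u%:Z.
rewrite ring_entryE ring_entryS /ring_cell /contact -/t cell_crossing; last first.
  by rewrite mulNr -(inj_eq (@Psi_inj t)) -mulNr eq_sym; exact: contact_neq.
rewrite mulNr cross_baseE /middle /local_avoid /Y1 /Y.
case: o => [j|] //=; rewrite eq_sym; case: eqP => //= _.
by rewrite subrr mulr0.
Qed.

Lemma ring_last (u : nat) o : ~~ avoiding o (q (a + e * u%:Z)) ->
  walk_sum w (ring_cell u) (ring_entry u) (q (a + e * u%:Z)) (avoiding o) = X m.
Proof.
set t := a + e * u%:Z => ot.
rewrite ring_entryE /ring_cell /contact -/t -{1}(Psi_fix t) cell_crossing; last first.
  by apply: vertex_contact_neq; rewrite /e -dirN dirP.
rewrite mulNr cross_sideE' /local_avoid; case: o ot => [j|] //=.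
by rewrite eq_sym => /negbTE ->.
Qed.

Lemma ring_last_avoid (u : nat) o : ~~ avoiding o (q (a + e * u%:Z)) ->
  walk_sum w (ring_cell u) (ring_entry u) (q (a + e * u%:Z))
    [predU1 (ring_entry u.+1) & avoiding o] = X1 m.
Proof.
set t := a + e * u%:Z => ot.
rewrite ring_entryE ring_entryS /ring_cell /contact -/t -{1}(Psi_fix t).
rewrite cell_crossing_avoid; first last.
- by case: o ot => [j|] //=; rewrite eq_sym => /negbTE ->.
- by apply: vertex_contact_neq; rewrite /e -dirN dirP.
rewrite mulNr cross_sideE' /=; congr (crossing _ _ _ (Some _)).
rewrite -/e addrAC subrr add0r.
by move: e1; rewrite !inE => /orP [] /eqP ->; lia.
Qed.

(** This evaluates one of the two terms of [walk_sum_peel], the way around in direction [e]: a side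
    of the first cell, the bases of the cells in between and a side of the last cell. *)
Lemma ring_half (r : nat) o : (0 < r < N)%N ->
  ~~ avoiding o (q a) -> ~~ avoiding o (q (a + e * r%:Z)) ->
  walk_sum w (level_cell m a) (q a) (contact e a) (avoiding o) *
    walk_sum w ring_rest (contact e a) (q (a + e * r%:Z)) (avoiding o) -
  visit_sum w (level_cell m a) (q a) (contact e a) (avoiding o) (contact (- e) a) *
    visit_sum w ring_rest (contact e a) (q (a + e * r%:Z)) (avoiding o)
      (contact (- e) a) =
  (\prod_(1 <= u < r) middle o (a + e * u%:Z)) *
  (X m ^+ 2 - (if r == N.-1 then (X m - X1 m) ^+ 2 else 0)).
Proof.
move=> rN oa ob; set d := contact (- e) a.
have visitE E x y S : visit_sum w E x y S d =
    walk_sum w E x y S - walk_sum w E x y [predU1 d & S].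
  by rewrite [X in _ = X - _](walk_sumE _ _ _ _ _ d) addrC addKr.
have aE : local_avoid o a = None.
  by case: o oa {ob} => [j|] //=; rewrite eq_sym => /negbTE ->.
have A1 : walk_sum w (level_cell m a) (q a) (contact e a) (avoiding o) = X m.
  rewrite -{1}(Psi_fix a) cell_crossing; last by rewrite eq_sym; exact: vertex_contact_neq.
  by rewrite cross_sideE aE.
have A2 : walk_sum w (level_cell m a) (q a) (contact e a)
    [predU1 d & avoiding o] = X1 m.
  rewrite -{1}(Psi_fix a) cell_crossing_avoid //; last first.
    by rewrite eq_sym; exact: vertex_contact_neq.
  rewrite cross_sideE /=; congr (crossing _ _ _ (Some _)); rewrite -/e.
  by move: e1; rewrite !inE => /orP [] /eqP ->; lia.
have dN u : (0 < u < N.-1)%N -> d \notin vtx (ring_cell u).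
  move=> uN; apply/negP => du.
  have [|[_ dE]|[uE _]] := cell_meet_dir e1 _ (contact_in m (- e) a) du; [lia| |lia].
  by have := contact_neq a e1; rewrite -dE eqxx.
have entry_y u : u == r -> ring_entry u != q (a + e * r%:Z).
  move=> /eqP ->; rewrite ring_entryE.
  set t := a + _; rewrite -{1}(Psi_fix t) (inj_eq (@Psi_inj t)).
  by apply: vertex_contact_neq; rewrite /e -dirN dirP.
have predU E x y : x != y -> d \notin vtx E ->
    walk_sum w E x y [predU1 d & avoiding o] = walk_sum w E x y (avoiding o).
  move=> xy dE; apply: eq_walk_sum => // z zE /=.
  by case: (eqVneq z d) => [zd|//]; rewrite -zd zE in dE.
have P1 : \prod_(1 <= u < r) walk_sum w (ring_cell u) (ring_entry u) (ring_entry u.+1) [predU1 d & avoiding o] =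
    \prod_(1 <= u < r) middle o (a + e * u%:Z).
  apply: eq_big_nat => u ur; rewrite predU ?ring_cell_cross ?ring_entry_neq //.
  by apply: dN; lia.
have P2 : \prod_(1 <= u < r) walk_sum w (ring_cell u) (ring_entry u) (ring_entry u.+1) (avoiding o) =
    \prod_(1 <= u < r) middle o (a + e * u%:Z).
  by apply: eq_big_nat => u ur; rewrite ring_cell_cross.
rewrite !visitE A1 A2 !ring_rest_walk // P1 P2 ring_last //.
(* Only for [r = N.-1] does the target cell touch the first one again, and [d] is then its far
   contact [ring_entry r.+1]; otherwise no cell on the way contains [d] and the correction
   vanishes. *)
case: eqP => [rE|rE].
  have dr : d = ring_entry r.+1.
    have -> : ring_entry r.+1 = contact e (a + - e).
      rewrite ring_entryS; rewrite /contact.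
      have qE : q (a + e * r%:Z) = q (a - e).
        by apply: vertex_eq_mod; exists e; rewrite rE; lia.
      by rewrite (Psi_periodic qE); congr Psi; rewrite vertexD qE -vertexD.
    by rewrite /d (contact_sym a (e := - e)) ?opprK // /e -dirN dirP.
  have -> : walk_sum w (ring_cell r) (ring_entry r) (q (a + e * r%:Z))
      [predU1 d & avoiding o] = X1 m by rewrite dr ring_last_avoid.
  by ring.
rewrite predU ?ring_last //; first by ring.
  exact: entry_y.
by apply: dN; lia.
Qed.

End Rings.

Lemma ring_restN m a b : ring_rest m a (~~ b) = ring_rest m a b.
Proof.
have sub c : (ring_rest m a (~~ c) `<=` ring_rest m a c)%fset.
  apply/fsubsetP => g /in_chain [u uN gu]; apply/in_chain.
  exists (N - u)%N; first by lia.
  have E : q (a + dir (~~ c) * u%:Z) = q (a + dir c * (N - u)%N%:Z).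
    by apply: vertex_eq_mod; exists (- dir c); rewrite dirN; lia.
  by move: gu; rewrite /ring_cell (level_cell_periodic _ E).
by apply/eqP; rewrite eqEfsubset sub /= -{1}[b]negbK sub.
Qed.

(** [walk_sum_peel] for cell [a] against the rest of the ring. Its two terms are [ring_half] in the
    two directions, with [r] and [N - r] steps, and the rest of the ring is the same graph for
    both. *)
Lemma crossing_recursion m a b (r : nat) o : (0 < r < N)%N ->
  ~~ avoiding o (q a) -> ~~ avoiding o (q (a + dir b * r%:Z)) ->
  crossing m.+1 a (a + dir b * r%:Z) o =
  (\prod_(1 <= u < r) middle m o (a + dir b * u%:Z)) *
    (X m ^+ 2 - (if r == N.-1 then (X m - X1 m) ^+ 2 else 0)) +
  (\prod_(1 <= u < N - r) middle m o (a - dir b * u%:Z)) *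
    (X m ^+ 2 - (if r == 1%N then (X m - X1 m) ^+ 2 else 0)).
Proof.
move=> rN oa ob.
have Nr : (0 < N - r < N)%N by lia.
have qE : q (a + dir (~~ b) * (N - r)%N%:Z) = q (a + dir b * r%:Z).
  by apply: vertex_eq_mod; exists (- dir b); rewrite dirN; lia.
rewrite -(ring_half m rN oa ob).
have := ring_half m (r := N - r) (b := ~~ b) (a := a) (o := o) Nr oa.
rewrite qE ring_restN => /(_ ob); rewrite dirN opprK.
have -> : (if (N - r == N.-1)%N then (X m - X1 m) ^+ 2 else 0) =
   (if r == 1%N then (X m - X1 m) ^+ 2 else 0).
  by congr (if _ then _ else _); lia.
have -> : \prod_(1 <= u < N - r) middle m o (a + - dir b * u%:Z) =
   \prod_(1 <= u < N - r) middle m o (a - dir b * u%:Z).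
  by apply: eq_bigr => u _; rewrite mulNr.
move=> <-; rewrite /crossing (levelS_ring m a b).
have cr := dirP b.
have meet u z : (0 < u < N)%N -> z \in vtx (level_cell m a) ->
    z \in vtx (ring_cell m a b u) ->
    (u = 1%N /\ z = contact (dir b) a) \/ (u = N.-1 /\ z = contact (- dir b) a).
  by move=> uN za zu; exact: (cell_meet_dir cr _ za zu).
have cell0 : ring_cell m a b 0 = level_cell m a.
  by rewrite /ring_cell mulr0 addr0.
have yA : q (a + dir b * r%:Z) \notin vtx (level_cell m a).
  by rewrite -cell0; apply: corner_ring; lia.
apply: walk_sum_peel.
- move=> z za /vtx_chain [u uN zu]; rewrite !inE.
  have uN' : (0 < u < N)%N by clear -uN N_ge3; lia.
  by have [[_ ->]|[_ ->]] := meet u z uN' za zu; rewrite eqxx ?orbT.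
- move=> u v auv; apply/negP => /in_chain [n nN]; apply/negP.
  by apply: (cell_edge_disj cr _ auv); clear -nN N_ge3; lia.
- exact: contact_neq.
- apply/negP => /vtx_chain [u uN qu].
  have [N0 u1 u2] : [/\ (0 < N)%N, (u < N)%N & u != 0%N] by clear -uN N_ge3; split; lia.
  by have := @corner_ring m a b 0 u N0 u1 u2; rewrite mulr0 addr0 qu.
- by [].
- by apply: contraNneq yA => <-; exact: corner_in_cell.
- apply/vtx_chain; exists 1%N; first by lia.
  by rewrite /ring_cell mulr1; exact: contact_in_next.
- apply/vtx_chain; exists N.-1; first by lia.
  have E : q (a + dir b * N.-1%:Z) = q (a - dir b).
    by apply: vertex_eq_mod; exists (dir b); lia.
  rewrite /ring_cell (level_cell_periodic _ E); apply: contact_in_next.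
  by rewrite -dirN dirP.
Qed.

Lemma prod_middle_none m (f : nat -> int) (r : nat) :
  \prod_(1 <= u < r) middle m None (f u) = Y m ^+ r.-1.
Proof. by rewrite prodr_const_nat subn1. Qed.

Lemma prod_middle_miss m (f : nat -> int) (r : nat) j :
  (forall u, (1 <= u < r)%N -> q (f u) != q j) ->
  \prod_(1 <= u < r) middle m (Some j) (f u) = Y m ^+ r.-1.
Proof.
move=> fj; rewrite -subn1 -prodr_const_nat; apply: eq_big_nat => u ur.
by rewrite /middle /= (negbTE (fj u ur)).
Qed.

Lemma prod_middle_hit m (f : nat -> int) (r u0 : nat) j : (1 <= u0 < r)%N ->
  (forall u, (1 <= u < r)%N -> (q (f u) == q j) = (u == u0)) ->
  \prod_(1 <= u < r) middle m (Some j) (f u) = Y1 m * Y m ^+ r.-2.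
Proof.
move=> ur fj; rewrite (@big_cat_nat _ _ _ u0) /=; [|lia..].
rewrite (@big_ltn _ _ _ u0 r); last by lia.
rewrite {2}/middle /= fj // eqxx mulrCA; congr (_ * _).
have E u v : (1 <= u)%N -> (v <= r)%N -> ((v <= u0) || (u0 < u))%N ->
    \prod_(u <= i < v) middle m (Some j) (f i) = Y m ^+ (v - u)%N.
  move=> u1 vr uv; rewrite -prodr_const_nat; apply: eq_big_nat => i iuv.
  rewrite /middle /= fj; last by lia.
  by case: eqP => // iu; lia.
rewrite !E; [|lia..].
by rewrite -exprD; congr (_ ^+ _); lia.
Qed.

Lemma vertex_eqP (i j : int) : (-(N%:Z) < i - j < N%:Z)%R -> (q i == q j) = (i == j).
Proof.
move=> ij; apply/eqP/eqP => [e|-> //].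
case: (ltrP i j) => lij.
- have := @vertex_neq i `|j - i|%N; have -> : i + `|j - i|%N%:Z = j by lia.
  rewrite e eqxx => h1; have : (0 < `|j - i| < N)%N by lia.
  by move=> /h1.
- have [//|ne] := eqVneq i j.
  have := @vertex_neq j `|i - j|%N; have -> : j + `|i - j|%N%:Z = i by lia.
  rewrite e eqxx => h1; have : (0 < `|i - j| < N)%N by lia.
  by move=> /h1.
Qed.

Let dir0 : dir false = 1. Proof. by []. Qed.

(* When the last cell on one way around touches the first one again, a walk may
   not use the common vertex twice; this excludes the pairs of crossings of the
   first and of the last cell that both visit it. *)
Definition clash m : R := (X m - X1 m) ^+ 2.

Lemma cross_side_rec m :
  X m.+1 = Y m ^+ (sN N).-1 * X m ^+ 2 +
    Y m ^+ (N - sN N).-1 * (X m ^+ 2 - (if sN N == 1%N then clash m else 0)).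
Proof.
have [s0 sN2] := sN_bounds.
have := @crossing_recursion m 0 false (sN N) None _ isT isT.
rewrite dir0 mul1r add0r -[X m.+1]/(crossing m.+1 0 s None) => ->; last by lia.
rewrite !prod_middle_none; case: eqP => [e|_]; first by lia.
by rewrite subr0.
Qed.

Lemma cross_side_avoid_rec m :
  X1 m.+1 = Y m ^+ (sN N).-1 * X m ^+ 2 +
    Y1 m * Y m ^+ (N - sN N).-2 *
      (X m ^+ 2 - (if sN N == 1%N then clash m else 0)).
Proof.
have [s0 sN2] := sN_bounds.
have := @crossing_recursion m 0 false (sN N) (Some (- s)).
rewrite dir0 mul1r add0r -[X1 m.+1]/(crossing m.+1 0 s (Some (- s))) /= => ->; first last.
- by rewrite vertex_eqP; lia.
- by rewrite vertex_eqP; lia.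
- by lia.
rewrite prod_middle_miss; last by move=> u ur; rewrite vertex_eqP; lia.
rewrite (@prod_middle_hit _ _ _ (sN N)); first last.
- by move=> u ur; rewrite vertex_eqP; [apply/eqP/eqP; lia | lia].
- by lia.
by case: eqP => [e|_]; [lia | rewrite subr0].
Qed.

(** With [N = 4 k + l] and [s = k + 1], the condition [2 s = N - 1] reads [2 k + l = 3]: it holds
    for [N = 3] and [N = 5] only. In [cross_side_rec], [s = 1] holds for [N = 3] only. *)
Lemma cross_base_rec m :
  Y m.+1 = Y m ^+ (2 * sN N).-1 *
      (X m ^+ 2 - (if (2 * sN N == N.-1)%N then clash m else 0)) +
    Y m ^+ (N - 2 * sN N).-1 * X m ^+ 2.
Proof.
have [s0 sN2] := sN_bounds.
have := @crossing_recursion m (- s) false (2 * sN N) None _ isT isT.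
rewrite dir0 mul1r (_ : - s + (2 * sN N)%N%:Z = s); last by lia.
rewrite -[Y m.+1]/(crossing m.+1 (- s) s None) => ->; last by lia.
rewrite !prod_middle_none; case: (2 * sN N =P 1)%N => [e|_]; first by lia.
by rewrite subr0.
Qed.

Lemma cross_base_avoid_rec m :
  Y1 m.+1 = Y1 m * Y m ^+ (2 * sN N).-2 *
      (X m ^+ 2 - (if (2 * sN N == N.-1)%N then clash m else 0)) +
    Y m ^+ (N - 2 * sN N).-1 * X m ^+ 2.
Proof.
have [s0 sN2] := sN_bounds.
have := @crossing_recursion m (- s) false (2 * sN N) (Some 0).
rewrite dir0 mul1r (_ : - s + (2 * sN N)%N%:Z = s); last by lia.
rewrite -[Y1 m.+1]/(crossing m.+1 (- s) s (Some 0)) /= => ->; first last.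
- by rewrite vertex_eqP; lia.
- by rewrite vertex_eqP; lia.
- by lia.
rewrite (@prod_middle_hit _ _ _ (sN N)); first last.
- by move=> u ur; rewrite vertex_eqP; [apply/eqP/eqP; lia | lia].
- by lia.
rewrite prod_middle_miss; last by move=> u ur; rewrite vertex_eqP; lia.
by case: (2 * sN N =P 1)%N => [e|_]; [lia | rewrite subr0].
Qed.

End Crossings.

(** * Boundary forests *)

Lemma finite_subgraphs (T : choiceType) (E : {fset {fset T}}) :
  finite_set [set G : {fset {fset T}} | (G `<=` E)%fset].
Proof.
apply: (sub_finite_set _ (finite_fset (fpowerset E))) => G /= GE.
by rewrite fpowersetE.
Qed.

Definition level_forest m (G : {fset {fset R[i]}}) : Prop :=
  [/\ (G `<=` level m)%fset, linear_forest G
    & forall x, degree G x = 1%N -> exists j, x = q j].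

Definition cell_paths m j : set {fset {fset R[i]}} :=
  [set G | (G `<=` level_cell m j)%fset /\ (G = fset0 \/
    exists x p, [/\ p != [::], uniq (x :: p), path_edges (x :: p) = G,
      x \in [:: q j; contact 1 j; contact (-1) j] &
      last x p \in [:: q j; contact 1 j; contact (-1) j]])].

Lemma level_cell_own m j x e : x \in vtx (level_cell m j) ->
  x != contact 1 j -> x != contact (-1) j ->
  e \in level m.+1 -> x \in e -> e \in level_cell m j.
Proof.
move=> xj x1 x2 /in_levelS [t et] xe.
have [n nN tE] := vertex_shift j t; rewrite (level_cell_periodic m tE) in et.
case: n nN tE et => [|n] nN tE et; first by rewrite addr0 in et.
have xt : x \in vtx (level_cell m (j + n.+1%:Z)) by apply/vtxP; exists e.
by have [[_ xE]|[_ xE]] := @cell_meet m j n.+1 x nN xj xt; rewrite xE eqxx in x1 x2.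
Qed.

(** At a vertex of cell [j] that is not a contact all edges of [G] stay in the cell. A leaf of the
    restriction there is thus a leaf of [G], hence a corner, hence [q j]. Only three leaves are
    possible. *)
Lemma level_forest_cell m G j : level_forest m.+1 G ->
  cell_paths m j (G `&` level_cell m j)%fset.
Proof.
move=> [GE lG leaf]; split; first exact: fsubsetIr.
have [->|ne] := eqVneq (G `&` level_cell m j)%fset fset0; first by left.
right; apply: (linear_forest_three_leaves _ ne).
  by apply: linear_forest_sub lG; exact: fsubsetIl.
move=> x dx; rewrite !inE.
have [|x1] := eqVneq x (contact 1 j); first by rewrite orbT.
have [|x2] := eqVneq x (contact (-1) j); first by rewrite !orbT.
rewrite !orbF.
have : [fset e in (G `&` level_cell m j)%fset | x \in e]%fset != fset0.
  by rewrite -cardfs_gt0 -degree_set dx.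
move=> /fset0Pn [e]; rewrite !inE /= => /andP [/andP [eG ej] xe].
have xj : x \in vtx (level_cell m j) by apply/vtxP; exists e.
have dG : degree G x = 1%N.
  rewrite -dx /degree; congr #|` _|; apply/fsetP => g; rewrite !inE /=.
  case: (boolP (g \in G)) => //= gG; case: (boolP (x \in g)) => //= xg;
    rewrite ?andbF ?andbT //.
  by rewrite (level_cell_own xj x1 x2 (fsubsetP GE _ gG) xg).
have [t xt] := leaf x dG; rewrite xt; apply/eqP.
by rewrite xt in xj; rewrite (corner_cell xj).
Qed.

Section ForestSums.
Context (w : R).
Hypothesis w_ge0 : 0 <= w.

(** The summand 1 is the empty restriction. A path is counted once for each orientation: two sides
    and one base, each twice, which is harmless in an upper bound. *)
Definition cell_weight m : R := 1 + 4 * cross_side w m + 2 * cross_base w m.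

Lemma cell_side m j b :
  walk_sum w (level_cell m j) (q j) (contact (dir b) j) pred0 = cross_side w m.
Proof.
have -> : pred0 = avoiding None :> pred R[i] by [].
rewrite -{1}(Psi_fix j) /contact cell_crossing.
  by rewrite cross_sideE.
by rewrite eq_sym; apply: vertex_contact_neq; exact: dirP.
Qed.

Lemma cell_base m j b :
  walk_sum w (level_cell m j) (contact (- dir b) j) (contact (dir b) j) pred0 =
  cross_base w m.
Proof.
have -> : pred0 = avoiding None :> pred R[i] by [].
rewrite /contact cell_crossing; first by rewrite mulNr cross_baseE.
rewrite -(inj_eq (@Psi_inj j)) eq_sym; apply: contact_neq; exact: dirP.
Qed.

Lemma cell_paths_sum m j :
  \sum_(G \in cell_paths m j) w ^+ #|` G| <= cell_weight m.
Proof.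
have fA : finite_set (cell_paths m j).
  by apply: sub_finite_set (finite_subgraphs (level_cell m j)) => G [].
rewrite (fsbigID [set fset0]) //= /cell_weight -addrA; apply: lerD.
  apply: (@le_trans _ _ (\sum_(G \in [set (fset0 : {fset {fset R[i]}})]) w ^+ #|` G|)).
    apply: ler_fsum_sub; [exact: finite_set1|by move=> G []|].
    by move=> G _; rewrite exprn_ge0.
  by rewrite fsbig_set1 cardfs0 expr0.
set a := q j; set b := contact 1 j; set c := contact (-1) j.
pose L := [:: (a, b); (a, c); (b, a); (c, a); (b, c); (c, b)].
have -> : 4 * cross_side w m + 2 * cross_base w m =
    \sum_(k <- L) \sum_(p \in saws (level_cell m j) k.1 k.2 pred0) w ^+ size p.
  have ab : walk_sum w (level_cell m j) a b pred0 = cross_side w m := cell_side m j false.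
  have ac : walk_sum w (level_cell m j) a c pred0 = cross_side w m := cell_side m j true.
  have cb : walk_sum w (level_cell m j) c b pred0 = cross_base w m := cell_base m j false.
  rewrite !big_cons big_nil /= -/(walk_sum _ _ a b _) -/(walk_sum _ _ a c _)
    -/(walk_sum _ _ b a _) -/(walk_sum _ _ c a _) -/(walk_sum _ _ b c _)
    -/(walk_sum _ _ c b _).
  rewrite (walk_sum_rev _ _ b a) (walk_sum_rev _ _ c a) (walk_sum_rev _ _ b c).
  by rewrite ab ac cb; ring.
apply: (@ler_fsum_cover _ _ _ _ _ L (fun k => saws (level_cell m j) k.1 k.2 pred0)
  (fun k p => path_edges (k.1 :: p)) _ _ [::]).
- exact: finite_setIl.
- by move=> k; exact: finite_saws.
- by move=> p; rewrite exprn_ge0.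
move=> G [[GE [G0|[x [p [p0 u pE xL yL]]]]] Gne]; first by case: Gne.
exists (x, last x p).
  have xy := uniq_last_neq p0 u; move: xL yL xy; rewrite -/a -/b -/c /L !inE.
  by move=> /or3P [] /eqP -> /or3P [] /eqP ->; rewrite ?eqxx // !xpair_eqE !eqxx ?orbT.
exists p => /=.
  apply/andP; split; last by rewrite all_predC has_pred0.
  by apply/and3P; split => //; rewrite path_path_edges pE.
by split => //; rewrite -pE card_path_edges.
Qed.

Definition forests_below m n : set {fset {fset R[i]}} :=
  [set G | (G `<=` chain (fun i : nat => level_cell m i%:Z) 0 n)%fset /\
    forall i : nat, (i < n)%N -> cell_paths m i%:Z (G `&` level_cell m i%:Z)%fset].

Lemma cell_disj m (i i' : nat) e : (i < i' < N)%N ->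
  e \in level_cell m i%:Z -> e \notin level_cell m i'%:Z.
Proof.
move=> ii ei; rewrite (_ : i'%:Z = i%:Z + 1 * (i' - i)%N%:Z); last by clear -ii; lia.
by apply: (cell_edge_disj _ _ ei) => //; clear -ii; lia.
Qed.

Lemma chain_S0 (T : choiceType) (f : nat -> {fset {fset T}}) n :
  chain f 0 n.+1 = (chain f 0 n `|` f n)%fset.
Proof.
apply/fsetP => e; rewrite inE; apply/in_chain/orP.
  move=> [u un eu]; have [<-|un'] := eqVneq u n; first by right.
  by left; apply/in_chain; exists u => //; lia.
by move=> [/in_chain [u un eu]|en]; [exists u|exists n] => //; lia.
Qed.

(** A graph is determined by its restrictions to the first [n] cells and to the next one, and its
    weight is the product of theirs since the cells share no edges. *)
Lemma forests_below_sum m n : (n <= N)%N ->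
  \sum_(G \in forests_below m n) w ^+ #|` G| <= cell_weight m ^+ n.
Proof.
have fF k : finite_set (forests_below m k).
  by apply: sub_finite_set (finite_subgraphs _) => G [GE _]; exact: GE.
have W0 : 0 <= cell_weight m.
  apply: le_trans (cell_paths_sum m 0); apply: fsumr_ge0 => G _; exact: exprn_ge0.
elim: n => [|n IH] nN.
  rewrite expr0.
  apply: (@le_trans _ _ (\sum_(G \in [set (fset0 : {fset {fset R[i]}})]) w ^+ #|` G|)).
    apply: ler_fsum_sub; [exact: finite_set1| |].
      by move=> G [+ _]; rewrite fsubset0 => /eqP.
    by move=> G _; rewrite exprn_ge0.
  by rewrite fsbig_set1 cardfs0 expr0.
have fC : finite_set (cell_paths m n%:Z).
  by apply: sub_finite_set (finite_subgraphs (level_cell m n%:Z)) => G [].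
rewrite exprSr.
apply: (@le_trans _ _ ((\sum_(G \in forests_below m n) w ^+ #|` G|) *
    (\sum_(G \in cell_paths m n%:Z) w ^+ #|` G|))); last first.
  apply: ler_pM => //; first by apply: fsumr_ge0 => G _; rewrite exprn_ge0.
  - by apply: fsumr_ge0 => G _; rewrite exprn_ge0.
  - by apply: IH; lia.
  - exact: cell_paths_sum.
rewrite fsum_mul //.
pose U := chain (fun i : nat => level_cell m i%:Z) 0 n.
have dU e : e \in U -> e \notin level_cell m n%:Z.
  by move=> /in_chain [u un]; apply: cell_disj; lia.
apply: (@ler_fsum_inj _ _ _ _ _
  (fun G => ((G `&` U)%fset, (G `&` level_cell m n%:Z)%fset))) => //.
- exact: finite_setX.
- move=> G G' /set_mem [GU _] /set_mem [GU' _] [e1 e2].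
  rewrite chain_S0 -/U in GU GU'.
  by rewrite -(fsetIidPl GU) -(fsetIidPl GU') !fsetIUr e1 e2.
- move=> G [GU Gp]; rewrite chain_S0 -/U in GU; split.
    split; last by apply: Gp.
    split; first exact: fsubsetIr.
    move=> i ni; rewrite -fsetIA (_ : U `&` _ = level_cell m i%:Z)%fset.
      by apply: Gp; lia.
    apply/fsetIidPr/fsubsetP => e ei; apply/in_chain; exists i => //; lia.
  rewrite /= -exprD -cardfsUI.
  have -> : ((G `&` U) `&` (G `&` level_cell m n%:Z))%fset = fset0.
    apply/fsetP => e; rewrite !inE; apply/negP => /andP [/andP [_ /dU /negP eU] /andP [_ eL]]; exact: eU eL.
  by rewrite cardfs0 addn0 -fsetIUr (fsetIidPl GU).
- by move=> G _; rewrite mulr_ge0 // exprn_ge0.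
Qed.

Lemma level_forest_sum m :
  \sum_(G \in level_forest m.+1) w ^+ #|` G| <= cell_weight m ^+ N.
Proof.
apply: le_trans (forests_below_sum m (leqnn N)); apply: ler_fsum_sub.
- by apply: sub_finite_set (finite_subgraphs _) => G [GE _]; exact: GE.
- move=> G lG; split; last by move=> i _; exact: level_forest_cell.
  have [GE _ _] := lG; apply: (fsubset_trans GE); apply/fsubsetP => e /in_levelS [j ej].
  have [n nN jE] := vertex_shift 0 j; rewrite add0r in jE.
  by apply/in_chain; exists n => //; rewrite -(level_cell_periodic m jE).
- by move=> G _; rewrite exprn_ge0.
Qed.

End ForestSums.

(** * Back to the rescaled gasket *)

Lemma PsiVK j : cancel (Psi N j : R[i] -> R[i]) (PsiV N j).
Proof.
have /andP [r0 _] := rho_bounds => x; rewrite /PsiV /Psi /homothety.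
rewrite [X in _ + _ * X]addrAC subrr add0r mulrA -rmorphM /= mulVf ?gt_eqF //.
by rewrite mul1r subrKC.
Qed.

Lemma PsiKV j : cancel (PsiV N j : R[i] -> R[i]) (Psi N j).
Proof.
have /andP [r0 _] := rho_bounds => x; rewrite /PsiV /Psi /homothety.
rewrite [X in _ + _ * X]addrAC subrr add0r mulrA -rmorphM /= mulfV ?gt_eqF //.
by rewrite mul1r subrKC.
Qed.

Definition zoom m : R[i] -> R[i] := iter m (PsiV N 0).
Definition unzoom m : R[i] -> R[i] := iter m (Psi N 0).

Lemma zoomK m : cancel (zoom m) (unzoom m).
Proof.
by elim: m => [|m IH] x //; rewrite /unzoom iterSr /zoom /= PsiKV; exact: IH.
Qed.

Lemma unzoomK m : cancel (unzoom m) (zoom m).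
Proof.
by elim: m => [|m IH] x //; rewrite /zoom iterSr /unzoom /= PsiVK; exact: IH.
Qed.

Lemma zoom_inj m : injective (zoom m).
Proof. exact: can_inj (zoomK m). Qed.

Lemma in_level_words m e : reflect
  (exists w : m.-tuple 'I_N, e \in image_graph
     (fun x => foldr (fun i : 'I_N => Psi N (i : nat)%:Z) x w) (base_cycle R N))
  (e \in level m).
Proof.
elim: m e => [|m IH] e.
  have id0 : image_graph (fun x : R[i] => x) (base_cycle R N) = base_cycle R N.
    apply/fsetP => g; apply/image_graphP/idP => [[g' gb ->]|gb].
      by rewrite imfset_id.
    by exists g; rewrite ?imfset_id.
  apply: (iffP idP) => [e0|[w]]; last by rewrite tuple0 /= id0.
  by exists [tuple]; rewrite /= id0.
apply: (iffP (bigfcupP _ _ _ _)) => [[i _ /image_graphP [e' /IH [w wE] ->]]|[w]].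
  exists [tuple of i :: w]; case/image_graphP: wE => e0 e0b ->.
  by apply/image_graphP; exists e0; rewrite // -imfset_comp.
case/tupleP: w => i w /image_graphP [e0 e0b ->]; exists i.
  by rewrite mem_index_enum.
pose F x := foldr (fun i : 'I_N => Psi N (i : nat)%:Z) x w.
apply/image_graphP; exists (F @` (e0 : {fset R[i]}))%fset; last by rewrite -imfset_comp.
by apply/IH; exists w; apply/image_graphP; exists e0.
Qed.

Lemma gasket_level m : gasket R N m = image_graph (zoom m) (level m).
Proof.
apply/fsetP => e; apply/bigfcupP/image_graphP => [[w _ /image_graphP [e0 e0b ->]]|].
  pose F x := foldr (fun i : 'I_N => Psi N (i : nat)%:Z) x w.
  exists (F @` (e0 : {fset R[i]}))%fset; last by rewrite -imfset_comp.
  by apply/in_level_words; exists w; apply/image_graphP; exists e0.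
move=> [e' /in_level_words [w /image_graphP [e0 e0b ->]] ->]; exists w.
  by rewrite mem_index_enum.
by apply/image_graphP; exists e0; rewrite // -imfset_comp.
Qed.

Lemma corner_zoom m j : corner R N m j = zoom m (q j).
Proof. by []. Qed.

Lemma corner_inj m i j : (corner R N m i == corner R N m j) = (q i == q j).
Proof. by rewrite !corner_zoom (inj_eq (@zoom_inj m)). Qed.

Definition away m (o : option int) : pred R[i] :=
  if o is Some t then pred1 (corner R N m t) else pred0.

Lemma weight_expn (beta : R) (n : nat) : expR (- beta * n%:R) = expR (- beta) ^+ n.
Proof. by rewrite -expRM_natl mulrC. Qed.

Lemma crossing_gasket (w : R) m i j o : crossing w m i j o =
  \sum_(p \in saws (gasket R N m) (corner R N m i) (corner R N m j) (away m o)) w ^+ size p.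
Proof.
rewrite gasket_level !corner_zoom -walk_sum_image; last exact: zoom_inj.
apply: eq_fsbigl; apply/funext => p; rewrite /saws.
congr (is_true (_ && all _ _)); apply/funext => x; case: o => //= t.
by rewrite corner_zoom (inj_eq (@zoom_inj m)).
Qed.

Lemma crossing_sum_any m (beta : R) i j :
  crossing_sum N m beta (corner R N m i) (corner R N m j) predT =
  crossing (expR (- beta)) m i j None.
Proof.
rewrite crossing_gasket /crossing_sum.
under eq_fsbigr do rewrite weight_expn; apply: eq_fsbigl.
apply/funext => p; rewrite /saws; congr (is_true (_ && _)).
by rewrite all_predC has_pred0.
Qed.

Lemma crossing_sum_avoids m (beta : R) i j k :
  crossing_sum N m beta (corner R N m i) (corner R N m j)
    [pred p | corner R N m k \notin p] =
  crossing (expR (- beta)) m i j (Some k).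
Proof.
rewrite crossing_gasket /crossing_sum.
under eq_fsbigr do rewrite weight_expn; apply: eq_fsbigl.
apply/funext => p; rewrite /saws; congr (is_true (_ && _)).
by rewrite all_predC has_pred1.
Qed.

Lemma crossing_sum_visits m (beta : R) i j k :
  crossing_sum N m beta (corner R N m i) (corner R N m j)
    [pred p | corner R N m k \in p] =
  crossing (expR (- beta)) m i j None - crossing (expR (- beta)) m i j (Some k).
Proof.
rewrite -crossing_sum_avoids -crossing_sum_any /crossing_sum.
apply/esym/eqP; rewrite subr_eq; apply/eqP; set x := corner R N m i.
rewrite (fsbigID [set p | corner R N m k \in x :: p]) /=; last first.
  apply: sub_finite_set (finite_saws (gasket R N m) x (corner R N m j) pred0) => p /=.
  by move=> /andP [sp _]; rewrite /saws /= sp /= all_predC has_pred0.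
congr (_ + _); apply: eq_fsbigl; apply/seteqP; split=> p /=.
- by move=> [/andP [-> _] ->].
- by move=> /andP [-> ->].
- by move=> [/andP [-> _] /negP ->].
- by move=> /andP [-> /negP].
Qed.

(** * Comparison of crossings with boundary forests *)

Section CrossingsFromForests.
Context (beta : R).
Let w := expR (- beta).

Let w_ge0 : 0 <= w.
Proof. exact: expR_ge0. Qed.

Lemma finite_boundary_forests m : finite_set [set G | boundary_forest (R := R) N m G].
Proof. by apply: sub_finite_set (finite_subgraphs (gasket R N m)) => G []. Qed.

Lemma boundary_forest_level m G : boundary_forest N m G ->
  level_forest m (image_graph (unzoom m) G).
Proof.
move=> [GE _ lG leaf]; split.
- apply/fsubsetP => _ /image_graphP [e /(fsubsetP GE) + ->].
  rewrite gasket_level => /image_graphP [e' e'm ->].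
  by rewrite -imfset_comp (eq_imfset (q := mem e') _ (zoomK m)) //= imfset_id.
- exact: (linear_forest_image (unzoomK m) (zoomK m)).
move=> x; rewrite (degree_image (unzoomK m) (zoomK m)) => /leaf /imfsetP [i _ xE].
by exists (i : nat)%:Z; rewrite -(zoomK m x) xE corner_zoom zoomK.
Qed.

Lemma forest_sum_le m sigma :
  forest_sum N m.+1 beta sigma <= cell_weight w m ^+ N.
Proof.
apply: le_trans (level_forest_sum w_ge0 m); rewrite /forest_sum.
under eq_fsbigr do rewrite weight_expn.
apply: (@ler_fsum_inj _ _ _ _ _ (image_graph (unzoom m.+1))).
- by apply: sub_finite_set (finite_boundary_forests m.+1) => G [].
- by apply: sub_finite_set (finite_subgraphs (level m.+1)) => G [].
- move=> G G' _ _; exact: (can_inj (image_graphK (unzoomK m.+1))).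
- move=> G [bG _]; split; first exact: boundary_forest_level.
  by rewrite (card_image_graph (unzoomK m.+1)).
- by move=> G _; exact: exprn_ge0.
Qed.

Lemma corner_bdry m j : corner R N m j \in bdry R N m.
Proof.
have [n nN jE] := vertex_shift 0 j; rewrite add0r in jE.
by apply/imfsetP; exists (Ordinal nN); rewrite //= !corner_zoom jE.
Qed.

Lemma unzoom_bdry m x : x \in bdry R N m -> unzoom m x \in base_vertices R N.
Proof.
move=> /imfsetP [i _ ->]; rewrite corner_zoom zoomK.
by apply/imfsetP; exists i.
Qed.

(** The leaves of a path are its two ends, here corners. The path and its reverse are the only
    listings of its component and give the same trace, the path through the boundary vertices met;
    it has an edge because both ends are kept. *)
Lemma crossing_forest m i j x p : x = corner R N m i -> p != [::] ->
  saw (gasket R N m) x (corner R N m j) p ->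
  boundary_forest N m (path_edges (x :: p)) /\
  trace N m (path_edges (x :: p)) \in skeletons R N.
Proof.
move=> xE p0 /and3P [pp up /eqP lp].
pose l := [seq unzoom m z | z <- x :: p & z \in bdry R N m].
have ul : uniq l by rewrite map_inj_uniq ?filter_uniq //; exact: can_inj (unzoomK m).
have lb z : z \in l -> z \in base_vertices R N.
  by move=> /mapP [y]; rewrite mem_filter => /andP [yb _] ->; exact: unzoom_bdry.
have tE : trace N m (path_edges (x :: p)) = path_edges l.
  apply/fsetP => e; rewrite !inE /=; apply/andP/idP => [[_ /asboolP [c]]|el].
    by move=> /(component_path_own p0 up) [] ->; rewrite // filter_rev map_rev path_edges_rev.
  split.
    by rewrite fpowersetE; apply/fsubsetP => z /(path_edges_mem el); exact: lb.
  apply/asboolP; exists (x :: p) => //; split=> //.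
  by case: (p) p0.
have lE : exists y l', l = unzoom m x :: y :: l'.
  have : unzoom m (corner R N m j) \in [seq unzoom m z | z <- p & z \in bdry R N m].
    apply: map_f; rewrite mem_filter corner_bdry -lp.
    by case: (p) p0 => //= y r _; exact: mem_last.
  rewrite /l /= xE corner_bdry /=.
  by case: [seq _ | _ <- _ & _] => // y r _; exists y, r.
split; last first.
  rewrite !inE /= tE; apply/andP; split.
    rewrite fpowersetE; apply/fsubsetP => e el; rewrite fpowersetE.
    by apply/fsubsetP => z /(path_edges_mem el); exact: lb.
  apply/asboolP; split; last exact: path_linear_forest.
  have [y [l' ->]] := lE; apply/fset0Pn; exists [fset unzoom m x; y]%fset.
  by rewrite path_edges_cons !inE eqxx.
split.
- by rewrite -path_path_edges.
- case: (p) p0 => // y r _; apply/fset0Pn; exists [fset x; y]%fset.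
  by rewrite path_edges_cons !inE eqxx.
- exact: path_linear_forest.
move=> z; have [zp|zp] := boolP (z \in x :: p); last by rewrite path_degree_out.
rewrite path_degree // lp xE.
have [-> _|_] := eqVneq z (corner R N m i); first exact: corner_bdry.
by have [-> _|_] := eqVneq z (corner R N m j); first exact: corner_bdry.
Qed.

Lemma forest_sum_ge0 m sigma : 0 <= forest_sum N m beta sigma.
Proof. by apply: fsumr_ge0 => G _; exact: expR_ge0. Qed.

Lemma forest_sum_Znorm m sigma : sigma \in skeletons R N ->
  forest_sum N m beta sigma <= Znorm N m beta.
Proof.
move=> sS; apply: le_trans (ler_norm _) _.
rewrite /Znorm; have : sigma \in enum_fset (skeletons R N) := sS.
elim: (enum_fset _) => // t r IH; rewrite inE big_cons le_max.
by move=> /orP [/eqP <-|/IH ->]; rewrite ?lexx ?orbT.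
Qed.

(** A walk with a given start is recovered from its edge set, so crossings inject into boundary
    forests; these are then sorted by their trace, which takes finitely many values. *)
Lemma crossing_le_Znorm m i j : q i != q j ->
  crossing w m i j None <= #|` skeletons R N|%:R * Znorm N m beta.
Proof.
move=> ij; rewrite crossing_gasket.
set x := corner R N m i; set y := corner R N m j.
pose B := [set G | boundary_forest N m G /\ trace N m G \in skeletons R N].
have fB : finite_set B.
  by apply: sub_finite_set (finite_boundary_forests m) => G [].
have nn p : saw (gasket R N m) x y p -> p != [::].
  case: p => // /and3P [_ _ /=]; rewrite corner_inj => /eqP e.
  by rewrite e eqxx in ij.
apply: (@le_trans _ _ (\sum_(G \in B) w ^+ #|` G|)).
  apply: (@ler_fsum_inj _ _ _ _ _ (fun p => path_edges (x :: p))) => //.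
  - exact: finite_saws.
  - move=> p p' /set_mem /andP [/and3P [_ up _] _] /set_mem /andP [/and3P [_ up' _] _].
    exact: path_edges_inj.
  - move=> p /andP [sp _]; have [bf tr] := crossing_forest (erefl x) (nn p sp) sp.
    by split => //; case/and3P: sp => _ up _; rewrite card_path_edges.
  - by move=> G _; exact: exprn_ge0.
apply: (@le_trans _ _ (\sum_(sigma <- skeletons R N) forest_sum N m beta sigma)).
  rewrite /forest_sum; under [leRHS]eq_bigr do under eq_fsbigr do rewrite weight_expn.
  apply: (@ler_fsum_cover _ _ _ _ B _ (fun sigma => [set G | boundary_forest N m G /\ trace N m G = sigma])
    (fun _ G => G) _ _ fset0) => //.
  - move=> k; by apply: sub_finite_set (finite_boundary_forests m) => G [].
  - by move=> G [bG tG]; exists (trace N m G) => //; exists G.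
rewrite big_seq.
apply: (@le_trans _ _ (\sum_(sigma <- skeletons R N | sigma \in skeletons R N) Znorm N m beta)).
  by apply: ler_sum => sigma; exact: forest_sum_Znorm.
by rewrite -big_seq big_const_seq count_predT iter_addr_0 mulr_natl.
Qed.

End CrossingsFromForests.

(** * Crossings become long at high levels *)

Lemma dot_vertex_lt i j : q i != q j -> dot (q j) (q i) < 1.
Proof.
move=> ij; have := dot_vertex i i; have := dot_vertex j j.
rewrite !subrr mulr0 cos0; case E : (q i) => [a b]; case F : (q j) => [c d].
rewrite /dot /= => cd ab; rewrite ltNge; apply/negP => le1.
have : (a - c) ^+ 2 + (b - d) ^+ 2 <= 0 by nra.
have := sqr_ge0 (a - c); have := sqr_ge0 (b - d) => d0 a0 ad.
have /eqP : (a - c) ^+ 2 = 0 by lra.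
have /eqP : (b - d) ^+ 2 = 0 by lra.
rewrite !sqrf_eq0 !subr_eq0 => /eqP bd /eqP ac.
by move: ij; rewrite E F ac bd eqxx.
Qed.

Lemma edge_length m x y i : adj (level m) x y ->
  `|dot x (q i) - dot y (q i)| <= 2 * rho ^+ m.
Proof.
have /andP [r0 _] := rho_bounds.
suff edge e : e \in level m ->
    forall u v, u \in e -> v \in e -> `|dot u (q i) - dot v (q i)| <= 2 * rho ^+ m.
  by move=> /edge; apply; rewrite !inE eqxx ?orbT.
elim: m e => [|m IH] e.
  have c1 t u : `|dot (q t) (q i) - dot (q u) (q i)| <= 2.
    rewrite !dot_vertex; apply: le_trans (ler_normB _ _) _.
    have cb (z : R) : `|cos z| <= 1 by rewrite ler_norml cos_geN1 cos_le1.
    by have := cb (2 * h * (t - i)%:~R); have := cb (2 * h * (u - i)%:~R); lra.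
  rewrite expr0 mulr1 => /imfsetP [k _ ->] u v.
  by rewrite !inE => /orP [] /eqP -> /orP [] /eqP ->; exact: c1.
move=> /in_levelS [j /image_graphP [e' /IH e'P ->]] u v.
move=> /imfsetP [u' /= ue ->] /imfsetP [v' /= ve ->].
rewrite !dot_homothety opprD addrACA subrr add0r -mulrBr normrM gtr0_norm //.
by rewrite exprS mulrCA ler_pM2l //; exact: e'P.
Qed.

Lemma path_length m x p i : path (adj (level m)) x p ->
  `|dot x (q i) - dot (last x p) (q i)| <= (size p)%:R * (2 * rho ^+ m).
Proof.
elim: p x => [|y p IH] x /=; first by rewrite subrr normr0 mul0r.
move=> /andP [/(@edge_length _ _ _ i) xy /IH yp].
rewrite -natr1 mulrDl mul1r [leRHS]addrC.
exact: le_trans (ler_distD _ _ _) (lerD xy yp).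
Qed.

(** Along the walk the inner product with [q i] drops from 1 to a smaller fixed value, and one edge
    changes it by at most [2 * rho ^+ m]. *)
Lemma saw_length_pinfty i j (K : nat) : q i != q j ->
  exists m0, forall m p, (m0 <= m)%N -> saw (level m) (q i) (q j) p -> (K <= size p)%N.
Proof.
move=> ij; have /andP [r0 r1] := rho_bounds.
have d0 : 0 < 1 - dot (q j) (q i) by rewrite subr_gt0 dot_vertex_lt.
have e0 : 0 < (1 - dot (q j) (q i)) / (2 * K.+1%:R) by rewrite divr_gt0 ?mulr_gt0.
have /cvgrPdist_lt /(_ _ e0) [m0 _ m0P] : rho ^+ m @[m --> \oo] --> (0 : R).
  by apply: cvg_expr; rewrite gtr0_norm.
exists m0 => m p mm /and3P [pp _ /eqP lp].
have := m0P m mm; rewrite /= sub0r normrN gtr0_norm ?exprn_gt0 // ltr_pdivlMr ?mulr_gt0 // => rm.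
have := path_length i pp; rewrite lp dot_vertex subrr mulr0 cos0 gtr0_norm // => pl.
rewrite leqNgt; apply/negP => pK.
have : (size p)%:R <= (K.+1)%:R :> R by rewrite ler_nat; exact: leq_trans (ltnW pK) _.
have p0 : 0 < 2 * rho ^+ m by rewrite mulr_gt0 ?exprn_gt0.
rewrite -(ler_pM2r p0) => /(le_trans pl).
by rewrite (_ : K.+1%:R * _ = rho ^+ m * (2 * K.+1%:R)); [rewrite leNgt rm|ring].
Qed.

(** A walk of length at least [K] loses a factor at most [(w / w') ^+ K] when its edge weight is
    lowered from [w'] to [w], and [K] can be taken arbitrarily large at high levels. *)
Lemma crossing_cvg0 (w w' : R) i j : 0 < w -> w < w' -> q i != q j ->
  (exists B, forall m, crossing w' m i j None <= B) ->
  crossing w m i j None @[m --> \oo] --> (0 : R).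
Proof.
move=> w0 ww ij [B BP]; have w'0 : 0 < w' by exact: lt_trans ww.
have c0 (v : R) m : 0 < v -> 0 <= crossing v m i j None.
  by move=> v0; apply: fsumr_ge0 => p _; rewrite exprn_ge0 // ltW.
have B0 : 0 <= B by apply: le_trans (BP 0%N); exact: c0.
have t1 : `|w / w'| < 1 by rewrite gtr0_norm ?divr_gt0 // ltr_pdivrMr // mul1r.
have t0 : 0 < w / w' by rewrite divr_gt0.
apply/cvgrPdist_le => e e0.
have e1 : 0 < e / (B + 1) by rewrite divr_gt0 // ltr_wpDl.
have /cvgrPdist_lt /(_ _ e1) [K _ /(_ K (leqnn K)) /=] :
  (w / w') ^+ n @[n --> \oo] --> (0 : R) by apply: cvg_expr.
rewrite sub0r normrN gtr0_norm ?exprn_gt0 // ltr_pdivlMr ?ltr_wpDl // => Ke.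
have [m0 m0P] := @saw_length_pinfty i j K ij; exists m0 => // m /= mm.
rewrite sub0r normrN ger0_norm ?c0 //.
apply: (@le_trans _ _ ((w / w') ^+ K * crossing w' m i j None)).
  rewrite /crossing /walk_sum mulr_fsumr.
  apply: ler_fsum => [|p /andP [sp _]]; first exact: finite_saws.
  have Kp := m0P m p mm sp.
  rewrite -{1}(divfK (lt0r_neq0 w'0) w) exprMn ler_pM2r ?exprn_gt0 //.
  by apply: ler_wiXn2l => //; rewrite ?ltW // -(gtr0_norm t0).
apply: le_trans (ltW Ke); apply: ler_wpM2l; first by rewrite ltW ?exprn_gt0.
by apply: le_trans (BP m) _; rewrite lerDl.
Qed.

(** * Positivity at level 0: arcs of the [N]-cycle *)

Lemma base_walk_step a b (n : nat) :
  adj (base_cycle R N) (q (a + dir b * n%:Z)) (q (a + dir b * n.+1%:Z)).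
Proof.
have edge t : [fset q t; q (t + 1)]%fset \in base_cycle R N.
  have [k kN tE] := vertex_shift 0 t; rewrite add0r in tE.
  by apply/imfsetP; exists (Ordinal kN); rewrite //= !vertexD tE.
rewrite /adj; case: b; rewrite /dir /= ?mul1r ?mulN1r.
  rewrite fsetUC (_ : a - n%:Z = a - n.+1%:Z + 1); [exact: edge|lia].
rewrite (_ : a + n.+1%:Z = a + n%:Z + 1); [exact: edge|lia].
Qed.

Definition base_walk a b (n : nat) : seq R[i] :=
  [seq q (a + dir b * k%:Z) | k <- iota 1 n].

Lemma base_walk_neq a b (k t : nat) : (k < N)%N -> (t < N)%N -> k != t ->
  q (a + dir b * k%:Z) != q (a + dir b * t%:Z).
Proof.
move=> kN tN kt; rewrite -!dirE -!symmetry_vertex (inj_eq (@symmetry_inj a b)).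
by rewrite vertex_eqP; [rewrite eqz_nat | lia].
Qed.

Lemma base_walk_saw a b (n : nat) : (n < N)%N ->
  saw (base_cycle R N) (q a) (q (a + dir b * n%:Z)) (base_walk a b n).
Proof.
move=> nN.
have E : q a :: base_walk a b n = [seq q (a + dir b * k%:Z) | k <- iota 0 n.+1].
  by rewrite /= mulr0 addr0.
apply/and3P; split.
- have : forall k, path (adj (base_cycle R N)) (q (a + dir b * k%:Z))
      [seq q (a + dir b * k%:Z) | k <- iota k.+1 n].
    by elim: n {nN E} => //= n IH k; rewrite base_walk_step IH.
  by move=> /(_ 0%N); rewrite mulr0 addr0.
- rewrite E map_inj_in_uniq ?iota_uniq // => k t.
  rewrite !mem_iota !add0n => /andP [_ kn] /andP [_ tn] /eqP kt; apply/eqP.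
  apply: contraTT kt; apply: base_walk_neq; exact: leq_trans nN.
- case: n {nN E} => [|n]; first by rewrite mulr0 addr0.
  by rewrite /base_walk -(addn1 n) iotaD map_cat last_cat /= add1n addn1.
Qed.

Lemma base_walk_saws a b (n : nat) S : (n < N)%N ->
  (forall k : nat, (k <= n)%N -> ~~ S (q (a + dir b * k%:Z))) ->
  saws (level 0) (q a) (q (a + dir b * n%:Z)) S (base_walk a b n).
Proof.
move=> nN av; apply/andP; split; first exact: base_walk_saw.
apply/allP => z; rewrite inE => /orP [/eqP ->|/mapP [k]].
  by have := av 0%N (leq0n n); rewrite mulr0 addr0.
by rewrite mem_iota => /andP [_ kn] ->; apply: av.
Qed.

Lemma crossing0_gt0 (w : R) a b (n : nat) j o : 0 < w -> (n < N)%N ->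
  q j = q (a + dir b * n%:Z) ->
  (forall k : nat, (k <= n)%N -> ~~ avoiding o (q (a + dir b * k%:Z))) ->
  0 < crossing w 0 a j o.
Proof.
move=> w0 nN jE av; rewrite /crossing jE; apply: (@lt_le_trans _ _ (w ^+ size (base_walk a b n))).
  exact: exprn_gt0.
apply: (@ler_fsum_term _ _ _ (fun p => w ^+ size p)); first exact: finite_saws.
  by move=> p _; rewrite exprn_ge0 // ltW.
exact: base_walk_saws.
Qed.

Lemma crossing0_visit_gt0 (w : R) a b (n k : nat) j t : 0 < w -> (n < N)%N ->
  (k <= n)%N -> q j = q (a + dir b * n%:Z) -> q t = q (a + dir b * k%:Z) ->
  0 < crossing w 0 a j None - crossing w 0 a j (Some t).
Proof.
move=> w0 nN kn jE tE; rewrite /crossing jE /=.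
rewrite (walk_sumE w _ _ _ pred0 (q t)).
have -> : walk_sum w (level 0) (q a) (q (a + dir b * n%:Z)) (pred1 (q t)) =
    walk_sum w (level 0) (q a) (q (a + dir b * n%:Z)) [predU1 (q t) & pred0].
  apply: eq_fsbigl; apply/funext => p; rewrite /saws.
  congr (is_true (_ && all _ _)); apply/funext => z /=; by rewrite orbF.
rewrite addrC addKr; apply: (@lt_le_trans _ _ (w ^+ size (base_walk a b n))).
  exact: exprn_gt0.
apply: (@ler_fsum_term _ _ _ (fun p => w ^+ size p)).
- by apply: finite_setIl; exact: finite_saws.
- by move=> p _; rewrite exprn_ge0 // ltW.
split; first exact: base_walk_saws.
rewrite /= tE inE; case: k kn tE => [|k] kn tE; first by rewrite mulr0 addr0 eqxx.
by apply/orP; right; apply/mapP; exists k.+1; rewrite // mem_iota.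
Qed.

(** * The two phases *)

Section Phases.
Context (beta : R).
Let w := expR (- beta).
Local Notation X := (cross_side w).
Local Notation X1 := (cross_side_avoid w).
Local Notation Y := (cross_base w).
Local Notation Y1 := (cross_base_avoid w).

Let w_gt0 : 0 < w.
Proof. exact: expR_gt0. Qed.

Lemma side_neq : q 0 != q s.
Proof. by rewrite eq_sym -(add0r s) vertex_neq //; have := sN_bounds; lia. Qed.

Lemma base_neq : q (- s) != q s.
Proof.
have -> : q s = q (- s + (2 * sN N)%N%:Z) by congr q; rewrite /s; lia.
by rewrite eq_sym vertex_neq //; have := sN_bounds; lia.
Qed.

Lemma Znorm_bounded : (exists B, forall m, X m <= B /\ Y m <= B) ->
  has_ubound (range (fun m => Znorm N m beta)).
Proof.
move=> [B BP].
have X0 m : 0 <= X m by apply: fsumr_ge0 => p _; rewrite exprn_ge0 // ltW.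
have Y0 m : 0 <= Y m by apply: fsumr_ge0 => p _; rewrite exprn_ge0 // ltW.
(* The forest bound compares level [m.+1] with crossings at level [m], so level 0 is listed apart; 6
   is the sum of the coefficients 4 and 2 in [cell_weight]. *)
exists (Num.max (Znorm N 0 beta) ((1 + 6 * B) ^+ N)) => _ [[|m] _ <-].
  by rewrite le_max lexx.
rewrite le_max; apply/orP; right.
have [XB YB] := BP m; have B0 : 0 <= B := le_trans (X0 m) XB.
rewrite /Znorm; elim: (enum_fset _) => [|t r IH].
  by rewrite big_nil exprn_ge0 // addr_ge0 // mulr_ge0.
rewrite big_cons ge_max IH andbT ger0_norm ?forest_sum_ge0 //.
apply: le_trans (forest_sum_le beta m t) _.
have := X0 m; have := Y0 m => y0 x0; rewrite /cell_weight -/w.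
by rewrite lerXn2r ?nnegrE //; lra.
Qed.

Lemma below_betac : 0 <= beta -> (beta%:E < betac R N)%E ->
  ~ exists B, forall m, X m <= B /\ Y m <= B.
Proof.
move=> b0 bc /Znorm_bounded ub; move: bc; rewrite ltNge => /negP; apply.
by apply: ereal_inf_lbound; exists beta.
Qed.

(** Some admissible [b < beta] lies between: crossings are bounded at [b] by the norm of the forest
    sums, and vanish in the limit at the strictly smaller weight. *)
Lemma above_betac i j : (betac R N < beta%:E)%E -> q i != q j ->
  crossing w m i j None @[m --> \oo] --> (0 : R).
Proof.
move=> /ereal_inf_lt [_ [b [b0 [B BP]] <-]]; rewrite lte_fin => bb ij.
apply: (@crossing_cvg0 w (expR (- b))) => //; first by rewrite ltr_expR ltrN2.
exists (#|` skeletons R N|%:R * B) => m.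
apply: le_trans (crossing_le_Znorm b m ij) _.
by apply: ler_wpM2l => //; apply: BP; exists m.
Qed.

Lemma cross_side0_gt0 : 0 < X 0.
Proof.
apply: (@crossing0_gt0 _ _ false (sN N)) => //; last by rewrite add0r mul1r.
by have := sN_bounds; lia.
Qed.

Lemma cross_base0_gt0 : 0 < Y 0.
Proof.
apply: (@crossing0_gt0 _ _ false (2 * sN N)) => //.
  by have [] := sN_bounds.
by congr q; rewrite /dir /= /s; lia.
Qed.

Section Generic.
Hypothesis N_neq3 : N != 3%N.
Hypothesis N_neq5 : N != 5%N.
Let k := kN N.
Let l := lN N.

Let Nkl : N = (4 * k + l)%N /\ sN N = k.+1.
Proof. by have [] := sN_val; rewrite /sN -/k -/l; lia. Qed.

Let k_gt0 : (0 < k)%N.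
Proof. by have [] := Nkl; have [_ +] := sN_val; rewrite -/l; move: N_ge3 N_neq3; lia. Qed.

Let l_bounds : (0 < l < 4)%N.
Proof. by have [] := sN_val. Qed.

(** As [k] and [l] are at least 1, this fails only for [k = l = 1], that is [N = 5]. *)
Let kl : (3 <= k + l)%N.
Proof. by have [+ _] := Nkl; move: k_gt0 l_bounds N_neq5; lia. Qed.

Let X_rec m : X m.+1 = X m ^+ 2 * (Y m ^+ k + Y m ^+ (3 * k + l - 2)).
Proof.
have [NE sE] := Nkl; rewrite cross_side_rec ifF; last by move: k_gt0; lia.
rewrite (_ : (sN N).-1 = k) ?sE // (_ : (N - k.+1).-1 = (3 * k + l - 2)%N); last by lia.
by rewrite subr0; ring.
Qed.

Let Y_rec m : Y m.+1 = X m ^+ 2 * (Y m ^+ (2 * k + l - 3) + Y m ^+ (2 * k + 1)).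
Proof.
have [NE sE] := Nkl; rewrite cross_base_rec ifF; last by move: k_gt0 kl; lia.
rewrite (_ : (2 * sN N).-1 = 2 * k + 1)%N; last by lia.
rewrite (_ : (N - 2 * sN N).-1 = (2 * k + l - 3)%N); last by lia.
by rewrite subr0; ring.
Qed.

Let XY_gt0 m : 0 < X m /\ 0 < Y m.
Proof.
elim: m => [|m [x0 y0]]; first by split; [exact: cross_side0_gt0|exact: cross_base0_gt0].
by rewrite X_rec Y_rec !mulr_gt0 ?addr_gt0 ?exprn_gt0.
Qed.

Let X_gt0 m : 0 < X m. Proof. by have [] := XY_gt0 m. Qed.
Let Y_gt0 m : 0 < Y m. Proof. by have [] := XY_gt0 m. Qed.

Let kR : 1 <= k%:R :> R. Proof. by rewrite ler1n. Qed.
Let l1R : 1 <= l%:R :> R. Proof. by rewrite ler1n; case/andP: l_bounds. Qed.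
Let l3R : l%:R <= 3 :> R. Proof. by rewrite ler_nat; case/andP: l_bounds. Qed.
Let klR : 3 <= k%:R + l%:R :> R. Proof. by rewrite -natrD ler_nat. Qed.

Lemma generic_below_betac : 0 <= beta -> (beta%:E < betac R N)%E ->
  exists l1 l2 : R, [/\ 0 < l1, 0 < l2,
    (fun m => LambdaP R N ^- m * ln (X m)) @ \oo --> l1 &
    (fun m => LambdaP R N ^- m * ln (Y m)) @ \oo --> l2].
Proof.
move=> b0 bc.
have [[m0 m00 Ym0]|bd] := generic_dichotomy k_gt0 l_bounds kl X_gt0 Y_gt0 X_rec Y_rec; last first.
  by case: (below_betac b0 bc).
apply: (generic_supercritical k_gt0 l_bounds kl X_gt0 Y_gt0 X_rec Y_rec m00 Ym0);
rewrite /LambdaP (negbTE N_neq3) (negbTE N_neq5) -/k -/l; move: kR klR => kR' klR';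
set t := k%:R + 3 / 2; set D := t ^+ 2 + _;
have D0 : 0 <= D by rewrite /D; have := sqr_ge0 t; lra.
- have := sqr_sqrtr D0; set r := Num.sqrt D => rD.
  have -> : (t + r) ^+ 2 = t ^+ 2 + 2 * t * r + D by rewrite -rD; ring.
  by rewrite /D /t; field.
have tD : t <= Num.sqrt D.
  rewrite -[leLHS]ger0_norm; last by rewrite /t; lra.
  by rewrite -sqrtr_sqr ler_wsqrtr // /D; lra.
by rewrite /t in tD *; lra.
Qed.

Lemma generic_above_betac : (betac R N < beta%:E)%E ->
  exists l1 l2 : R, [/\ 0 < l1, 0 < l2,
    (fun m => LambdaM R N ^- m * - ln (X m)) @ \oo --> l1 &
    (fun m => LambdaM R N ^- m * - ln (Y m)) @ \oo --> l2].
Proof.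
move=> bc.
have XL : X @ \oo --> (0 : R) by apply: above_betac => //; exact: side_neq.
have YL : Y @ \oo --> (0 : R) by apply: above_betac => //; exact: base_neq.
(* The radicand of [LambdaM] equals [(t - 1) ^+ 2 + 4 - l]. Since [l <= 3] it is positive and
   [r >= |t - 1|]; together with [t >= 3 / 2] this yields all the inequalities required of the
   eigenvalue [t + r]. *)
have [t [r [r0 rD tE rE]]] : exists t r : R, [/\ 0 <= r, r ^+ 2 = (t - 1) ^+ 2 + 4 - l%:R,
    t = k%:R + (l%:R - 1) / 2 & LambdaM R N = t + r].
  exists (k%:R + (l%:R - 1) / 2); set t := k%:R + (l%:R - 1) / 2.
  exists (Num.sqrt (t ^+ 2 - 2 * (k%:R + l%:R - 3))).
  rewrite /LambdaM (negbTE N_neq3) (negbTE N_neq5) -/k -/l; split=> //.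
  have DE : t ^+ 2 - 2 * (k%:R + l%:R - 3) = (t - 1) ^+ 2 + 4 - l%:R.
    by rewrite /t; field.
  rewrite sqr_sqrtr // DE; have := sqr_ge0 (t - 1); move: l1R l3R; lra.
have rt : `|t - 1| <= r.
  by rewrite -(ler_pXn2r (n := 2)) ?nnegrE // real_normK ?num_real // rD; move: l1R l3R; lra.
have r1 : 0 < r.
  by rewrite lt0r r0 andbT -sqrf_eq0 rD gt_eqF //; have := sqr_ge0 (t - 1); move: l1R l3R; lra.
have [t1 t2] : t - 1 <= r /\ 3 / 2 <= t.
  split; [exact: le_trans (ler_norm _) rt|].
  rewrite tE; have [k1|k2] := leqP k 1.
    have k1R : k%:R <= 1 :> R by rewrite lern1.
    by move: klR kR; lra.
  have k2R : 2 <= k%:R :> R by rewrite ler_nat.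
  by move: l1R l3R; lra.
apply: (generic_subcritical k_gt0 l_bounds kl X_gt0 Y_gt0 X_rec Y_rec XL YL); rewrite rE.
- have -> : (t + r) ^+ 2 = t ^+ 2 + 2 * t * r + ((t - 1) ^+ 2 + 4 - l%:R).
    by rewrite -rD; ring.
  by rewrite tE; field.
- lra.
- by rewrite tE in t1 *; lra.
- by rewrite tE; lra.
Qed.

End Generic.

Section Triangle.
Hypothesis N3 : N = 3%N.
Let x := X1.
Let y m := X m - X1 m.

Let sE : s = 1. Proof. by rewrite /s N3. Qed.

Let turn i j : (exists n : int, i = j + 3 * n) -> q i = q j.
Proof. by move=> [n ->]; apply: vertex_eq_mod; exists n; rewrite N3. Qed.

Let base_side m : Y m = X m.
Proof.
rewrite /cross_base /cross_side -[RHS](cross_sideE w m true (- s) None).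
by apply: crossing_periodic => //; apply: turn; exists 1; rewrite sE.
Qed.

Let base_side_avoid m : Y1 m = X1 m.
Proof.
rewrite /cross_base_avoid /cross_side_avoid.
have -> : crossing w m 0 s (Some (- s)) =
    crossing w m (- s) (- s + dir true * s) (Some 0).
  by rewrite cross_sideE; congr crossing; congr Some; rewrite /dir /=; lia.
by apply: crossing_periodic => //; apply: turn; exists 1; rewrite sE.
Qed.

Let XE m : X m = x m + y m. Proof. by rewrite /y addrC subrK. Qed.

Let rX m : X m.+1 = X m ^+ 2 + X m * (X m ^+ 2 - y m ^+ 2).
Proof.
rewrite cross_side_rec base_side (_ : (sN N == 1)%N) ?N3 //=.
by rewrite expr0 expr1 mul1r.
Qed.

Let x_rec m : x m.+1 = (x m + y m) ^+ 2 + x m * (x m ^+ 2 + 2 * x m * y m).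
Proof.
rewrite /x cross_side_avoid_rec base_side base_side_avoid (_ : (sN N == 1)%N) ?N3 //=.
by rewrite !expr0 mulr1 mul1r -XE /clash -/(y m) XE /x; ring.
Qed.

Let y_rec m : y m.+1 = y m * (x m ^+ 2 + 2 * x m * y m).
Proof. by rewrite {1}/y -/(x m.+1) x_rec rX XE; ring. Qed.

Let xy_gt0 m : 0 < x m /\ 0 < y m.
Proof.
elim: m => [|m [x0 y0]]; last first.
  have p0 : 0 < x m ^+ 2 + 2 * x m * y m.
    by apply: addr_gt0; [exact: exprn_gt0 | apply: mulr_gt0; rewrite ?mulr_gt0].
  rewrite x_rec y_rec; split; last exact: mulr_gt0.
  by apply: addr_gt0; [apply: exprn_gt0; exact: addr_gt0 | exact: mulr_gt0].
split.
  (* The edge from [q 0] to [q 1] avoids the third corner; the other arc, of two edges, visits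
     it. *)
  apply: (@crossing0_gt0 _ _ false 1) => //; first by rewrite N3.
    by rewrite sE.
  move=> n n1 /=; rewrite sE vertex_eqP; last by rewrite N3 /dir /=; lia.
  by rewrite /dir /=; lia.
apply: (@crossing0_visit_gt0 _ _ true 2 1) => //.
  by apply: turn; exists 1; rewrite sE.
by rewrite sE.
Qed.

Let x_gt0 m : 0 < x m. Proof. by have [] := xy_gt0 m. Qed.
Let y_gt0 m : 0 < y m. Proof. by have [] := xy_gt0 m. Qed.

Lemma triangle_below_betac : 0 <= beta -> (beta%:E < betac R N)%E ->
  exists2 l : R, 0 < l &
    (fun m => LambdaP R N ^- m * ln (X1 m)) @ \oo --> l /\
    (fun m => LambdaP R N ^- m * ln (X m - X1 m)) @ \oo --> l.
Proof.
move=> b0 bc; rewrite /LambdaP (_ : (N == 3)%N); last by rewrite N3.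
have [[m0 xm0]|[B BP]] := triangular_dichotomy x_gt0 y_gt0 x_rec y_rec.
  exact: (triangular_supercritical x_gt0 y_gt0 x_rec y_rec xm0).
case: (below_betac b0 bc); exists (B + B) => m; rewrite base_side XE.
by have [xB yB] := BP m; rewrite lerD.
Qed.

Lemma triangle_above_betac : (betac R N < beta%:E)%E ->
  exists l1 l2 : R, [/\ 0 < l1, 0 < l2,
    (fun m => LambdaM R N ^- m * - ln (X1 m)) @ \oo --> l1 &
    (fun m => LambdaM R N ^- m * - ln (X m - X1 m)) @ \oo --> l2].
Proof.
move=> bc; rewrite /LambdaM (_ : (N == 3)%N); last by rewrite N3.
apply: (triangular_subcritical x_gt0 y_gt0 x_rec y_rec).
have XL : X @ \oo --> (0 : R) by apply: above_betac => //; exact: side_neq.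
apply: (squeeze_cvgr _ (cvg_cst 0) XL); apply: nearW => m.
by rewrite ltW ?x_gt0 //= XE lerDl ltW ?y_gt0.
Qed.

End Triangle.

Section Pentagon.
Hypothesis N5 : N = 5%N.
Let f1 := X1.
Let f2 m := X m - X1 m.
Let t1 := Y1.
Let t2 m := Y m - Y1 m.

Let sE : s = 2. Proof. by rewrite /s N5. Qed.

Let turn i j : (exists n : int, i = j + 5 * n) -> q i = q j.
Proof. by move=> [n ->]; apply: vertex_eq_mod; exists n; rewrite N5. Qed.

Let XE m : X m = f1 m + f2 m. Proof. by rewrite /f2 addrC subrK. Qed.
Let YE m : Y m = t1 m + t2 m. Proof. by rewrite /t2 addrC subrK. Qed.

Let s1 : (sN N).-1 = 1%N. Proof. by rewrite N5. Qed.
Let s2 : (N - sN N).-1 = 2%N. Proof. by rewrite N5. Qed.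
Let s3 : (2 * sN N).-1 = 3%N. Proof. by rewrite N5. Qed.
Let s4 : (N - 2 * sN N).-1 = 0%N. Proof. by rewrite N5. Qed.
Let s5 : (sN N == 1%N) = false. Proof. by rewrite N5. Qed.
Let s6 : (2 * sN N == N.-1)%N. Proof. by rewrite N5. Qed.

Let f1_rec m : f1 m.+1 = (f1 m + f2 m) ^+ 2 * ((t1 m + t2 m) * (1 + t1 m)).
Proof. by rewrite /f1 cross_side_avoid_rec s1 s2 s5 -XE -YE /t1; ring. Qed.

Let f2_rec m : f2 m.+1 = (f1 m + f2 m) ^+ 2 * ((t1 m + t2 m) * t2 m).
Proof. by rewrite {1}/f2 -/(f1 m.+1) f1_rec cross_side_rec s1 s2 s5 XE YE; ring. Qed.

Let t1_rec m : t1 m.+1 =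
  (f1 m + f2 m) ^+ 2 + ((f1 m + f2 m) ^+ 2 - f2 m ^+ 2) * (t1 m + t2 m) ^+ 2 * t1 m.
Proof. by rewrite /t1 cross_base_avoid_rec s3 s4 s6 -XE -YE /clash /f2; ring. Qed.

Let t2_rec m : t2 m.+1 =
  ((f1 m + f2 m) ^+ 2 - f2 m ^+ 2) * (t1 m + t2 m) ^+ 2 * t2 m.
Proof.
rewrite {1}/t2 -/(t1 m.+1) t1_rec cross_base_rec s3 s4 s6 /clash -/(f2 m) XE YE; ring.
Qed.

Let N_neq3 : (N == 3%N) = false. Proof. by rewrite N5. Qed.
Let N_eq5 : (N == 5%N) = true. Proof. by rewrite N5. Qed.

Let pos m : [/\ 0 < f1 m, 0 < f2 m, 0 < t1 m & 0 < t2 m].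
Proof.
elim: m => [|m [a0 b0 c0 d0]]; last first.
  have D0 : 0 < (f1 m + f2 m) ^+ 2 - f2 m ^+ 2.
    by rewrite (_ : _ - _ = f1 m * (f1 m + 2 * f2 m)) ?mulr_gt0 ?addr_gt0 ?mulr_gt0 //; ring.
  have F0 : 0 < f1 m + f2 m := addr_gt0 a0 b0.
  have T0 : 0 < t1 m + t2 m := addr_gt0 c0 d0.
  have F2 : 0 < (f1 m + f2 m) ^+ 2 := exprn_gt0 2 F0.
  have DT : 0 < ((f1 m + f2 m) ^+ 2 - f2 m ^+ 2) * (t1 m + t2 m) ^+ 2.
    exact: mulr_gt0 D0 (exprn_gt0 2 T0).
  rewrite f1_rec f2_rec t1_rec t2_rec; split; last exact: mulr_gt0.
  - by apply: mulr_gt0 => //; apply: mulr_gt0 => //; exact: addr_gt0.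
  - by apply: mulr_gt0 => //; exact: mulr_gt0.
  - by apply: addr_gt0 => //; exact: mulr_gt0.
split.
(* From 0 to 2 the arc of two edges avoids the corner -2 and that of three edges visits it at its
   second step. From -2 to 2 the single edge avoids 0 and the arc of four edges visits it at its
   second step. *)
- apply: (@crossing0_gt0 _ _ false 2) => //; first by rewrite sE.
  move=> n n2 /=; rewrite sE vertex_eqP; last by rewrite N5 /dir /=; lia.
  by rewrite /dir /=; lia.
- apply: (@crossing0_visit_gt0 _ _ true 3 2) => //; first by rewrite N5.
    by apply: turn; exists 1; rewrite sE.
  by rewrite sE.
- apply: (@crossing0_gt0 _ _ true 1) => //; first by rewrite N5.
    by apply: turn; exists 1; rewrite sE.
  move=> n n1 /=; rewrite sE vertex_eqP; last by rewrite N5 /dir /=; lia.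
  by rewrite /dir /=; lia.
- apply: (@crossing0_visit_gt0 _ _ false 4 2) => //; first by rewrite N5.
    by rewrite sE.
  by rewrite sE.
Qed.

Let f1_gt0 m : 0 < f1 m. Proof. by have [] := pos m. Qed.
Let f2_gt0 m : 0 < f2 m. Proof. by have [] := pos m. Qed.
Let t1_gt0 m : 0 < t1 m. Proof. by have [] := pos m. Qed.
Let t2_gt0 m : 0 < t2 m. Proof. by have [] := pos m. Qed.

Lemma pentagon_below_betac : 0 <= beta -> (beta%:E < betac R N)%E ->
  exists l1 l2 : R, [/\ 0 < l1, 0 < l2,
    (fun m => LambdaP R N ^- m * ln (X1 m)) @ \oo --> l1 /\
    (fun m => LambdaP R N ^- m * ln (X m - X1 m)) @ \oo --> l1,
    (fun m => LambdaP R N ^- m * ln (Y1 m)) @ \oo --> l2 &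
    (fun m => LambdaP R N ^- m * ln (Y m - Y1 m)) @ \oo --> l2].
Proof.
move=> b0 bc; rewrite /LambdaP N_neq3 N_eq5.
have [[m0 m00 [Xm0 Ym0]]|[B BP]] := pentagonal_dichotomy f1_gt0 f2_gt0 t1_gt0 t2_gt0
    f1_rec f2_rec t1_rec t2_rec; last first.
  by case: (below_betac b0 bc); exists B => m; rewrite XE YE; exact: BP.
have r2 : Num.sqrt (17 : R) ^+ 2 = 17 by rewrite sqr_sqrtr.
have r0 := sqrtr_ge0 (17 : R); move: r2 r0; set r := Num.sqrt _ => r2 r0.
apply: (pentagonal_supercritical f1_gt0 f2_gt0 t1_gt0 t2_gt0
    f1_rec f2_rec t1_rec t2_rec m00 Xm0 Ym0); last by nra.
have -> : ((5 + r) / 2) ^+ 2 = (25 + 10 * r + r ^+ 2) / 4 by field.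
by rewrite r2; field.
Qed.

Lemma pentagon_above_betac : (betac R N < beta%:E)%E ->
  exists l1 l2 l3 l4 : R, [/\ 0 < l1, 0 < l2, 0 < l3, 0 < l4 &
    [/\ (fun m => LambdaM R N ^- m * - ln (X1 m)) @ \oo --> l1,
        (fun m => LambdaM R N ^- m * - ln (X m - X1 m)) @ \oo --> l2,
        (fun m => LambdaM R N ^- m * - ln (Y1 m)) @ \oo --> l3 &
        (fun m => LambdaM R N ^- m * - ln (Y m - Y1 m)) @ \oo --> l4]].
Proof.
move=> bc; rewrite /LambdaM N_neq3 N_eq5.
have XL : X @ \oo --> (0 : R) by apply: above_betac => //; exact: side_neq.
have YL : Y @ \oo --> (0 : R) by apply: above_betac => //; exact: base_neq.
have r2 : Num.sqrt (3 : R) ^+ 2 = 3 by rewrite sqr_sqrtr.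
have r0 := sqrtr_ge0 (3 : R); move: r2 r0; set r := Num.sqrt _ => r2 r0.
have XEf : X = (fun m => f1 m + f2 m) by apply/funext => m; exact: XE.
have YEf : Y = (fun m => t1 m + t2 m) by apply/funext => m; exact: YE.
rewrite XEf in XL; rewrite YEf in YL.
apply: (pentagonal_subcritical f1_gt0 f2_gt0 t1_gt0 t2_gt0
    f1_rec f2_rec t1_rec t2_rec XL YL); last by nra.
have -> : (1 + r) ^+ 2 = 1 + 2 * r + r ^+ 2 by ring.
by rewrite r2; ring.
Qed.

End Pentagon.

Lemma crossing_entries (c : nat -> R -> R) : c \in crossing_vector R N ->
  [\/ [/\ N != 3%N, N != 5%N & c^~ beta = X \/ c^~ beta = Y],
      N = 3%N /\ (c^~ beta = X1 \/ c^~ beta = (fun m => X m - X1 m)) |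
      N = 5%N /\ (c^~ beta \in [:: X1; (fun m => X m - X1 m); Y1; (fun m => Y m - Y1 m)])].
Proof.
rewrite /crossing_vector.
have [N3|N3] := eqVneq N 3%N.
  have sE : s = 1 by rewrite /s N3.
  (* For [N = 3] the third corner 2 is the corner [- s = -1] modulo 3. *)
  have Av m : crossing w m 0 1 (Some 2) = X1 m.
    rewrite /cross_side_avoid; apply: crossing_periodic; rewrite ?sE // => z /=.
    by rewrite (@vertex_eq_mod 2 (- 1)) //; exists 1; rewrite N3.
  rewrite !inE => /orP [] /eqP ->; apply: Or32; split=> //; [left|right]; apply/funext => m.
    by rewrite crossing_sum_avoids Av.
  by rewrite crossing_sum_visits Av /cross_side sE.
have [N5|N5] := eqVneq N 5%N.
  have sE : s = 2 by rewrite /s N5.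
  rewrite !inE => c4; apply: Or33; split=> //.
  have eqb (f g : nat -> R) : f = g -> f == g by move=> ->.
  case/or4P: c4 => /eqP ->; apply/or4P;
    [apply: Or41|apply: Or42|apply: Or43|apply: Or44]; apply: eqb; apply/funext => m.
  - by rewrite crossing_sum_avoids /cross_side_avoid sE.
  - by rewrite crossing_sum_visits /cross_side_avoid /cross_side sE.
  - by rewrite crossing_sum_avoids /cross_base_avoid sE.
  - by rewrite crossing_sum_visits /cross_base_avoid /cross_base sE.
rewrite !inE => /orP [] /eqP ->; apply: Or31; split=> //; [left|right];
  by apply/funext => m; rewrite crossing_sum_any.
Qed.

End Phases.
End Geometry.

Theorem theorem6 (R : realType) (N : nat) (hN : (3 <= N)%N)
    (hN4 : ~~ (4 %| N)%N) :
  (forall beta : R, 0 <= beta -> (beta%:E < betac R N)%E ->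
     forall c : nat -> R -> R, c \in crossing_vector R N ->
     exists2 l : R, 0 < l &
       (fun m : nat => LambdaP R N ^- m * ln (c m beta)) @ \oo --> l) /\
  (forall beta : R, (betac R N < beta%:E)%E ->
     forall c : nat -> R -> R, c \in crossing_vector R N ->
     exists2 l : R, 0 < l &
       (fun m : nat => LambdaM R N ^- m * - ln (c m beta)) @ \oo --> l).
Proof.
have entry (L beta : R) (F : R -> R) (c : nat -> R -> R) (u : nat -> R) (l : R) :
    c^~ beta = u -> 0 < l -> (fun m : nat => L ^- m * F (u m)) @ \oo --> l ->
    exists2 l : R, 0 < l & (fun m : nat => L ^- m * F (c m beta)) @ \oo --> l.
  by move=> <- l0 cl; exists l.
split=> [beta b0 bc c|beta bc c] /(crossing_entries hN hN4 beta).
  have {}entry := entry (LambdaP R N) beta (@ln R) c.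
  case=> [[N3 N5 cE]|[N3 cE]|[N5]].
  - have [l1 [l2 [l10 l20 c1 c2]]] := generic_below_betac hN hN4 N3 N5 b0 bc.
    by case: cE => cE; [apply: entry cE l10 c1|apply: entry cE l20 c2].
  - have [l l0 [c1 c2]] := triangle_below_betac hN hN4 N3 b0 bc.
    by case: cE => cE; [apply: entry cE l0 c1|apply: entry cE l0 c2].
  - have [l1 [l2 [l10 l20 [c1 c2] c3 c4]]] := pentagon_below_betac hN hN4 N5 b0 bc.
    rewrite !inE => /or4P [] /eqP cE; [exact: entry cE l10 c1|exact: entry cE l10 c2|
      exact: entry cE l20 c3|exact: entry cE l20 c4].
have {}entry := entry (LambdaM R N) beta (fun x => - ln x) c.
case=> [[N3 N5 cE]|[N3 cE]|[N5]].
- have [l1 [l2 [l10 l20 c1 c2]]] := generic_above_betac hN hN4 N3 N5 bc.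
  by case: cE => cE; [apply: entry cE l10 c1|apply: entry cE l20 c2].
- have [l1 [l2 [l10 l20 c1 c2]]] := triangle_above_betac hN hN4 N3 bc.
  by case: cE => cE; [apply: entry cE l10 c1|apply: entry cE l20 c2].
- have [l1 [l2 [l3 [l4 [l10 l20 l30 l40 [c1 c2 c3 c4]]]]]] := pentagon_above_betac hN hN4 N5 bc.
  rewrite !inE => /or4P [] /eqP cE; [exact: entry cE l10 c1|exact: entry cE l20 c2|
    exact: entry cE l30 c3|exact: entry cE l40 c4].
Qed.
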